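(* Let $X$ be a compact complex manifold and let $\mathcal{L}$ be a line-bundle over $X$. If $a(X)=0$, then the irreducible components of the space of codimension one foliations $$\{[\omega]\in\mathbb{P}H^0(X,\Omega^1_X\otimes\mathcal{L}) \mid \omega\wedge d\omega=0\}$$ are either linear subspaces or rational normal curves.
   Context: Manifolds are connected and line-bundles are holomorphic. The algebraic dimension $a(X)$ is the transcendence degree over $\mathbb{C}$ of the field $\mathbb{C}(X)$ of meromorphic functions on $X$. $\mathbb{P}H^0(X,\Omega^1_X\otimes\mathcal{L})$ is the projective space of complex lines in $H^0(X,\Omega^1_X\otimes\mathcal{L})$. For a section $\omega$ of $\Omega^1_X\otimes\mathcal{L}$, the condition $\omega\wedge d\omega=0$ is understood in local trivializations of $\mathcal{L}$: $\omega$ becomes a local holomorphic $1$-form, and the condition does not depend on the trivialization. A rational normal curve in $\mathbb{P}^k$ is a smooth non-degenerate (not contained in a hyperplane) rational curve of degree $k$; here a curve in the projective space above is called a rational normal curve if it is one in its linear span, the smallest linear subspace containing it. *)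

(* Defs.v *)
From HB Require Import structures.
From mathcomp Require Import all_boot all_order all_algebra.
From mathcomp Require Import all_classical all_reals all_analysis.
From mathcomp Require Import complex.
(* The notations of mpoly clash with those of the analysis library; below
   [mpoly n K] is the polynomial ring {mpoly K[n]} and [ishomog1 d mdeg] is the
   set d.-homog of its homogeneous polynomials of degree d. *)
From mathcomp Require Import -(notations) mpoly.

Set Implicit Arguments.
Unset Strict Implicit.
Unset Printing Implicit Defensive.

Import Order.TTheory GRing.Theory Num.Theory.
Import numFieldNormedType.Exports.
Local Open Scope classical_set_scope.
Local Open Scope card_scope.
Local Open Scope ring_scope.

(* [R[i]], named so that the topology and norm of a [numClosedFieldType] are
   inferred on it. *)
Definition Cplx (R : realType) : numClosedFieldType := R[i].

(* Complex Frechet differentiability at each point of [D], which is always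
   open where this is used. *)
Definition holomorphic_on (R : realType) (n : nat) (W : normedModType (Cplx R))
    (D : set 'rV[Cplx R]_n) (f : 'rV[Cplx R]_n -> W) : Prop :=
  forall z, D z -> differentiable f z.

(* A holomorphic atlas.  The functions [chart i] and [chart_inv i] are total,
   and only meaningful on [chart_dom i] and on its image. *)
Record complexAtlas (R : realType) (n : nat) (X : topologicalType) := {
  chart_index : Type;
  chart_dom : chart_index -> set X;
  chart : chart_index -> X -> 'rV[Cplx R]_n;
  chart_inv : chart_index -> 'rV[Cplx R]_n -> X;
  chart_dom_open : forall i, open (chart_dom i);
  chart_cover : forall x, exists i, chart_dom i x;
  chart_img_open : forall i, open (chart i @` chart_dom i);
  chartK : forall i x, chart_dom i x -> chart_inv i (chart i x) = x;
  chart_continuous : forall i x, chart_dom i x -> {for x, continuous (chart i)};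
  chart_inv_continuous : forall i z, (chart i @` chart_dom i) z ->
    {for z, continuous (chart_inv i)};
  chart_transition : forall i j,
    holomorphic_on (chart i @` (chart_dom i `&` chart_dom j))
                   (chart j \o chart_inv i)
}.

Definition holomorphic_fun (R : realType) (n : nat) (X : topologicalType)
    (M : complexAtlas R n X) (U : set X) (f : X -> Cplx R) : Prop :=
  forall i : chart_index M,
    holomorphic_on (chart i @` (chart_dom i `&` U)) (f \o chart_inv i).

(* A section of the sheaf of meromorphic functions is represented by a total
   function: near every point it is a quotient [g / h] of holomorphic functions,
   [h] vanishing identically on no nonempty open set.  Its values where no such
   [h] is nonzero are irrelevant, and two representatives define the same
   element of C(X) when they agree on a dense open set. *)
Definition meromorphic (R : realType) (n : nat) (X : topologicalType)
    (M : complexAtlas R n X) (f : X -> Cplx R) : Prop :=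
  forall x : X, exists (U : set X) (g h : X -> Cplx R),
    [/\ open U /\ U x,
        holomorphic_fun M U g /\ holomorphic_fun M U h,
        forall O : set X, open O -> O `<=` U -> O !=set0 ->
          exists2 y, O y & h y != 0
      & forall y, U y -> h y != 0 -> f y = g y / h y].

Definition mero_eq (R : realType) (X : topologicalType) (f g : X -> Cplx R) :
    Prop :=
  exists U : set X, [/\ open U, dense U & forall x, U x -> f x = g x].

(* Algebraic independence over C in C(X). *)
Definition mero_alg_indep (R : realType) (X : topologicalType) (d : nat)
    (f : 'I_d -> X -> Cplx R) : Prop :=
  forall P : mpoly d (Cplx R),
    mero_eq (fun x => meval (fun i => f i x) P) (fun=> 0) -> P = 0.

(* a(X) = d : the transcendence degree of C(X), as the maximal size of an
   algebraically independent family. *)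
Definition algebraic_dimension (R : realType) (n : nat) (X : topologicalType)
    (M : complexAtlas R n X) (d : nat) : Prop :=
  let has_indep m := exists f : 'I_m -> X -> Cplx R,
    (forall i, meromorphic M (f i)) /\ mero_alg_indep f in
  has_indep d /\ ~ has_indep d.+1.

(* The fibres, with local trivializations whose transition functions are
   holomorphic (they are nowhere zero because the trivializations are
   bijective).  [triv a x] is only meaningful for [x] in [triv_dom a]. *)
Record lineBundle (R : realType) (n : nat) (X : topologicalType)
    (M : complexAtlas R n X) := {
  fiber : X -> lmodType (Cplx R);
  triv_index : Type;
  triv_dom : triv_index -> set X;
  triv : triv_index -> forall x : X, {linear fiber x -> (Cplx R)^o};
  triv_dom_open : forall a, open (triv_dom a);
  triv_cover : forall x, exists a, triv_dom a x;
  triv_bij : forall a x, triv_dom a x -> bijective (triv a x);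
  triv_transition : forall a b, exists2 g : X -> Cplx R,
    holomorphic_fun M (triv_dom a `&` triv_dom b) g &
    forall x, triv_dom a x -> triv_dom b x ->
      forall v : fiber x, triv b x v = g x * triv a x v
}.

(* Global sections of Omega^1 (x) L.  In the chart [i], with coordinates z_p,
   the section is [sum_p dz_p (x) form_coef i x p] at the point [x]; the
   coefficients are set to 0 off the domain of the chart, so that equal sections
   are equal terms.  The entry [p q] of the library's Jacobian ['J f z] is
   d f_q / d z_p. *)
Record twistedForm (R : realType) (n : nat) (X : topologicalType)
    (M : complexAtlas R n X) (L : lineBundle M) := TwistedForm {
  form_coef : forall (i : chart_index M) (x : X), 'I_n -> fiber L x;
  form_coef_out : forall i x p, ~ chart_dom i x -> form_coef i x p = 0;
  form_coef_change : forall i j x p, chart_dom i x -> chart_dom j x ->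
    form_coef i x p =
      \sum_(q < n) ('J (chart j \o chart_inv i) (chart i x)) p q
                   *: form_coef j x q;
  form_coef_holo : forall i (a : triv_index L) p,
    holomorphic_fun M (chart_dom i `&` triv_dom a)
      (fun x => triv a x (form_coef i x p))
}.

Section TwistedFormModule.
Context (R : realType) (n : nat) (X : topologicalType).
Context (M : complexAtlas R n X) (L : lineBundle M).
Local Notation H0 := (twistedForm L).

Lemma twistedForm_eq (w1 w2 : H0) :
  (forall i x p, form_coef w1 i x p = form_coef w2 i x p) -> w1 = w2.
Proof.
case: w1 w2 => [c1 a1 b1 d1] [c2 a2 b2 d2] /= e.
have ec : c1 = c2.
  apply: functional_extensionality_dep => i.
  apply: functional_extensionality_dep => x.
  by apply: funext => p; exact: e.
rewrite {}ec {e} in a1 b1 d1 *.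
by rewrite (Prop_irrelevance a1 a2) (Prop_irrelevance b1 b2)
  (Prop_irrelevance d1 d2).
Qed.

Definition form_zero : H0.
Proof.
refine (@TwistedForm R n X M L (fun _ _ _ => 0) _ _ _) => //.
- by move=> i j x p _ _; rewrite big1// => q _; rewrite scaler0.
- move=> i a p j z _.
  rewrite (_ : _ \o _ = cst 0); first exact: differentiable_cst.
  by apply: funext => y /=; rewrite linear0.
Defined.

Definition form_lin (c : Cplx R) (w1 w2 : H0) : H0.
Proof.
refine (@TwistedForm R n X M L
    (fun i x p => c *: form_coef w1 i x p + form_coef w2 i x p) _ _ _).
- move=> i x p nix; rewrite (form_coef_out w1 p nix) (form_coef_out w2 p nix).
  by rewrite scaler0 addr0.
- move=> i j x p ix jx.
  rewrite (form_coef_change w1 p ix jx) (form_coef_change w2 p ix jx).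
  rewrite scaler_sumr -big_split/=; apply: eq_bigr => q _.
  by rewrite scalerDr !scalerA mulrC.
- move=> i a p j z Dz.
  have h1 := @form_coef_holo _ _ _ _ _ w1 i a p j z Dz.
  have h2 := @form_coef_holo _ _ _ _ _ w2 i a p j z Dz.
  rewrite (_ : _ \o _ =
    c \*: ((fun x => triv a x (form_coef w1 i x p)) \o chart_inv j)
    + ((fun x => triv a x (form_coef w2 i x p)) \o chart_inv j)).
    by apply: differentiableD => //; exact: differentiableZ.
  by apply: funext => y /=; rewrite linearP.
Defined.

HB.instance Definition _ := gen_eqMixin H0.
HB.instance Definition _ := gen_choiceMixin H0.

Definition form_add (w1 w2 : H0) : H0 := form_lin 1 w1 w2.
Definition form_scale (c : Cplx R) (w : H0) : H0 := form_lin c w form_zero.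
Definition form_opp (w : H0) : H0 := form_scale (-1) w.

Fact form_addA : associative form_add.
Proof. by move=> u v w; apply: twistedForm_eq => i x p /=; rewrite !scale1r addrA. Qed.

Fact form_addC : commutative form_add.
Proof. by move=> u v; apply: twistedForm_eq => i x p /=; rewrite !scale1r addrC. Qed.

Fact form_add0 : left_id form_zero form_add.
Proof. by move=> u; apply: twistedForm_eq => i x p /=; rewrite scaler0 add0r. Qed.

Fact form_addN : left_inverse form_zero form_opp form_add.
Proof.
by move=> u; apply: twistedForm_eq => i x p /=; rewrite scale1r scaleN1r addr0 addNr.
Qed.

HB.instance Definition _ :=
  GRing.isZmodule.Build H0 form_addA form_addC form_add0 form_addN.

Fact form_scaleA a b w : form_scale a (form_scale b w) = form_scale (a * b) w.
Proof. by apply: twistedForm_eq => i x p /=; rewrite !addr0 scalerA. Qed.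

Fact form_scale1 : left_id 1 form_scale.
Proof. by move=> w; apply: twistedForm_eq => i x p /=; rewrite addr0 scale1r. Qed.

Fact form_scaleDr : right_distributive form_scale +%R.
Proof.
by move=> a u v; apply: twistedForm_eq => i x p /=; rewrite !addr0 !scale1r scalerDr.
Qed.

Fact form_scaleDl w : {morph form_scale^~ w : a b / a + b}.
Proof.
by move=> a b; apply: twistedForm_eq => i x p /=; rewrite !addr0 scale1r scalerDl.
Qed.

HB.instance Definition _ := GRing.Zmodule_isLmodule.Build (Cplx R) H0
  form_scaleA form_scale1 form_scaleDr form_scaleDl.

End TwistedFormModule.

(* For a 1-form sum_p al_p dz_p on an open subset of C^n, the coefficients of
   its differential and of its wedge product with its differential. *)
Definition dform (R : realType) (n : nat) (al : 'I_n -> 'rV[Cplx R]_n -> Cplx R)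
    (p q : 'I_n) (z : 'rV[Cplx R]_n) : Cplx R :=
  'D_(delta_mx ord0 p) (al q) z - 'D_(delta_mx ord0 q) (al p) z.

Definition wedge_dform (R : realType) (n : nat)
    (al : 'I_n -> 'rV[Cplx R]_n -> Cplx R) (p q r : 'I_n) (z : 'rV[Cplx R]_n) :
    Cplx R :=
  al p z * dform al q r z - al q z * dform al p r z + al r z * dform al p q z.

Definition local_form (R : realType) (n : nat) (X : topologicalType)
    (M : complexAtlas R n X) (L : lineBundle M) (w : twistedForm L)
    (i : chart_index M) (a : triv_index L) (p : 'I_n) (z : 'rV[Cplx R]_n) :
    Cplx R :=
  triv a (chart_inv i z) (form_coef w i (chart_inv i z) p).

Definition integrable_form (R : realType) (n : nat) (X : topologicalType)
    (M : complexAtlas R n X) (L : lineBundle M) (w : twistedForm L) : Prop :=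
  forall (i : chart_index M) (a : triv_index L) z,
    (chart i @` (chart_dom i `&` triv_dom a)) z ->
    forall p q r, wedge_dform (local_form w i a) p q r z = 0.

Definition line_of (K : closedFieldType) (V : lmodType K) (v : V) : set V :=
  [set c *: v | c in [set: K]].

(* The points of P(V) are the lines of V; a subset of P(V) is a set of lines. *)
Definition proj_space (K : closedFieldType) (V : lmodType K) : set (set V) :=
  [set line_of v | v in [set v : V | v != 0]].
Arguments proj_space {K V}.

(* Homogeneous polynomial functions on V: homogeneous polynomials in finitely
   many linear forms. *)
Definition hom_poly_fun (K : closedFieldType) (V : lmodType K) (d : nat) (f : V -> K) :
    Prop :=
  exists (m : nat) (l : 'I_m -> {linear V -> K^o}) (P : mpoly m K),
    P \is ishomog1 d mdeg /\
    forall v, f v = meval (fun i => l i v) P.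

Definition zariski_closed (K : closedFieldType) (V : lmodType K) (Z : set (set V)) :
    Prop :=
  exists S : set (V -> K), (forall f, S f -> exists d, hom_poly_fun d f) /\
    Z = [set l | proj_space l /\ forall f, S f -> forall v, l v -> f v = 0].

Definition irreducible_set (K : closedFieldType) (V : lmodType K) (Z : set (set V)) :
    Prop :=
  Z !=set0 /\ forall A B, zariski_closed A -> zariski_closed B ->
    Z `<=` A `|` B -> Z `<=` A \/ Z `<=` B.

Definition irreducible_component (K : closedFieldType) (V : lmodType K)
    (F Z : set (set V)) : Prop :=
  [/\ Z `<=` F, irreducible_set Z
    & forall Z', irreducible_set Z' -> Z `<=` Z' -> Z' `<=` F -> Z' = Z].

Definition linear_subspace (K : closedFieldType) (V : lmodType K) (Z : set (set V)) :
    Prop :=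
  exists W : {pred V}, submod_closed W /\
    Z = [set l | proj_space l /\ forall v, l v -> v \in W].

Definition linear_span (K : closedFieldType) (V : lmodType K) (Z : set (set V)) :
    set (set V) :=
  smallest (@linear_subspace K V) Z.

Definition proj_dimension (K : closedFieldType) (V : lmodType K) (Z : set (set V))
    (d : nat) : Prop :=
  let has_chain m := exists c : nat -> set (set V),
    (forall i, (i <= m)%N ->
       [/\ zariski_closed (c i), irreducible_set (c i) & c i `<=` Z]) /\
    (forall i, (i < m)%N -> c i `<` c i.+1) in
  has_chain d /\ ~ has_chain d.+1.

Definition proj_variety (K : closedFieldType) (V : lmodType K) (Z : set (set V)) :
    Prop :=
  zariski_closed Z /\ irreducible_set Z.

Definition proj_curve (K : closedFieldType) (V : lmodType K) (Z : set (set V)) : Prop :=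
  proj_variety Z /\ proj_dimension Z 1.

(* Jacobian criterion: at every point of Z, the tangent space of the affine cone
   over Z, cut out by the differentials of all homogeneous polynomials vanishing
   on Z, has dimension dim Z + 1. *)
Definition smooth_variety (K : closedFieldType) (k : nat)
    (Z : set (set 'rV[K]_k.+1)) : Prop :=
  exists2 d, proj_dimension Z d &
  forall v : 'rV[K]_k.+1, v != 0 -> Z (line_of v) ->
  exists2 T : {vspace 'rV[K]_k.+1}, \dim T = d.+1 &
  forall w, w \in T <->
    forall (e : nat) (P : mpoly k.+1 K),
      P \is ishomog1 e mdeg ->
      (forall u : 'rV[K]_k.+1, Z (line_of u) -> meval (u ord0) P = 0) ->
      \sum_(i < k.+1) w ord0 i * meval (v ord0) (mderiv i P) = 0.

Definition eval_map (K : closedFieldType) (m n : nat) (F : 'I_n -> mpoly m K)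
    (v : 'rV[K]_m) : 'rV[K]_n :=
  \row_j meval (v ord0) (F j).

(* The homogeneous maps F and G define rational maps Z --> Z' and Z' --> Z with
   G o F the identity on a nonempty open subset of the irreducible set Z. *)
Definition rational_retract (K : closedFieldType) (m n : nat)
    (F : 'I_n.+1 -> mpoly m.+1 K) (G : 'I_m.+1 -> mpoly n.+1 K)
    (Z : set (set 'rV[K]_m.+1)) (Z' : set (set 'rV[K]_n.+1)) : Prop :=
  exists A, [/\ zariski_closed A, ~ (Z `<=` A) &
    forall v, v != 0 -> Z (line_of v) -> ~ A (line_of v) ->
      [/\ eval_map F v != 0, Z' (line_of (eval_map F v)),
          eval_map G (eval_map F v) != 0
        & line_of (eval_map G (eval_map F v)) = line_of v]].

Definition birational (K : closedFieldType) (m n : nat)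
    (Z : set (set 'rV[K]_m.+1)) (Z' : set (set 'rV[K]_n.+1)) : Prop :=
  exists (d e : nat) (F : 'I_n.+1 -> mpoly m.+1 K)
      (G : 'I_m.+1 -> mpoly n.+1 K),
    [/\ forall j, F j \is ishomog1 d mdeg,
        forall j, G j \is ishomog1 e mdeg,
        rational_retract F G Z Z' & rational_retract G F Z' Z].

Definition rational_variety_P1 (K : closedFieldType) (k : nat)
    (Z : set (set 'rV[K]_k.+1)) : Prop :=
  birational Z (@proj_space K 'rV[K]_2).

Definition hyperplane (K : closedFieldType) (k : nat) (a : 'rV[K]_k.+1) :
    set (set 'rV[K]_k.+1) :=
  [set l | proj_space l /\
     forall v : 'rV[K]_k.+1, l v -> \sum_(i < k.+1) a ord0 i * v ord0 i = 0].

Definition nondegenerate (K : closedFieldType) (k : nat)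
    (Z : set (set 'rV[K]_k.+1)) : Prop :=
  forall a : 'rV[K]_k.+1, a != 0 -> ~ (Z `<=` hyperplane a).

(* The degree of a curve is the number of its points on a general hyperplane,
   i.e. on the hyperplanes in a nonempty open subset of the dual space. *)
Definition curve_degree (K : closedFieldType) (k : nat)
    (Z : set (set 'rV[K]_k.+1)) (d : nat) : Prop :=
  exists B : set (set 'rV[K]_k.+1),
    [/\ zariski_closed B, ~ (proj_space `<=` B) &
        forall a, a != 0 -> ~ B (line_of a) -> Z `&` hyperplane a #= `I_d].

Definition rational_normal_curve_in (K : closedFieldType) (k : nat)
    (Z : set (set 'rV[K]_k.+1)) : Prop :=
  [/\ proj_curve Z, smooth_variety Z, nondegenerate Z, rational_variety_P1 Z
    & curve_degree Z k].

Definition proj_image (K : closedFieldType) (U V : lmodType K)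
    (phi : {linear U -> V}) (Z : set (set U)) : set (set V) :=
  [set phi @` l | l in Z].

(* A rational normal curve in its linear span, identified with P^k by an
   injective linear map. *)
Definition rational_normal_curve (K : closedFieldType) (V : lmodType K)
    (Z : set (set V)) : Prop :=
  exists (k : nat) (phi : {linear 'rV[K]_k.+1 -> V}) (D : set (set 'rV[K]_k.+1)),
    [/\ injective phi, linear_span Z = proj_image phi proj_space,
        Z = proj_image phi D & rational_normal_curve_in D].

Definition foliation_space (R : realType) (n : nat) (X : topologicalType)
    (M : complexAtlas R n X) (L : lineBundle M) : set (set (twistedForm L)) :=
  [set line_of w | w in [set w : twistedForm L | w != 0 /\ integrable_form w]].
Arguments foliation_space {R n X M} L.

(* Main.v *)
Require Import Defs.
From HB Require Import structures.
From mathcomp Require Import all_boot all_order all_algebra.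
From mathcomp Require Import all_classical all_reals all_analysis.
From mathcomp Require Import complex separable perm.
From mathcomp Require Import -(notations) mpoly.
From mathcomp Require Import ring lra.

(** On a manifold without nonconstant meromorphic functions, forms of
    H^0(X, Omega^1 (x) L) that are linearly independent over C are linearly
    independent at generic points ([generic_independence]).  In a minimal
    counterexample one form is, generically, a combination of the others, which
    are independent there.  By Cramer's rule the coefficients are meromorphic
    functions, hence algebraic over C, hence constant on a nonempty open set; the
    identity theorem then makes the relation global.

    Let Z be an irreducible component, and let w_1, ..., w_k be a basis of its
    linear span with all [w_i] in Z.  At a generic point the w_i are part of a
    coframe, and w_i /\ dw_i = 0 means that dw_i = w_i /\ sum_r e_ir w_r, up to
    more terms of the same kind outside the w_r.  So a combination sum_i x_i w_i
    is integrable there iff, for all p, q, r,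

      x_p x_q (e_qr - e_pr) + x_p x_r (e_pq - e_rq) + x_q x_r (e_rp - e_qp) = 0,

    together with binomial equations x_p x_q (e'_qs - e'_ps) = 0
    ([wedge_normal_form]).  A generic point of Z has only nonzero coordinates, so
    the binomial equations are trivial, and division by x_p x_q x_r makes the
    others linear in the reciprocals 1/x_i: this is the Cremona transformation.

    If none of these linear relations is nontrivial, every combination of the w_i
    is integrable, and Z is the whole linear span by maximality ([linear_case]).
    Otherwise one of the relations expresses some 1/x_r by 1/x_p and 1/x_q.  For
    any other m, e_mr differs from e_pr or from e_qr, so one of the triples
    (p, m, r) and (q, m, r) gives 1/x_m as well ([plane_of_relation]): the
    reciprocals satisfy 1/x_i = a_i / x_p + b_i / x_q on Z, and Z is contained in
    the curve x_i = prod_(j != i) (s a_j + t b_j).  These k products form a basis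
    of the binary forms of degree k - 1, so that the curve is a rational normal
    curve; it satisfies the same equations as Z, so it consists of foliations, and
    Z is this curve by maximality ([curve_case]).

    Holomorphic functions are given by complex differentiability alone, and two
    consequences of Cauchy's theory are used: the identity theorem, and the
    continuity of partial derivatives, by which the integrability of a form
    extends from generic points to all points.  Both come from the single estimate
    |F p| <= 100 sup |F|, the supremum being taken on the boundary of a square
    ([cauchy_estimate]): the first by applying it to F z / z^n, the second by
    applying it to difference quotients.  The estimate itself follows from
    Goursat's theorem and from a lower bound on the integral of 1 / (z - p).

    A set is shown to be irreducible by joining its points by polynomial curves
    ([irreducible_by_curves]).  The properties that make up the definition of a
    rational normal curve are verified on the Veronese parametrization
    (s^k : s^(k-1) t : ... : t^k). *)

Set Implicit Arguments.
Unset Strict Implicit.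
Unset Printing Implicit Defensive.

Import Order.TTheory GRing.Theory Num.Theory.
Import numFieldNormedType.Exports.
Local Open Scope classical_set_scope.
Local Open Scope ring_scope.

(* The filters of neighborhoods in C and C^n, which type class search would
   otherwise look for through the structures carried by [Cplx]. *)
#[local] Hint Extern 0 (Filter _) =>
  solve [refine (@nbhs_filter (Cplx _) _) | refine (@nbhs_filter 'rV[Cplx _]__ _)]
  : typeclass_instances.
#[local] Hint Extern 0 (ProperFilter _) =>
  solve [refine (@nbhs_pfilter (Cplx _) _)] : typeclass_instances.

(** * Integrals along segments *)

Section SegmentIntegral.
Context {R : realType}.
Local Notation K := (Cplx R).
Local Notation Re := (@complex.Re R).
Local Notation Im := (@complex.Im R).
Local Notation N := (@ComplexField.Normc.normc R).
Implicit Types (f g : R -> K) (a b : R).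

(** The norm of [Cplx R] takes its values in [Cplx R]; estimates are carried out
    on the real number [N z]. *)
Lemma normr_normc (z : K) : `|z| = Complex (N z) 0.
Proof. by rewrite normc_def; case: z. Qed.

Lemma normc_ge0 (z : K) : 0 <= N z.
Proof. by have := normr_ge0 z; rewrite normr_normc lecE /= eqxx. Qed.

Lemma le_Re_normc (z : K) : `|Re z| <= N z.
Proof.
case: z => x y /=; rewrite -sqrtr_sqr ler_wsqrtr// lerDl; exact: sqr_ge0.
Qed.

Lemma le_Im_normc (z : K) : `|Im z| <= N z.
Proof.
case: z => x y /=; rewrite -sqrtr_sqr ler_wsqrtr// lerDr; exact: sqr_ge0.
Qed.

Lemma normc_le_ReIm (z : K) : N z <= `|Re z| + `|Im z|.
Proof.
case: z => x y /=.
rewrite -[leRHS]ger0_norm ?addr_ge0// -[leRHS]sqrtr_sqr ler_wsqrtr//.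
rewrite sqrrD !real_normK ?num_real// addrAC lerDl.
by rewrite mulrn_wge0// mulr_ge0.
Qed.

Lemma normc_mul (z w : K) : N (z * w) = N z * N w.
Proof. exact: ComplexField.Normc.normcM. Qed.

Lemma cvg_normc (T : Type) (F : set_system T) {FF : Filter F} (f : T -> K) (l : K) :
  (forall e : R, 0 < e -> \forall x \near F, N (l - f x) < e) <-> f @ F --> l.
Proof.
split=> [h|/cvgrPdist_lt h e e0].
  apply/cvgrPdist_lt => e; rewrite ltcE/= => /andP[/eqP ei er].
  near=> x; rewrite normr_normc ltcE/= ei eqxx/=; near: x; exact: h.
have e0' : 0 < (Complex e 0 : K) by rewrite ltcE/= eqxx.
apply: filterS (h _ e0') => x; by rewrite normr_normc ltcE/= eqxx.
Unshelve. all: by end_near. Qed.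

Lemma continuous_Re : continuous (fun z : K => Re z).
Proof.
move=> z; apply/cvgrPdist_lt => e e0.
have := (@cvg_normc K (nbhs z) (@nbhs_filter K z) id z).2 (@cvg_id _ _) e e0.
by apply: filterS => w; apply: le_lt_trans; have := le_Re_normc (z - w); case: z w => [? ?] [].
Qed.

Lemma continuous_Im : continuous (fun z : K => Im z).
Proof.
move=> z; apply/cvgrPdist_lt => e e0.
have := (@cvg_normc K (nbhs z) (@nbhs_filter K z) id z).2 (@cvg_id _ _) e e0.
by apply: filterS => w; apply: le_lt_trans; have := le_Im_normc (z - w); case: z w => [? ?] [].
Qed.

Lemma continuous_hline (y : R) : continuous (fun t : R => Complex t y : K).
Proof.
move=> t; apply/cvg_normc => e e0.
have /cvgrPdist_lt/(_ e e0) := @cvg_id _ (nbhs t).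
apply: filterS => w; apply: le_lt_trans; apply: le_trans (normc_le_ReIm _) _ => /=.
by rewrite subrr normr0 addr0.
Qed.

Lemma continuous_vline (x : R) : continuous (fun t : R => Complex x t : K).
Proof.
move=> t; apply/cvg_normc => e e0.
have /cvgrPdist_lt/(_ e e0) := @cvg_id _ (nbhs t).
apply: filterS => w; apply: le_lt_trans; apply: le_trans (normc_le_ReIm _) _ => /=.
by rewrite subrr normr0 add0r.
Qed.

Definition rint (f : R -> R) a b : R :=
  (\int[lebesgue_measure]_(t in `[a, b]) f t)%R.

Definition cint f a b : K :=
  Complex (rint (fun t => Re (f t)) a b) (rint (fun t => Im (f t)) a b).

(** Continuity at the points of the segment of a function on the whole line:
    unlike continuity of the restriction, it composes without subspace
    topologies. *)
Definition cont_on (U : topologicalType) (f : R -> U) a b : Prop :=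
  forall t, a <= t <= b -> {for t, continuous f}.

Lemma cont_on_integrable (f : R -> R) a b : cont_on f a b ->
  lebesgue_measure.-integrable `[a, b] (EFin \o f).
Proof.
move=> cf; apply: continuous_compact_integrable; first exact: segment_compact.
apply: continuous_in_subspaceT => t; rewrite inE/= in_itv/= => ht.
exact: cf.
Qed.

Lemma cont_on_Re f a b : cont_on f a b -> cont_on (fun t => Re (f t)) a b.
Proof. move=> cf t /cf ct; apply: continuous_comp => //; exact: continuous_Re. Qed.

Lemma cont_on_Im f a b : cont_on f a b -> cont_on (fun t => Im (f t)) a b.
Proof. move=> cf t /cf ct; apply: continuous_comp => //; exact: continuous_Im. Qed.

Lemma rintD (f g : R -> R) a b : cont_on f a b -> cont_on g a b ->
  rint (fun t => f t + g t) a b = rint f a b + rint g a b.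
Proof. by move=> cf cg; rewrite /rint RintegralD//; exact: cont_on_integrable. Qed.

Lemma rintZ (f : R -> R) c a b : cont_on f a b ->
  rint (fun t => c * f t) a b = c * rint f a b.
Proof. by move=> cf; rewrite /rint RintegralZl//; exact: cont_on_integrable. Qed.

Lemma rint_split (f : R -> R) a m b : a <= m <= b -> cont_on f a b ->
  rint f a b = rint f a m + rint f m b.
Proof.
move=> /andP[am mb] cf; rewrite /rint.
have h : (\int[lebesgue_measure]_(t in `]m, b]) f t)%R =
         (\int[lebesgue_measure]_(t in `[m, b]) f t)%R.
  rewrite Rintegral_itv_obnd_cbnd//.
  apply: integrableS (cont_on_integrable cf) => //.
  by move=> t /=; rewrite !in_itv/= => /andP[mt ->]; rewrite (le_trans am (ltW mt)).
rewrite -h -(@Rintegral_itvB R f (BLeft a) (BRight b) m); last 3 first.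
- exact: cont_on_integrable.
- by rewrite bnd_simp.
- by rewrite bnd_simp.
by rewrite addrC subrK.
Qed.

Lemma rint_cst c a b : a <= b -> rint (fun=> c) a b = c * (b - a).
Proof.
move=> ab; rewrite /rint Rintegral_cst//; congr (_ * _).
transitivity (fine (@lebesgue_measure R [set` `[a, b]%R])) => //.
rewrite lebesgue_measure_itv/= lte_fin.
by case: ltgtP ab => // -> _; rewrite subrr.
Qed.

Lemma rint_le (f g : R -> R) a b : cont_on f a b -> cont_on g a b ->
  (forall t, a <= t <= b -> f t <= g t) -> rint f a b <= rint g a b.
Proof.
move=> cf cg fg; apply: le_Rintegral; [by []|exact: cont_on_integrable..|].
by move=> t /=; rewrite in_itv/=; exact: fg.
Qed.

Lemma rint_bound (f : R -> R) M a b : a <= b -> cont_on f a b ->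
  (forall t, a <= t <= b -> `|f t| <= M) -> `|rint f a b| <= M * (b - a).
Proof.
move=> ab cf fM.
have cc c : cont_on (fun=> c : R) a b by move=> t _; exact: cvg_cst.
rewrite ler_norml -mulNr -!rint_cst//; apply/andP; split; apply: rint_le => //.
  by move=> t /fM; rewrite ler_norml => /andP[].
by move=> t /fM; rewrite ler_norml => /andP[].
Qed.

Lemma rint_id a b : a <= b -> rint id a b = (b ^+ 2 - a ^+ 2) / 2.
Proof.
rewrite le_eqVlt => /predU1P[->|ab].
  by rewrite /rint set_itv1 Rintegral_set1 subrr mul0r.
rewrite /rint /Rintegral (@continuous_FTC2 R id (fun x => x ^+ 2 / 2))//=.
- by rewrite mulrBl.
- by apply: continuous_subspaceT => x; exact: cvg_id.
- split.
  + by move=> x _; apply: derivableM => //; exact: derivable_cst.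
  + apply: cvg_at_right_filter; apply: cvgMl; exact: exprn_continuous.
  + apply: cvg_at_left_filter; apply: cvgMl; exact: exprn_continuous.
- move=> x _; rewrite derive1E.
  suff h : is_derive x 1 (fun y : R => y ^+ 2 / 2) x by exact: derive_val.
  by apply: is_derive_eq; rewrite /GRing.scale/=; lra.
Qed.

End SegmentIntegral.

(** * Integrals around rectangles *)

Section RectangleIntegral.
Context {R : realType}.
Local Notation K := (Cplx R).
Local Notation Re := (@complex.Re R).
Local Notation Im := (@complex.Im R).
Local Notation N := (@ComplexField.Normc.normc R).
Implicit Types (f g : R -> K) (F G : K -> K).

Lemma normc_zero : N 0 = 0. Proof. exact: ComplexField.Normc.normc0. Qed.
Lemma normc_one : N 1 = 1. Proof. exact: ComplexField.Normc.normc1. Qed.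
Lemma normc_i : N (Complex 0 1) = 1.
Proof. by rewrite /= expr0n expr1n add0r sqrtr1. Qed.
Lemma normc_opp (z : K) : N (- z) = N z.
Proof. exact: normcN. Qed.
Lemma normc_add (z w : K) : N (z + w) <= N z + N w.
Proof. exact: le_normcD. Qed.
Lemma normc_sub (z w : K) : N (z - w) <= N z + N w.
Proof. by rewrite -(normc_opp w); exact: normc_add. Qed.
Lemma normc_distC (z w : K) : N (z - w) = N (w - z).
Proof. by rewrite -normc_opp opprB. Qed.
Lemma normc_eq0 (z : K) : N z = 0 -> z = 0.
Proof. exact: ComplexField.Normc.eq0_normc. Qed.
Lemma normc_gt0 (z : K) : z != 0 -> 0 < N z.
Proof.
move=> z0; rewrite lt_def normc_ge0 andbT; apply: contra_neq z0; exact: normc_eq0.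
Qed.

Lemma cintD f g a b : cont_on f a b -> cont_on g a b ->
  cint (fun t => f t + g t) a b = cint f a b + cint g a b.
Proof.
move=> cf cg; rewrite /cint.
rewrite -[RHS]/(Complex (rint _ _ _ + rint _ _ _) (rint _ _ _ + rint _ _ _)).
rewrite -!rintD; [|exact: cont_on_Im|exact: cont_on_Im|exact: cont_on_Re|exact: cont_on_Re].
by congr Complex; congr rint; apply/funext => t; case: (f t) (g t) => ? ? [].
Qed.

Lemma cintZ f c a b : cont_on f a b ->
  cint (fun t => c * f t) a b = c * cint f a b.
Proof.
move=> cf; case: c => u v; rewrite /cint.
rewrite -[RHS]/(Complex (u * rint _ _ _ - v * rint _ _ _) (u * rint _ _ _ + v * rint _ _ _)).
rewrite -mulNr.
have cR := cont_on_Re cf; have cI := cont_on_Im cf.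
have cM (h : R -> R) d : cont_on h a b -> cont_on (fun t => d * h t) a b.
  by move=> ch t /ch cht; apply: cvgMr.
rewrite -!rintZ// -!rintD; try exact: cM.
by congr Complex; congr rint; apply/funext => t; case: (f t) => ? ? /=; ring.
Qed.

Lemma cint_split f a m b : a <= m <= b -> cont_on f a b ->
  cint f a b = cint f a m + cint f m b.
Proof.
move=> amb cf; rewrite /cint (rint_split amb (cont_on_Re cf)).
by rewrite (rint_split amb (cont_on_Im cf)).
Qed.

(** The factor 2 comes from bounding the real and the imaginary parts
    separately. *)
Lemma cint_bound f M a b : a <= b -> cont_on f a b ->
  (forall t, a <= t <= b -> N (f t) <= M) -> N (cint f a b) <= 2 * M * (b - a).
Proof.
move=> ab cf fM; apply: le_trans (normc_le_ReIm _) _.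
have h1 := @rint_bound R (fun t => Re (f t)) M a b ab (cont_on_Re cf).
have h2 := @rint_bound R (fun t => Im (f t)) M a b ab (cont_on_Im cf).
have {}h1 := h1 (fun t ht => le_trans (le_Re_normc _) (fM t ht)).
have {}h2 := h2 (fun t ht => le_trans (le_Im_normc _) (fM t ht)).
by rewrite /cint /=; lra.
Qed.

Lemma cint_affine (A B : K) a b : a <= b ->
  cint (fun t => A + B * Complex t 0) a b =
  A * Complex (b - a) 0 + B * Complex ((b ^+ 2 - a ^+ 2) / 2) 0.
Proof.
move=> ab.
have c1 (z : K) : cont_on (fun=> z) a b by move=> t _; exact: cvg_cst.
have c2 : cont_on (fun t => Complex t 0 : K) a b.
  by move=> t _; exact: continuous_hline.
rewrite cintD; [|exact: c1|by move=> t ht; apply: cvgM; [exact: cvg_cst|exact: c2]].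
rewrite cintZ//; congr (_ + _ * _).
  by rewrite /cint !rint_cst//; case: A => u v; congr Complex => /=; ring.
by rewrite /cint /= rint_cst// mul0r rint_id.
Qed.

(** Counterclockwise; on the vertical sides dz = i dy. *)
Definition rectint F x0 x1 y0 y1 : K :=
  cint (fun t => F (Complex t y0)) x0 x1 - cint (fun t => F (Complex t y1)) x0 x1
  + Complex 0 1 * (cint (fun t => F (Complex x1 t)) y0 y1
                   - cint (fun t => F (Complex x0 t)) y0 y1).

Definition bdry (x0 x1 y0 y1 : R) : set K :=
  [set z | [/\ x0 <= Re z <= x1, y0 <= Im z <= y1 &
    (Re z == x0) || (Re z == x1) || (Im z == y0) || (Im z == y1)]].

Definition cont_bdry F x0 x1 y0 y1 :=
  forall z, bdry x0 x1 y0 y1 z -> {for z, continuous F}.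

Lemma cont_h F x0 x1 y : (forall x, x0 <= x <= x1 -> {for (Complex x y : K), continuous F}) ->
  cont_on (fun t => F (Complex t y)) x0 x1.
Proof.
move=> cF t /cF ct; exact: (cvg_comp _ _ (@continuous_hline R y t) ct).
Qed.

Lemma cont_v F x y0 y1 : (forall y, y0 <= y <= y1 -> {for (Complex x y : K), continuous F}) ->
  cont_on (fun t => F (Complex x t)) y0 y1.
Proof.
move=> cF t /cF ct; exact: (cvg_comp _ _ (@continuous_vline R x t) ct).
Qed.

Lemma cont_bdryP F x0 x1 y0 y1 : x0 <= x1 -> y0 <= y1 -> cont_bdry F x0 x1 y0 y1 ->
  [/\ cont_on (fun t => F (Complex t y0)) x0 x1,
      cont_on (fun t => F (Complex t y1)) x0 x1,
      cont_on (fun t => F (Complex x0 t)) y0 y1 &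
      cont_on (fun t => F (Complex x1 t)) y0 y1].
Proof.
move=> x01 y01 cF; split.
- by apply: cont_h => x xx; apply: cF; split; rewrite /= ?lexx ?eqxx ?orbT.
- by apply: cont_h => x xx; apply: cF; split; rewrite /= ?lexx ?y01 ?eqxx ?orbT.
- by apply: cont_v => x xx; apply: cF; split; rewrite /= ?lexx ?x01 ?eqxx ?orbT.
- by apply: cont_v => x xx; apply: cF; split; rewrite /= ?lexx ?x01 ?eqxx ?orbT.
Qed.

Lemma rectint_splitx F x0 m x1 y0 y1 : x0 <= m <= x1 ->
  cont_on (fun t => F (Complex t y0)) x0 x1 ->
  cont_on (fun t => F (Complex t y1)) x0 x1 ->
  rectint F x0 x1 y0 y1 = rectint F x0 m y0 y1 + rectint F m x1 y0 y1.
Proof.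
move=> hm c0 c1; rewrite /rectint (cint_split hm c0) (cint_split hm c1).
by set i := Complex 0 1; ring.
Qed.

Lemma rectint_splity F x0 x1 y0 m y1 : y0 <= m <= y1 ->
  cont_on (fun t => F (Complex x0 t)) y0 y1 ->
  cont_on (fun t => F (Complex x1 t)) y0 y1 ->
  rectint F x0 x1 y0 y1 = rectint F x0 x1 y0 m + rectint F x0 x1 m y1.
Proof.
move=> hm c0 c1; rewrite /rectint (cint_split hm c0) (cint_split hm c1).
by set i := Complex 0 1; ring.
Qed.

Lemma rectintD F G x0 x1 y0 y1 : x0 <= x1 -> y0 <= y1 ->
  cont_bdry F x0 x1 y0 y1 -> cont_bdry G x0 x1 y0 y1 ->
  rectint (fun z => F z + G z) x0 x1 y0 y1 =
  rectint F x0 x1 y0 y1 + rectint G x0 x1 y0 y1.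
Proof.
move=> hx hy /(cont_bdryP hx hy)[a b c d] /(cont_bdryP hx hy)[a' b' c' d'].
rewrite /rectint (cintD a a') (cintD b b') (cintD c c') (cintD d d').
by set i := Complex 0 1; ring.
Qed.

Lemma rectintZ F k x0 x1 y0 y1 : x0 <= x1 -> y0 <= y1 ->
  cont_bdry F x0 x1 y0 y1 ->
  rectint (fun z => k * F z) x0 x1 y0 y1 = k * rectint F x0 x1 y0 y1.
Proof.
move=> hx hy /(cont_bdryP hx hy)[a b c d].
rewrite /rectint (cintZ _ a) (cintZ _ b) (cintZ _ c) (cintZ _ d).
by set i := Complex 0 1; ring.
Qed.

Lemma rectint_bound F M x0 x1 y0 y1 : x0 <= x1 -> y0 <= y1 ->
  cont_bdry F x0 x1 y0 y1 ->
  (forall z, bdry x0 x1 y0 y1 z -> N (F z) <= M) ->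
  N (rectint F x0 x1 y0 y1) <= 4 * M * ((x1 - x0) + (y1 - y0)).
Proof.
move=> hx hy /(cont_bdryP hx hy)[a b c d] FM; rewrite /rectint.
apply: le_trans (normc_add _ _) _; rewrite normc_mul normc_i mul1r.
have := normc_sub (cint (fun t => F (Complex t y0)) x0 x1) (cint (fun t =>
  F (Complex t y1)) x0 x1).
have := normc_sub (cint (fun t => F (Complex x1 t)) y0 y1) (cint (fun t =>
  F (Complex x0 t)) y0 y1).
have := @cint_bound _ M _ _ hx a; have := @cint_bound _ M _ _ hx b.
have := @cint_bound _ M _ _ hy c; have := @cint_bound _ M _ _ hy d.
move=> e1 e2 e3 e4.
have {}e1 : N (cint (fun t => F (Complex x1 t)) y0 y1) <= 2 * M * (y1 - y0).
  by apply: e1 => t ht; apply: FM; split; rewrite /= ?lexx ?hx ?eqxx ?orbT.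
have {}e2 : N (cint (fun t => F (Complex x0 t)) y0 y1) <= 2 * M * (y1 - y0).
  by apply: e2 => t ht; apply: FM; split; rewrite /= ?lexx ?hx ?eqxx ?orbT.
have {}e3 : N (cint (fun t => F (Complex t y1)) x0 x1) <= 2 * M * (x1 - x0).
  by apply: e3 => t ht; apply: FM; split; rewrite /= ?lexx ?hy ?eqxx ?orbT.
have {}e4 : N (cint (fun t => F (Complex t y0)) x0 x1) <= 2 * M * (x1 - x0).
  by apply: e4 => t ht; apply: FM; split; rewrite /= ?lexx ?hy ?eqxx ?orbT.
lra.
Qed.

(** An affine function has a primitive. This is the part of F that is subtracted
    in Goursat's theorem. *)
Lemma rectint_affine (A B : K) x0 x1 y0 y1 : x0 <= x1 -> y0 <= y1 ->
  rectint (fun z => A + B * z) x0 x1 y0 y1 = 0.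
Proof.
move=> hx hy; rewrite /rectint.
have eh y : (fun t => A + B * Complex t y) =
    (fun t => (A + B * Complex 0 y) + B * Complex t 0).
  apply/funext => t; rewrite -addrA -mulrDr; congr (_ + _ * _).
  by congr Complex => /=; ring.
have ev x : (fun t => A + B * Complex x t) =
    (fun t => (A + B * Complex x 0) + (B * Complex 0 1) * Complex t 0).
  apply/funext => t; rewrite -addrA -mulrA -mulrDr; congr (_ + _ * _).
  by congr Complex => /=; ring.
rewrite !eh !ev !cint_affine//.
by clear eh ev; case: A B => [a a'] [b b']; apply/eqP; rewrite eq_complex /=; apply/andP;
  split; apply/eqP; field.
Qed.

End RectangleIntegral.

(** * Goursat's theorem *)

Arguments rectint : simpl never.
Arguments cint : simpl never.
#[local] Arguments ComplexField.Normc.normc : simpl never.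
Section GoursatTheorem.
Context {R : realType}.
Local Notation K := (Cplx R).
Local Notation Re := (@complex.Re R).
Local Notation Im := (@complex.Im R).
Local Notation N := (@ComplexField.Normc.normc R).
Implicit Types (f g : R -> K) (F G : K -> K) (z w : K).

Lemma nested_segments (a b : nat -> R) :
  (forall n, a n <= a n.+1) -> (forall n, b n.+1 <= b n) ->
  (forall n, a n <= b n) -> exists x, forall n, a n <= x <= b n.
Proof.
move=> ia db ab.
have ha m n : (m <= n)%N -> a m <= a n.
  by move=> /subnK <-; elim: (n - m)%N => // k ih; exact: le_trans ih (ia _).
have hb m n : (m <= n)%N -> b n <= b m.
  by move=> /subnK <-; elim: (n - m)%N => // k ih; exact: le_trans (db _) ih.
have hab m n : a m <= b n.
  apply: le_trans (ha m (maxn m n) (leq_maxl _ _)) _.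
  exact: le_trans (ab _) (hb _ _ (leq_maxr _ _)).
exists (sup (range a)) => n; apply/andP; split.
  apply: ub_le_sup; last by exists n.
  by exists (b 0%N) => _ [m _ <-].
by apply: ge_sup; [exists (a 0%N), 0%N|move=> _ [m _ <-]].
Qed.

(** Complex differentiability with a real epsilon, as Goursat's argument uses
    it; [cdiffP] identifies it with [derivable]. *)
Definition cdiff F (z : K) := exists d : K, forall e : R, 0 < e ->
  exists2 r : R, 0 < r & forall w : K, N (w - z) < r ->
    N (F w - F z - d * (w - z)) <= e * N (w - z).

Lemma cdiff_continuous F z : cdiff F z -> {for z, continuous F}.
Proof.
move=> [d hd]; apply/cvg_normc => e e0; have [r r0 hr] := hd 1 ltr01.
have Nd := normc_ge0 d.
pose q := Num.min r (e / (2 + N d)).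
have q0 : 0 < q by rewrite lt_min r0 divr_gt0//; lra.
have := (@cvg_normc _ K (nbhs z) (@nbhs_filter K z) id z).2 (@cvg_id _ _) q q0.
apply: filterS => w; rewrite lt_min normc_distC => /andP[wr we].
rewrite normc_distC; have h := hr _ wr.
rewrite ltr_pdivlMr in we; last by lra.
have : N (F w - F z) <= N (F w - F z - d * (w - z)) + N (d * (w - z)).
  by rewrite -{1}(subrK (d * (w - z)) (F w - F z)); exact: normc_add.
rewrite normc_mul => h2; have := normc_ge0 (w - z) => h3; nra.
Qed.

Definition half (b : bool) (u v : R) : R * R :=
  if b then ((u + v) / 2, v) else (u, (u + v) / 2).

Lemma halfP b u v : u <= v ->
  [/\ u <= (half b u v).1, (half b u v).1 <= (half b u v).2,
      (half b u v).2 <= v & (half b u v).2 - (half b u v).1 = (v - u) / 2].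
Proof. by move=> uv; case: b => /=; split; lra. Qed.

(** The bound c l^2 is additive when a rectangle is divided in four, so that a
    rectangle violating it has a quarter violating it. *)
Lemma quarter_sum (c l : R) (I1 I2 I3 I4 : K) :
  N I1 <= c * (l / 2) ^+ 2 -> N I2 <= c * (l / 2) ^+ 2 ->
  N I3 <= c * (l / 2) ^+ 2 -> N I4 <= c * (l / 2) ^+ 2 ->
  c * l ^+ 2 < N (I1 + I2 + (I3 + I4)) -> False.
Proof.
have := normc_add (I1 + I2) (I3 + I4); have := normc_add I1 I2; have := normc_add I3 I4.
have -> : (l / 2) ^+ 2 = l ^+ 2 / 4 by rewrite !expr2; lra.
by move: (N _) (N _) (N _) (N _) (N _) (N _) (N _) => *; lra.
Qed.

(** Bisection. If the integral is not 0, it exceeds c L^2 for some c > 0, where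
    L is half the perimeter, hence so does the integral around a quarter of the
    rectangle, around a quarter of this quarter, and so on. These rectangles
    shrink to a point z0. Subtracting the affine approximation of F at z0, whose
    integral is 0, leaves a function bounded by (c / 8) |z - z0| near z0; so the
    integrals are at most (c / 2) L^2, a contradiction. *)
Lemma goursat F x0 x1 y0 y1 : x0 <= x1 -> y0 <= y1 ->
  (forall z : K, x0 <= Re z <= x1 -> y0 <= Im z <= y1 -> cdiff F z) ->
  rectint F x0 x1 y0 y1 = 0.
Proof.
move=> hx hy dF; apply: contrapT => /eqP/normc_gt0 I0.
pose RI (r : (R * R) * (R * R)) := rectint F r.1.1 r.1.2 r.2.1 r.2.2.
pose L (r : (R * R) * (R * R)) := (r.1.2 - r.1.1) + (r.2.2 - r.2.1).
pose r0 := ((x0, x1), (y0, y1)).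
(* The added 1 keeps c defined when the rectangle is reduced to a point. *)
pose c := N (RI r0) / (2 * (L r0 ^+ 2 + 1)).
have L2 : 0 <= L r0 ^+ 2 by exact: sqr_ge0.
have c0 : 0 < c by rewrite divr_gt0//; lra.
have cI : c * L r0 ^+ 2 < N (RI r0).
  have : c * (2 * (L r0 ^+ 2 + 1)) = N (RI r0) by rewrite /c divfK//; lra.
  by move: I0; rewrite -/(RI r0) => I0; nra.
pose ok (r : (R * R) * (R * R)) :=
  [/\ x0 <= r.1.1, r.1.1 <= r.1.2, r.1.2 <= x1 &
   [/\ y0 <= r.2.1, r.2.1 <= r.2.2 & r.2.2 <= y1]].
pose bad r := c * L r ^+ 2 < N (RI r).
pose quarter (b : bool * bool) (r : (R * R) * (R * R)) :=
  (half b.1 r.1.1 r.1.2, half b.2 r.2.1 r.2.2).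
have step r : exists b, ok r -> bad r -> bad (quarter b r).
  apply: contrapT => /forallNP h.
  have okr : ok r by have := h (true, true); rewrite !not_implyE => -[].
  have badr : bad r by have := h (true, true); rewrite !not_implyE => -[_ []].
  have {}h b : N (RI (quarter b r)) <= c * (L r / 2) ^+ 2.
    have := h b; rewrite !not_implyE => -[_ [_ /negP]]; rewrite /bad -leNgt.
    case: okr => h1 h2 h3 [h4 h5 h6].
    case: (halfP b.1 h2) => _ _ _ e1; case: (halfP b.2 h5) => _ _ _ e2.
    rewrite {1}/L /= e1 e2.
    by have -> : (r.1.2 - r.1.1) / 2 + (r.2.2 - r.2.1) / 2 = L r / 2 by rewrite /L; lra.
  case: okr badr => h1 h2 h3 [h4 h5 h6].
  have cF z : r.1.1 <= Re z <= r.1.2 -> r.2.1 <= Im z <= r.2.2 -> {for z, continuous F}.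
    move=> /andP[u1 u2] /andP[v1 v2]; apply/cdiff_continuous/dF.
      by rewrite (le_trans h1 u1) (le_trans u2 h3).
    by rewrite (le_trans h4 v1) (le_trans v2 h6).
  have := h (true, true); have := h (true, false).
  have := h (false, true); have := h (false, false).
  rewrite /bad /RI /quarter /=.
  set mx := (r.1.1 + r.1.2) / 2; set my := (r.2.1 + r.2.2) / 2.
  have hmx : r.1.1 <= mx <= r.1.2 by rewrite /mx; lra.
  have hmy : r.2.1 <= my <= r.2.2 by rewrite /my; lra.
  rewrite (@rectint_splitx _ F r.1.1 mx r.1.2)//; last 2 first.
  - by apply: cont_h => x hx'; apply: cF => /=; clear -hx' hmx hmy h2 h5; lra.
  - by apply: cont_h => x hx'; apply: cF => /=; clear -hx' hmx hmy h2 h5; lra.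
  rewrite (@rectint_splity _ F r.1.1 mx r.2.1 my r.2.2)//; last 2 first.
  - by apply: cont_v => x hx'; apply: cF => /=; clear -hx' hmx hmy h2 h5; lra.
  - by apply: cont_v => x hx'; apply: cF => /=; clear -hx' hmx hmy h2 h5; lra.
  rewrite (@rectint_splity _ F mx r.1.2 r.2.1 my r.2.2)//; last 2 first.
  - by apply: cont_v => x hx'; apply: cF => /=; clear -hx' hmx hmy h2 h5; lra.
  - by apply: cont_v => x hx'; apply: cF => /=; clear -hx' hmx hmy h2 h5; lra.
  by move=> k1 k2 k3 k4; apply: (quarter_sum k1 k2 k3 k4).
have [q hq] := choice step.
pose s n := iter n (fun r => quarter (q r) r) r0.
have oks n : ok (s n).
  elim: n => [|n [h1 h2 h3 [h4 h5 h6]]]; first by split.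
  case: (halfP (q (s n)).1 h2) => e1 e2 e3 _; case: (halfP (q (s n)).2 h5) => e4 e5 e6 _.
  rewrite /ok /= -/(s n); split; [lra|by []|lra|split; [lra|by []|lra]].
have bads n : bad (s n).
  by elim: n => [|n ih] //=; apply: hq.
have Ls n : L (s n) = L r0 / 2 ^+ n.
  elim: n => [|n ih]; first by rewrite expr0 divr1.
  case: (oks n) => h1 h2 h3 [h4 h5 h6].
  case: (halfP (q (s n)).1 h2) => _ _ _ e1; case: (halfP (q (s n)).2 h5) => _ _ _ e2.
  rewrite /L /= -/(s n) e1 e2 exprSr invfM mulrA -ih /L; lra.
have [x hxs] : exists x, forall n, (s n).1.1 <= x <= (s n).1.2.
  apply: nested_segments => n; case: (oks n) => h1 h2 h3 _ //;
  by case: (halfP (q (s n)).1 h2).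
have [y hys] : exists y, forall n, (s n).2.1 <= y <= (s n).2.2.
  apply: nested_segments => n; case: (oks n) => _ _ _ [h1 h2 h3] //;
  by case: (halfP (q (s n)).2 h2).
(* The constant is 1/8 because [rectint_bound] loses a factor 4. *)
have [d hd] := dF (Complex x y) (hxs 0%N) (hys 0%N).
have e0 : 0 < c / 8 by lra.
have [r rpos hr] := hd _ e0.
have Lr0 : 0 <= L r0 by rewrite /L /=; lra.
have [n hn] : exists n, L r0 / 2 ^+ n < r.
  exists (Num.bound (L r0 / r)).
  set n := Num.bound _.
  have h1 : L r0 / r < n%:R by apply: archi_boundP; rewrite divr_ge0// ltW.
  have h2 : n%:R < 2 ^+ n :> R by rewrite -natrX ltr_nat ltn_expl.
  have p2 : 0 < 2 ^+ n :> R by rewrite exprn_gt0.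
  rewrite ltr_pdivrMr// mulrC -ltr_pdivrMr//; exact: lt_trans h1 h2.
case: (oks n) => h1 h2 h3 [h4 h5 h6].
have hN z : (s n).1.1 <= Re z <= (s n).1.2 -> (s n).2.1 <= Im z <= (s n).2.2 ->
    N (z - Complex x y) <= L (s n).
  move=> hz1 hz2; apply: le_trans (normc_le_ReIm _) _.
  have := hxs n; have := hys n; rewrite /L; case: z hz1 hz2 => u v /= hz1 hz2 ? ?.
  by apply: lerD; rewrite ler_norml; lra.
have cF z : (s n).1.1 <= Re z <= (s n).1.2 -> (s n).2.1 <= Im z <= (s n).2.2 ->
   {for z, continuous F}.
  move=> /andP[u1 u2] /andP[v1 v2]; apply/cdiff_continuous/dF.
    by rewrite (le_trans h1 u1) (le_trans u2 h3).
  by rewrite (le_trans h4 v1) (le_trans v2 h6).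
pose z0 : K := Complex x y.
have cA (A B : K) : cont_bdry (fun z => A + B * z) (s n).1.1 (s n).1.2 (s n).2.1 (s n).2.2.
  move=> z _; apply: cvgD; first exact: cvg_cst.
  by apply: cvgM; [exact: cvg_cst|exact: cvg_id].
have cFb : cont_bdry F (s n).1.1 (s n).1.2 (s n).2.1 (s n).2.2.
  by move=> z [z1 z2 _]; exact: cF.
have eI : RI (s n) = rectint (fun z => F z + ((d * z0 - F z0) + (- d) * z))
    (s n).1.1 (s n).1.2 (s n).2.1 (s n).2.2.
  rewrite (rectintD h2 h5 cFb (cA (d * z0 - F z0) (- d))).
  by rewrite (rectint_affine _ _ h2 h5) addr0.
have := bads n; rewrite /bad eI; apply/negP; rewrite -leNgt.
apply: (le_trans (rectint_bound h2 h5 (M := c / 8 * L (s n)) _ _)).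
- by move=> z hz; apply: cvgD; [exact: cFb|exact: cA].
- move=> z [hz1 hz2 _]; have hz := hN _ hz1 hz2.
  have -> : F z + ((d * z0 - F z0) + (- d) * z) = F z - F z0 - d * (z - z0) by ring.
  apply: le_trans (hr _ _) _; first by rewrite (le_lt_trans hz)// Ls.
  by rewrite ler_wpM2l// ltW.
- by rewrite -/(L (s n)) expr2; nra.
Qed.

End GoursatTheorem.

(** * Integrals around a singular point *)

Section PoleIntegral.
Context {R : realType}.
Local Notation K := (Cplx R).
Local Notation Re := (@complex.Re R).
Local Notation Im := (@complex.Im R).
Local Notation N := (@ComplexField.Normc.normc R).
Implicit Types (F G : K -> K) (z w : K).

Lemma nbhs_normc (z : K) (P : set K) :
  nbhs z P <-> exists2 r : R, 0 < r & forall w : K, N (w - z) < r -> P w.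
Proof.
split=> [/nbhs_ballP[e /= e0 he]|[r r0 hr]].
  move: e0 he; case: e => e i; rewrite ltcE/= => /andP[/eqP -> e0] he.
  exists e => // w hw; apply: he; rewrite /ball/= normr_normc ltcE/= eqxx/=.
  by rewrite normc_distC.
have := (@cvg_normc _ K (nbhs z) (@nbhs_filter K z) id z).2 (@cvg_id _ _) r r0.
by apply: filterS => w hw; apply: hr; rewrite normc_distC.
Qed.

Lemma nbhs_neq (z0 z1 : K) : z0 != z1 -> nbhs z0 [set z | z != z1].
Proof.
move=> z01; apply/nbhs_normc; exists (N (z0 - z1)).
  by apply: normc_gt0; rewrite subr_eq0.
by move=> z; apply: contraTneq => ->; rewrite normc_distC ltxx.
Qed.

Lemma normc_inv (z : K) : N z^-1 = (N z)^-1.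
Proof. exact: ComplexField.Normc.normcV. Qed.

Definition cderiv F (z d : K) := forall e : R, 0 < e ->
  exists2 r : R, 0 < r & forall w : K, N (w - z) < r ->
    N (F w - F z - d * (w - z)) <= e * N (w - z).

Lemma cderivP F (z d : K) : cderiv F z d <-> is_derive z 1 F d.
Proof.
have scE (a b : K) : a *: (b : K^o) = a * b by [].
split=> [h|[dF <-] e e0].
  have c : h0^-1 *: ((F \o shift z) (h0 *: (1 : K^o)) - F z) @[h0 --> 0^'] --> d.
    apply/cvg_normc => e e0; have [r r0 hr] := h (e / 2) (divr_gt0 e0 (ltr0Sn _ _)).
    rewrite /dnbhs; apply/nbhs_normc; exists r => // w; rewrite subr0 => wr /= w0.
    have Nw := normc_gt0 w0.
    have {}hr : N (F (w + z) - F z - d * w) <= e / 2 * N w.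
      by have := hr (w + z); rewrite addrK => /(_ wr).
    have -> : d - w^-1 *: (F (w *: (1 : K^o) + z) - F z) =
        - w^-1 * (F (w + z) - F z - d * w).
      by rewrite !scE mulr1; field.
    rewrite normc_mul normc_opp normc_inv mulrC ltr_pdivrMr//; apply: le_lt_trans hr _.
    by rewrite ltr_pM2r//; lra.
  by apply: DeriveDef; [apply/cvg_ex; exists d|exact: cvg_lim c].
have c : h0^-1 *: ((F \o shift z) (h0 *: (1 : K^o)) - F z) @[h0 --> 0^'] --> 'D_1 F z.
  exact: dF.
have h := (cvg_normc _ _).2 c e e0; have {}h := h (dnbhs_filter (0 : K)).
have [r r0 hr] := (nbhs_normc (0 : K) _).1 h; clear h.
exists r => // w wr; have [->|wz] := eqVneq w z.
  by rewrite !subrr mulr0 subrr normc_zero mulr0.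
have w0 : w - z != 0 by rewrite subr_eq0.
have Nw := normc_gt0 w0.
have := hr (w - z); rewrite subr0 => /(_ wr w0) /=.
rewrite !scE mulr1 subrK => h.
have -> : F w - F z - 'D_1 F z * (w - z) =
  - (w - z) * ('D_1 F z - (w - z)^-1 * (F w - F z)) by field.
by rewrite normc_mul normc_opp mulrC ler_pM2r// ltW.
Qed.

Lemma cdiffP F z : cdiff F z <-> derivable F z 1.
Proof.
split=> [[d /cderivP[]//]|dF].
by exists ('D_1 F z); apply/cderivP; exact: DeriveDef.
Qed.

(* All estimates are made on this square, for points of [-2, 2]^2, which are at
   distance at least 1 from its boundary; affine substitutions bring the
   general case there. *)
Local Notation sq := (fun z : K => (- 3 <= Re z <= 3) && (- 3 <= Im z <= 3)).
Local Notation I F := (rectint F (- 3) 3 (- 3) 3).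

(** By Goursat's theorem the integral is also the integral around a square of
    side 2 d centered at p. There |F| <= e / d, so that it is at most 16 e. *)
Lemma goursat_removable F (p : K) : -2 <= Re p <= 2 -> -2 <= Im p <= 2 ->
  (forall z, sq z -> z != p -> cdiff F z) ->
  (forall e : R, 0 < e -> exists2 r : R, 0 < r &
     forall w : K, w != p -> N (w - p) < r -> N (F w) * N (w - p) <= e) ->
  I F = 0.
Proof.
case: p => a b /= ha hb dF small.
apply: contrapT => /eqP/normc_gt0 I0.
have [r r0 hr] := small (N (I F) / 17) (divr_gt0 I0 (ltr0Sn _ _)).
pose d := Num.min (1 / 2) (r / 3).
have d0 : 0 < d by rewrite lt_min; apply/andP; split; lra.
have d1 : d <= 1 / 2 by rewrite ge_min lexx.
have d2 : d <= r / 3 by rewrite ge_min lexx orbT.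
have out z : (Re z < a) || (a < Re z) || (Im z < b) || (b < Im z) ->
    z != (Complex a b : K).
  by apply: contraTneq => -> /=; rewrite !ltxx.
have cF z : sq z -> (Re z < a) || (a < Re z) || (Im z < b) || (b < Im z) ->
    {for z, continuous F}.
  by move=> hz /out ho; apply/cdiff_continuous/dF.
have G x0 x1 y0 y1 : -3 <= x0 -> x0 <= x1 -> x1 <= 3 -> -3 <= y0 -> y0 <= y1 ->
    y1 <= 3 -> (x1 < a) || (a < x0) || (y1 < b) || (b < y0) -> rectint F x0 x1 y0 y1 = 0.
  move=> *; apply: goursat => // z hz1 hz2; apply: dF; first by lra.
  by apply: out; lra.
(* The four rectangles that are cut off avoid p. *)
have eI : I F = rectint F (a - d) (a + d) (b - d) (b + d).
  rewrite (@rectint_splitx _ F (- 3) (a - d) 3 (- 3) 3); last 3 first.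
  - by lra.
  - by apply: cont_h => x hx; apply: cF => /=; lra.
  - by apply: cont_h => x hx; apply: cF => /=; lra.
  rewrite (_ : rectint F (- 3) (a - d) _ _ = 0) ?add0r; last by apply: G; lra.
  rewrite (@rectint_splitx _ F (a - d) (a + d) 3 (- 3) 3); last 3 first.
  - by lra.
  - by apply: cont_h => x hx; apply: cF => /=; lra.
  - by apply: cont_h => x hx; apply: cF => /=; lra.
  rewrite (_ : rectint F (a + d) 3 _ _ = 0) ?addr0; last by apply: G; lra.
  rewrite (@rectint_splity _ F (a - d) (a + d) (- 3) (b - d) 3); last 3 first.
  - by lra.
  - by apply: cont_v => x hx; apply: cF => /=; lra.
  - by apply: cont_v => x hx; apply: cF => /=; lra.
  rewrite (_ : rectint F _ _ (- 3) (b - d) = 0) ?add0r; last by apply: G; lra.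
  rewrite (@rectint_splity _ F (a - d) (a + d) (b - d) (b + d) 3); last 3 first.
  - by lra.
  - by apply: cont_v => x hx; apply: cF => /=; lra.
  - by apply: cont_v => x hx; apply: cF => /=; lra.
  by rewrite (_ : rectint F _ _ (b + d) 3 = 0) ?addr0//; apply: G; lra.
have hout z : bdry (a - d) (a + d) (b - d) (b + d) z ->
    (Re z < a) || (a < Re z) || (Im z < b) || (b < Im z).
  by move=> [hz1 hz2 hz3]; case/orP: hz3 => [/orP[/orP[]|]|] /eqP; lra.
have cb : cont_bdry F (a - d) (a + d) (b - d) (b + d).
  by move=> z hz; apply: cF (hout z hz); case: hz => hz1 hz2 _; lra.
have ad : a - d <= a + d by lra.
have bd : b - d <= b + d by lra.
have := rectint_bound ad bd (M := N (I F) / 17 / d) cb; rewrite -eI.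
have e16 : 4 * (N (I F) / 17 / d) * (a + d - (a - d) + (b + d - (b - d))) =
    16 / 17 * N (I F).
  by field; rewrite gt_eqF.
rewrite e16 => h.
suff h2 : N (I F) <= 16 / 17 * N (I F) by move: I0 h2; lra.
apply: h => z hz; have hz' := hout z hz.
have [hz1 hz2 hz3] := hz.
have Nd : d <= N (z - Complex a b).
  have := le_Re_normc (z - Complex a b); have := le_Im_normc (z - Complex a b).
  have -> : Re (z - Complex a b) = Re z - a by case: z {hz hz' hz1 hz2 hz3}.
  have -> : Im (z - Complex a b) = Im z - b by case: z {hz hz' hz1 hz2 hz3}.
  rewrite !ler_norml => /andP[u1 u2] /andP[v1 v2].
  clear -d0 u1 u2 v1 v2 hz3; by case/orP: hz3 => [/orP[/orP[]|]|] /eqP; lra.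
have Nr : N (z - Complex a b) < r.
  apply: le_lt_trans (normc_le_ReIm _) _.
  have -> : Re (z - Complex a b) = Re z - a by case: z {hz hz' hz1 hz2 hz3 Nd}.
  have -> : Im (z - Complex a b) = Im z - b by case: z {hz hz' hz1 hz2 hz3 Nd}.
  have : `|Re z - a| <= d by rewrite ler_norml; clear -hz1 hz2; lra.
  have : `|Im z - b| <= d by rewrite ler_norml; clear -hz1 hz2; lra.
  by lra.
rewrite ler_pdivlMr//; apply: le_trans (hr _ (out _ hz') Nr).
by rewrite ler_wpM2l// normc_ge0.
Qed.

Lemma cont_inv_sub (p z : K) : z != p -> {for z, continuous (fun z => (z - p)^-1)}.
Proof.
move=> zp; apply: cvgV; first by rewrite subr_eq0.
by apply: cvgB; [exact: cvg_id|exact: cvg_cst].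
Qed.

Lemma bdry_far (p z : K) : -2 <= Re p <= 2 -> -2 <= Im p <= 2 ->
  bdry (- 3) 3 (- 3) 3 z -> 1 <= N (z - p) /\ z != p.
Proof.
move=> hp hq [hz1 hz2 hz3].
have h1 : 1 <= N (z - p).
  have := le_Re_normc (z - p); have := le_Im_normc (z - p).
  have -> : Re (z - p) = Re z - Re p by case: z {hz1 hz2 hz3}; case: p {hp hq}.
  have -> : Im (z - p) = Im z - Im p by case: z {hz1 hz2 hz3}; case: p {hp hq}.
  rewrite !ler_norml => /andP[u1 u2] /andP[v1 v2].
  by case/orP: hz3 => [/orP[/orP[]|]|] /eqP; lra.
split=> //; rewrite -subr_eq0; apply: contraTneq h1 => ->.
by rewrite normc_zero -ltNge ltr01.
Qed.

(** On a side of the square [-3, 3]^2 at distance v from p, the imaginary part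
    of dz / (z - p) is v / (u^2 + v^2), where u is the distance along the side. *)
Lemma side_kernel_ge (u v : R) : -5 <= u <= 5 -> 1 <= v <= 5 ->
  1 / 50 <= v / (u ^+ 2 + v ^+ 2).
Proof. by move=> hu hv; rewrite ler_pdivlMr; nra. Qed.

(** The integral is 2 i pi; a lower bound is enough here. Each side contributes
    at least 6 / 50 to the imaginary part. *)
Lemma rect_pole_ge (p : K) : -2 <= Re p <= 2 -> -2 <= Im p <= 2 ->
  12 / 25 <= N (I (fun z => (z - p)^-1)).
Proof.
move=> hp hq; apply: le_trans (le_Im_normc _); apply: le_trans (ler_norm _).
have cb : cont_bdry (fun z => (z - p)^-1) (- 3) 3 (- 3) 3.
  by move=> z /(bdry_far hp hq)[_]; exact: cont_inv_sub.
have i33 : (-3 : R) <= 3 by lra.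
have [ch0 ch1 cv0 cv1] := cont_bdryP i33 i33 cb.
case: p hp hq {cb} ch0 ch1 cv0 cv1 => a b /= hp hq ch0 ch1 cv0 cv1.
rewrite /rectint /cint /=.
rewrite mul0r mul1r add0r.
have cc (c : R) : cont_on (fun=> c : R) (-3) 3 by move=> t _; exact: cvg_cst.
have lo (f : R -> R) : cont_on f (- 3) 3 ->
    (forall t, -3 <= t <= 3 -> 1 / 50 <= f t) -> 6 / 50 <= rint f (- 3) 3.
  move=> cf hf; have -> : 6 / 50 = rint (fun=> 1 / 50) (- 3) 3 :> R.
    by rewrite rint_cst//; lra.
  exact: rint_le.
have up (f : R -> R) : cont_on f (- 3) 3 ->
    (forall t, -3 <= t <= 3 -> f t <= - (1 / 50)) -> rint f (- 3) 3 <= - (6 / 50).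
  move=> cf hf; have -> : - (6 / 50) = rint (fun=> - (1 / 50)) (- 3) 3 :> R.
    by rewrite rint_cst//; lra.
  exact: rint_le.
have b0 := lo _ (cont_on_Im ch0); have b1 := up _ (cont_on_Im ch1).
have b2 := lo _ (cont_on_Re cv1); have b3 := up _ (cont_on_Re cv0).
have l0 t : -3 <= t <= 3 -> 1 / 50 <= - ((- 3 - b) / ((t - a) ^+ 2 + (- 3 - b) ^+ 2)).
  move=> ht; rewrite -mulNr -(sqrrN (- 3 - b)).
  by apply: side_kernel_ge; clear -ht hp hq; lra.
have l1 t : -3 <= t <= 3 -> - ((3 - b) / ((t - a) ^+ 2 + (3 - b) ^+ 2)) <= - (1 / 50).
  by move=> ht; rewrite lerN2; apply: side_kernel_ge; clear -ht hp hq; lra.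
have l2 t : -3 <= t <= 3 -> 1 / 50 <= (3 - a) / ((3 - a) ^+ 2 + (t - b) ^+ 2).
  move=> ht; rewrite [_ ^+ 2 + _]addrC.
  by apply: side_kernel_ge; clear -ht hp hq; lra.
have l3 t : -3 <= t <= 3 -> (- 3 - a) / ((- 3 - a) ^+ 2 + (t - b) ^+ 2) <= - (1 / 50).
  move=> ht; rewrite -[leLHS]opprK lerN2 [_ ^+ 2 + _]addrC -mulNr -(sqrrN (- 3 - a)).
  by apply: side_kernel_ge; clear -ht hp hq; lra.
have {b0 l0} := b0 l0; have {b1 l1} := b1 l1.
have {b2 l2} := b2 l2; have {b3 l3} := b3 l3.
clear; lra.
Qed.

End PoleIntegral.

(** * Cauchy's estimate *)

Section CauchyEstimate.
Context {R : realType}.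
Local Notation K := (Cplx R).
Local Notation Re := (@complex.Re R).
Local Notation Im := (@complex.Im R).
Local Notation N := (@ComplexField.Normc.normc R).
Implicit Types (F G : K -> K) (z w : K).
Local Notation sq := (fun z : K => (- 3 <= Re z <= 3) && (- 3 <= Im z <= 3)).
Local Notation I F := (rectint F (- 3) 3 (- 3) 3).

(** The function (F z - F p) / (z - p) is o(1 / |z - p|) at p, so its integral
    is 0. Hence F p times the integral of 1 / (z - p), which is at least 12/25
    in modulus, equals the integral of F z / (z - p), which is at most 48 M. *)
Lemma cauchy_estimate F (p : K) (M : R) : -2 <= Re p <= 2 -> -2 <= Im p <= 2 ->
  (forall z, sq z -> z != p -> cdiff F z) -> {for p, continuous F} ->
  (forall z, bdry (- 3) 3 (- 3) 3 z -> N (F z) <= M) ->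
  N (F p) <= 100 * M.
Proof.
move=> hp hq dF cF FM.
have i33 : (-3 : R) <= 3 by lra.
have bsq z : bdry (- 3) 3 (- 3) 3 z -> sq z by case=> -> ->.
pose k z := (z - p)^-1.
have ck : cont_bdry k (- 3) 3 (- 3) 3.
  by move=> z /(bdry_far hp hq)[_]; exact: cont_inv_sub.
have cFb : cont_bdry F (- 3) 3 (- 3) 3.
  by move=> z hz; apply/cdiff_continuous/dF; [exact: bsq|have [] := bdry_far hp hq hz].
have cFk : cont_bdry (fun z => F z * k z) (- 3) 3 (- 3) 3.
  by move=> z hz; apply: cvgM; [exact: cFb|exact: ck].
have cpk : cont_bdry (fun z => - F p * k z) (- 3) 3 (- 3) 3.
  by move=> z hz; apply: cvgM; [exact: cvg_cst|exact: ck].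
have e0 : I (fun z => F z * k z + - F p * k z) = 0.
  apply: (goursat_removable hp hq).
    move=> z hz zp; apply/cdiffP.
    have dk : derivable k z 1.
      apply: derivableV; first by rewrite subr_eq0.
      by apply: derivableB; [exact: derivable_id|exact: derivable_cst].
    have dFz : derivable F z 1 by apply/cdiffP; exact: dF.
    have d1 : derivable (F * k) z 1 := derivableM dFz dk.
    have d2 : derivable (cst (- F p) * k) z 1 :=
      derivableM (@derivable_cst _ _ _ (- F p : K^o) z 1) dk.
    exact: (derivableD d1 d2).
  move=> e epos.
  have h := (@cvg_normc R K (nbhs p) (@nbhs_filter K p) F (F p)).2 cF e epos.
  have [r r0 hr] := (nbhs_normc p _).1 h; clear h.
  exists r => // w wp wr; rewrite -mulrDl -normc_mul /k divfK ?subr_eq0//.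
  by rewrite -normc_opp opprD opprK addrC; apply/ltW/hr.
rewrite (rectintD i33 i33 cFk cpk) (rectintZ _ i33 i33 ck) in e0.
have e1 : I (fun z => F z * k z) = F p * I k.
  by apply/eqP; rewrite -subr_eq0 -mulNr e0.
have h1 := rect_pole_ge hp hq.
have h2 : N (I (fun z => F z * k z)) <= 4 * M * (3 - - 3 + (3 - - 3)).
  apply: rectint_bound => // z hz; rewrite normc_mul normc_inv.
  have [f1 f2] := bdry_far hp hq hz; have NF := normc_ge0 (F z).
  rewrite ler_pdivrMr; last by lra.
  by have := FM z hz; nra.
rewrite e1 normc_mul in h2; have := normc_ge0 (F p) => h3.
by move: h1; rewrite -/k => h1; nra.
Qed.

End CauchyEstimate.

(** * Identity theorem and derivatives in one variable *)

Section CauchyConsequences.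
Context {R : realType}.
Local Notation K := (Cplx R).
Local Notation Re := (@complex.Re R).
Local Notation Im := (@complex.Im R).
Local Notation N := (@ComplexField.Normc.normc R).
Implicit Types (F G : K -> K) (z w : K).
Local Notation sq := (fun z : K => (- 3 <= Re z <= 3) && (- 3 <= Im z <= 3)).

Lemma cont_on_bounded (f : R -> K) a b : a <= b -> cont_on f a b ->
  exists M : R, forall t, a <= t <= b -> N (f t) <= M.
Proof.
move=> ab cf.
have cN : {within `[a, b], continuous (fun t => N (f t))}.
  apply: continuous_in_subspaceT => t; rewrite inE/= in_itv/= => /cf ct.
  apply/cvgrPdist_lt => e e0.
  have := (@cvg_normc R R (nbhs t) (@nbhs_filter R t) f (f t)).2 ct e e0.
  apply: filterS => s; apply: le_lt_trans.
  have := normc_add (f s - f t) (f t); have := normc_add (f t - f s) (f s).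
  by rewrite !subrK (normc_distC (f s)) ler_norml; lra.
have [c _ hc] := EVT_max ab cN.
by exists (N (f c)) => t ht; apply: hc; rewrite in_itv.
Qed.

Lemma cdiff_bounded_bdry F : (forall z, sq z -> cdiff F z) ->
  exists M : R, forall z, bdry (- 3) 3 (- 3) 3 z -> N (F z) <= M.
Proof.
move=> dF; have i33 : (-3 : R) <= 3 by lra.
have cb : cont_bdry F (- 3) 3 (- 3) 3.
  by move=> z [hz1 hz2 _]; apply/cdiff_continuous/dF; rewrite hz1.
have [/(cont_on_bounded i33)[m1 h1] /(cont_on_bounded i33)[m2 h2]
  /(cont_on_bounded i33)[m3 h3] /(cont_on_bounded i33)[m4 h4]] := cont_bdryP i33 i33 cb.
exists (`|m1| + `|m2| + `|m3| + `|m4|) => -[x y] [/= hx hy hb].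
have := ler_norm m1; have := ler_norm m2; have := ler_norm m3; have := ler_norm m4.
have := normr_ge0 m1; have := normr_ge0 m2; have := normr_ge0 m3; have := normr_ge0 m4.
case/orP: hb => [/orP[/orP[]|]|] /eqP e.
- by have := h3 y hy; rewrite e; lra.
- by have := h4 y hy; rewrite e; lra.
- by have := h1 x hx; rewrite e; lra.
- by have := h2 x hx; rewrite e; lra.
Qed.

Lemma square_bdry_ge z : bdry (- 3) 3 (- 3) 3 z -> 3 <= N z.
Proof.
case=> _ _; have := le_Re_normc z; have := le_Im_normc z.
rewrite !ler_norml => /andP[u1 u2] /andP[v1 v2].
by clear -u1 u2 v1 v2; case/orP => [/orP[/orP[]|]|] /eqP; lra.
Qed.

(** The estimate at 1 for F z / z^n, where |z| >= 3 on the boundary, gives |F 1|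
    <= 100 M / 3^n for all n. *)
Lemma identity_square F (r : R) : (forall z, sq z -> cdiff F z) -> 0 < r ->
  (forall z, N z < r -> F z = 0) -> F 1 = 0.
Proof.
move=> dF r0 F0; have [M hM] := cdiff_bounded_bdry dF.
have h1 n : N (F 1) <= 100 * (M / 3 ^+ n).
  (* The quotient is 0 near 0, hence differentiable there too. *)
  have -> : F 1 = F 1 * (1 ^+ n)^-1 by rewrite expr1n invr1 mulr1.
  apply: (@cauchy_estimate R (fun z => F z * (z ^+ n)^-1) 1) => /=; try by lra.
  - move=> z hz _; have [z0|z0] := eqVneq z 0.
      exists 0 => e e0; exists r => // w; rewrite z0 subr0 mul0r subr0 => wr.
      by rewrite !F0 ?normc_zero// !mul0r subr0 normc_zero mulr_ge0 ?normc_ge0// ltW.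
    apply/cdiffP; have d1 : derivable F z 1 by apply/cdiffP; exact: dF.
    have d2 : derivable (fun y : K => (y ^+ n)^-1) z 1.
      apply: derivableV; first by rewrite expf_neq0.
      exact: exprn_derivable.
    exact: (derivableM d1 d2).
  - apply: cvgM; first by apply/cdiff_continuous/dF => /=; lra.
    apply: cvgV; first by rewrite expr1n oner_neq0.
    by apply: (@cdiff_continuous _ (fun z : K => z ^+ n)); apply/cdiffP; exact: exprn_derivable.
  - move=> z hz; have z3 := square_bdry_ge hz.
    rewrite normc_mul normc_inv.
    have -> : N (z ^+ n) = N z ^+ n.
      by elim: n => [|n ih]; rewrite ?expr0 ?normc_one// !exprS normc_mul ih.
    have p3 : 0 < (3 : R) ^+ n by rewrite exprn_gt0//; lra.
    have le3 : 3 ^+ n <= N z ^+ n by rewrite lerXn2r ?nnegrE//; lra.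
    apply: ler_pM; [exact: normc_ge0|by rewrite invr_ge0 exprn_ge0// normc_ge0|exact: hM|].
    by rewrite lef_pV2 ?posrE//; lra.
apply: contrapT => /eqP/normc_gt0 F1.
have := archi_boundP (divr_ge0 (mulr_ge0 (ler0n _ 100) (normr_ge0 M)) (ltW F1)).
set n := Num.bound _ => hn; have {h1} := h1 n.
have h2 : n%:R < 3 ^+ n :> R by rewrite -natrX ltr_nat ltn_expl.
have p3 : 0 < (3 : R) ^+ n by rewrite exprn_gt0//; lra.
rewrite mulrA ler_pdivlMr// => h3; rewrite ltr_pdivrMr// in hn.
have := ler_norm M; nra.
Qed.

(** The estimate at 0 for the difference quotient, extended by the derivative:
    on the boundary it is at most 2 M / 3 in modulus. *)
Lemma cauchy_derivative F (d : K) (M : R) : (forall z, sq z -> cdiff F z) ->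
  cderiv F 0 d -> (forall z, bdry (- 3) 3 (- 3) 3 z -> N (F z) <= M) ->
  N (F 0) <= M -> N d <= 100 * M.
Proof.
move=> dF dd FM F0M.
pose u z := if z == 0 then d else (F z - F 0) / z.
have -> : d = u 0 by rewrite /u eqxx.
have u_near z : z != 0 -> \forall w \near z, (F w - F 0) / w = u w.
  move=> z0; apply/nbhs_normc; exists (N z) => [|w]; first exact: normc_gt0.
  by rewrite /u; case: eqVneq => // ->; rewrite sub0r normc_opp ltxx.
apply: cauchy_estimate => /=; try by lra.
- move=> z hz z0; apply/cdiffP.
  have d1 : derivable F z 1 by apply/cdiffP; exact: dF.
  have d2 : derivable (fun y : K => y^-1) z 1.
    by apply: derivableV; [exact: z0|exact: derivable_id].
  have d3 : derivable (fun y => (F y - F 0) / y) z 1.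
    have d0 : derivable (fun y => F y - F 0) z 1.
      by apply: derivableB; [exact: d1|exact: derivable_cst].
    exact: (derivableM d0 d2).
  by apply: near_eq_derivable d3; exact: u_near.
- apply/(@cvg_normc R K (nbhs (0 : K)) (@nbhs_filter K 0)) => e e0;
  have [r r0 hr] := dd (e / 2) (divr_gt0 e0 (ltr0Sn _ _)).
  apply/nbhs_normc; exists r => // w wr; rewrite /u eqxx.
  case: eqVneq => [_|w0]; first by rewrite subrr normc_zero.
  have := hr w wr; rewrite subr0 => h.
  have -> : d - (F w - F 0) / w = - (F w - F 0 - d * w) / w by field.
  rewrite normc_mul normc_inv normc_opp ltr_pdivrMr ?normc_gt0//.
  by apply: le_lt_trans h _; rewrite ltr_pM2r ?normc_gt0//; lra.
- move=> z hz; have z1 := square_bdry_ge hz.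
  have z0 : z != 0 by apply: contraTneq z1 => ->; rewrite normc_zero; lra.
  rewrite /u (negbTE z0) normc_mul normc_inv ler_pdivrMr; last by lra.
  apply: le_trans (normc_sub _ _) _; have := FM z hz; have := normc_ge0 (F 0); nra.
Qed.

End CauchyConsequences.

(** * Holomorphic functions of several variables *)

Section SeveralVariables.
Context {R : realType}.
Local Notation K := (Cplx R).
Local Notation Re := (@complex.Re R).
Local Notation Im := (@complex.Im R).
Local Notation N := (@ComplexField.Normc.normc R).
Context {n : nat}.
Implicit Types (f : 'rV[K]_n -> K) (c y v w : 'rV[K]_n).
Local Notation sq := (fun z : K => (- 3 <= Re z <= 3) && (- 3 <= Im z <= 3)).

Lemma line_quotient f y v (t : K) :
  (fun h : K => h^-1 *: (((fun s : K => f (y + s *: v)) \o shift t) (h *: (1 : K^o)) - f (y + t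
    *: v)))
  = (fun h : K => h^-1 *: ((f \o shift (y + t *: v)) (h *: v) - f (y + t *: v))).
Proof.
apply: funext => h /=; congr (_ *: (f _ - _)).
by rewrite scalerDl [h *: 1]mulr1 addrCA addrC -addrA; congr (_ + _); rewrite addrC.
Qed.

Lemma line_derivable f y v (t : K) : derivable f (y + t *: v) v ->
  derivable (fun s : K => f (y + s *: v)) t 1.
Proof. by rewrite /derivable line_quotient. Qed.

Lemma line_derive f y v (t : K) :
  'D_1 (fun s : K => f (y + s *: v)) t = 'D_v f (y + t *: v).
Proof. by rewrite /derive line_quotient. Qed.

Lemma sq_norm (t : K) : sq t -> `|t| <= 6%:R.
Proof.
move=> ht; rewrite normr_normc (_ : 6%:R = Complex 6 0); last first.
  by rewrite -[RHS]/((6 : R)%:C)%C rmorph_nat.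
rewrite lecE /= eqxx /=; apply: le_trans (normc_le_ReIm t) _.
have h1 : `|Re t| <= 3 by rewrite ler_norml; case/andP: ht.
have h2 : `|Im t| <= 3 by rewrite ler_norml; case/andP: ht.
by clear -h1 h2; lra.
Qed.

(** On the complex line through y and z, with parameter 0 at y and 1 at z, f
    vanishes near 0. The square of parameters reaches points at distance less
    than 12 r from y, hence the larger ball on which f is differentiable. *)
Lemma identity_ball f c (r : K) : 0 < r ->
  (forall w, `|w - c| < r *+ 14 -> differentiable f w) ->
  forall y, `|y - c| < r -> (\forall w \near y, f w = 0) ->
  forall z, `|z - c| < r -> f z = 0.
Proof.
move=> r0 df y yr fy z zr.
pose v := z - y.
have vr : `|v| <= r *+ 2.
  rewrite (_ : v = (z - c) - (y - c)); last by rewrite /v opprB addrA subrK.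
  by rewrite mulr2n; apply: le_trans (ler_normB _ _) _; apply: lerD; apply: ltW.
have -> : f z = (fun s : K => f (y + s *: v)) 1.
  by rewrite /= scale1r /v addrC subrK.
have small : \forall s \near (0 : K), f (y + s *: v) = 0.
  have ct : (fun s : K => y + s *: v) @ (0 : K) --> y.
    rewrite -[X in _ --> X]addr0 -(scale0r v).
    by apply: cvgD; [exact: cvg_cst|apply: cvgZl; exact: cvg_id].
  exact: (ct _ fy).
have [r' r'0 hr'] := (nbhs_normc (0 : K) _).1 small.
apply: (@identity_square R (fun s : K => f (y + s *: v)) r' _ r'0); last by move=> s sr;
  apply: hr'; rewrite subr0.
move=> s /sq_norm s6; apply/cdiffP/line_derivable/diff_derivable/df.
rewrite addrAC; apply: le_lt_trans (ler_normD _ _) _.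
rewrite (_ : 14 = 1 + 13)%N// mulrnDr; apply: ltr_leD => //.
rewrite normrZ; apply: le_trans (ler_pM _ _ s6 vr) _ => //.
by rewrite mulrnAr mulr_natl -mulrnA ler_pMn2l.
Qed.

(** Continuity along a compact segment is uniform; g parametrizes a side of the
    square. *)
Lemma uniform_segment f (c v : 'rV[K]_n) (g : R -> K) (e : R) : 0 < e ->
  continuous g ->
  (forall t, -3 <= t <= 3 -> {for c + g t *: v, continuous f}) ->
  \forall y \near c, forall t, -3 <= t <= 3 ->
    N (f (y + g t *: v) - f (c + g t *: v)) <= e.
Proof.
move=> e0 cg cf.
have /compact_near_coveringP nc := @segment_compact R (-3) 3.
have nc' := nc _ (nbhs c) (fun y t => N (f (y + g t *: v) - f (c + g t *: v)) <= e) _.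
have hU : \forall y \near c,
    `[-3, 3] `<=` (fun t => N (f (y + g t *: v) - f (c + g t *: v)) <= e).
  apply: nc' => t /=.
  rewrite in_itv /= => ht.
  have := (cvg_normc _ _).2 (cf t ht) (e / 2) (divr_gt0 e0 (ltr0Sn _ _)) => h1.
  pose A := [set w : 'rV[K]_n | N (f (c + g t *: v) - f w) < e / 2].
  have nA : nbhs (c + g t *: v) A by exact: h1.
  have k1 : (fun z : R * 'rV[K]_n => z.2 + g z.1 *: v) @ (t, c) --> c + g t *: v.
    apply: cvgD; first exact: cvg_snd.
    apply: cvgZl; apply: (@cvg_comp _ _ _ fst g); [exact: cvg_fst|exact: cg].
  have k2 : (fun z : R * 'rV[K]_n => c + g z.1 *: v) @ (t, c) --> c + g t *: v.
    apply: cvgD; first exact: cvg_cst.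
    apply: cvgZl; apply: (@cvg_comp _ _ _ fst g); [exact: cvg_fst|exact: cg].
  have m1 : \forall z \near (t, c), A (z.2 + g z.1 *: v) := k1 _ nA.
  have m2 : \forall z \near (t, c), A (c + g z.1 *: v) := k2 _ nA.
  apply: filterS2 m1 m2 => -[t' y] /=; rewrite /A /=.
  move: (f (c + g t *: v)) (f (y + g t' *: v)) (f (c + g t' *: v)) => a b d a1 a2.
  rewrite (_ : b - d = (a - d) - (a - b)); last by ring.
  by apply: le_trans (normc_sub _ _) _; clear -a1 a2; lra.
apply: filterS hU => y hy t ht; apply: hy => /=.
by rewrite in_itv.
Qed.

(** The derivative at 0 of t |-> f (y + t u) - f (c + t u) is bounded by the
    values of this function on the boundary of the square, which are uniformly
    small for y close to c. Here u is a multiple of v that is small enough for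
    the square to stay in the domain of f. *)
Lemma derive_continuous f c v : (\forall w \near c, differentiable f w) ->
  {for c, continuous ('D_v f)}.
Proof.
move=> df.
have /nbhs_ballP[e /= e0 he] := df.
have {}he w : `|w - c| < e -> differentiable f w.
  by move=> wc; apply: he; rewrite -ball_normE /= distrC.
pose k : K := e / 2 / (7 * (1 + `|v|)).
have v1 : 0 < 1 + `|v| by rewrite ltr_pwDl.
have k0 : 0 < k by rewrite divr_gt0// ?divr_gt0// mulr_gt0.
pose u := k *: v.
have u7 : 6%:R * `|u| < e / 2.
  rewrite /u normrZ gtr0_norm// /k mulrA.
  rewrite [X in X * _ < _]mulrCA -mulrA gtr_pMr ?divr_gt0//.
  rewrite -mulrA mulrCA mulrC ltr_pdivrMr ?mulr_gt0// mul1r.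
  rewrite mulrDr mulr1; apply: ltr_pwDl => //; apply: ler_wpM2r => //.
  by rewrite ler_nat.
have dom y s : `|y - c| < e / 2 -> sq s -> differentiable f (y + s *: u).
  move=> yc /sq_norm s6; apply: he; rewrite addrAC.
  apply: le_lt_trans (ler_normD _ _) _; rewrite [ltRHS](splitr e).
  apply: ltrD => //; rewrite normrZ; apply: le_lt_trans u7.
  exact: ler_wpM2r.
have sq0 : sq 0 by rewrite /=; apply/andP; split; lra.
have ce : `|c - c| < e / 2 by rewrite subrr normr0 divr_gt0.
have nball : \forall y \near c, `|y - c| < e / 2.
  apply/nbhs_ballP; exists (e / 2) => [|w] /=; first by rewrite divr_gt0.
  by rewrite -ball_normE /= distrC.
suff main : {for c, continuous ('D_u f)}.
  have Dk w : `|w - c| < e / 2 -> 'D_v f w = k^-1 * 'D_u f w.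
    move=> wc; have dw : differentiable f w.
      by have := dom w 0 wc sq0; rewrite scale0r addr0.
    by rewrite !deriveE// /u linearZ /= -[k *: _]/(k * _) mulKf// gt_eqF.
  have [k' ek] : exists k', (k^-1)%R = k' by exists (k^-1)%R.
  rewrite ek in Dk.
  have cu : (fun w => k' * 'D_u f w) @ c --> 'D_v f c.
    rewrite (Dk c ce).
    have c1 : (fun=> k') @ c --> k' by exact: (@cvg_cst _ k' _ (nbhs c) (@nbhs_filter _ c)).
    exact: (cvgM c1 main).
  have h : \forall w \near c, k' * 'D_u f w = 'D_v f w.
    by apply: filterS nball => w /Dk ->.
  exact: (cvg_trans (@near_eq_cvg _ _ (nbhs c) (@nbhs_filter _ c) _ _ h) cu).
apply/(@cvg_normc R _ (nbhs c) (@nbhs_filter _ c)) => d d0.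
have M0 : 0 < d / 200 by rewrite divr_gt0.
have fc s : sq s -> {for c + s *: u, continuous f}.
  by move=> hs; apply: differentiable_continuous; exact: dom.
have i3 : -3 <= (3 : R) <= 3 by lra.
have i3' : -3 <= (- 3 : R) <= 3 by lra.
have s1 := @uniform_segment f c u (fun t => Complex t (- 3)) _ M0 (@continuous_hline R _)
  (fun t ht => fc (Complex t (- 3)) (introT andP (conj ht i3'))).
have s2 := @uniform_segment f c u (fun t => Complex t 3) _ M0 (@continuous_hline R _)
  (fun t ht => fc (Complex t 3) (introT andP (conj ht i3))).
have s3 := @uniform_segment f c u (fun t => Complex (- 3) t) _ M0 (@continuous_vline R _)
  (fun t ht => fc (Complex (- 3) t) (introT andP (conj i3' ht))).
have s4 := @uniform_segment f c u (fun t => Complex 3 t) _ M0 (@continuous_vline R _)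
  (fun t ht => fc (Complex 3 t) (introT andP (conj i3 ht))).
have s5 : \forall y \near c, N (f y - f c) <= d / 200.
  have cc : {for c, continuous f} by have := fc 0 sq0; rewrite scale0r addr0.
  have := (@cvg_normc R _ (nbhs c) (@nbhs_filter _ c) f (f c)).2 cc _ M0.
  by apply: filterS => w /ltW; rewrite normc_distC.
near=> y.
pose F (s : K) := f (y + s *: u) - f (c + s *: u).
have yb : `|y - c| < e / 2 by near: y.
have dl w s : `|w - c| < e / 2 -> sq s -> derivable (fun s : K => f (w + s *: u)) s 1.
  by move=> wc hs; apply/line_derivable/diff_derivable/dom.
have dF s : sq s -> derivable F s 1.
  by move=> hs; apply: derivableB; exact: dl.
have DF : 'D_1 F 0 = 'D_u f y - 'D_u f c.
  rewrite /F deriveB; [|exact: dl|exact: dl].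
  by rewrite !line_derive !scale0r !addr0.
rewrite normc_distC -DF.
have : N ('D_1 F 0) <= 100 * (d / 200); last by clear -d0; lra.
apply: (@cauchy_derivative _ F).
- by move=> s /dF /cdiffP.
- by apply/cderivP; apply: DeriveDef => //; exact: dF.
- have t1 := near s1 y; have t2 := near s2 y; have t3 := near s3 y; have t4 := near s4 y.
  move=> [a b] [/= ha hb hab]; case/orP: hab => [/orP[/orP[]|]|] /eqP ->.
  + by apply: t3 => //; near: y.
  + by apply: t4 => //; near: y.
  + by apply: t1 => //; near: y.
  + by apply: t2 => //; near: y.
- by rewrite /F !scale0r !addr0; near: y.
Unshelve. all: by end_near. Qed.

End SeveralVariables.

(** * Holomorphic functions and forms on a manifold *)

Section Manifold.
Context {R : realType} {n : nat} {X : topologicalType}.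
Context (M : complexAtlas R n X).
Local Notation K := (Cplx R).
Implicit Types (U W O : set X) (u v : X -> K).

Lemma holoS U W u : U `<=` W -> holomorphic_fun M W u -> holomorphic_fun M U u.
Proof.
by move=> UW hu i z [x [ix Ux] <-]; apply: hu; exists x => //; split => //; exact: UW.
Qed.

Lemma holo_cst U (c : K) : holomorphic_fun M U (fun=> c).
Proof. by move=> i z _; exact: differentiable_cst. Qed.

Lemma holoD U u v : holomorphic_fun M U u -> holomorphic_fun M U v ->
  holomorphic_fun M U (fun x => u x + v x).
Proof. by move=> hu hv i z Dz; exact: (differentiableD (hu i z Dz) (hv i z Dz)). Qed.

Lemma holoM U u v : holomorphic_fun M U u -> holomorphic_fun M U v ->
  holomorphic_fun M U (fun x => u x * v x).
Proof. by move=> hu hv i z Dz; exact: (differentiableM (hu i z Dz) (hv i z Dz)). Qed.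

Lemma holo_big U (op : K -> K -> K) (idx : K) (I : Type) (r : seq I) (P : pred I)
    (u : I -> X -> K) :
  (forall v1 v2, holomorphic_fun M U v1 -> holomorphic_fun M U v2 ->
     holomorphic_fun M U (fun x => op (v1 x) (v2 x))) ->
  (forall i, holomorphic_fun M U (u i)) ->
  holomorphic_fun M U (fun x => \big[op/idx]_(i <- r | P i) u i x).
Proof.
move=> hop hu; elim: r => [|i r ih].
  by under eq_fun do rewrite big_nil; exact: holo_cst.
under eq_fun do rewrite big_cons.
by case: (P i) => //; exact: hop.
Qed.

Lemma holo_det U m (A : X -> 'M[K]_m) :
  (forall i j, holomorphic_fun M U (fun x => A x i j)) ->
  holomorphic_fun M U (fun x => \det (A x)).
Proof.
move=> hA; rewrite /determinant; apply: holo_big => [|s]; first exact: holoD.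
apply: holoM.
  exact: holo_cst.
by apply: holo_big => [|i]; [exact: holoM|exact: hA].
Qed.

Lemma holo_adj U m (A : X -> 'M[K]_m) i j :
  (forall i j, holomorphic_fun M U (fun x => A x i j)) ->
  holomorphic_fun M U (fun x => (\adj (A x)) i j).
Proof.
move=> hA; rewrite (_ : (fun x => _) =
  (fun x => (-1) ^+ (j + i) * \det (row' j (col' i (A x))))).
  apply: holoM; first exact: holo_cst.
  apply: holo_det => k l.
  by rewrite (_ : (fun x => _) = fun x => A x (lift j k) (lift i l))//; apply: funext => x;
    rewrite !mxE.
by apply: funext => x; rewrite mxE.
Qed.

Lemma holo_continuous U u x : open U -> holomorphic_fun M U u -> U x ->
  {for x, continuous u}.
Proof.
move=> oU hu Ux; have [i ix] := chart_cover M x.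
have D : (chart i @` (chart_dom i `&` U)) (chart i x) by exists x.
have c1 : {for chart i x, continuous (u \o chart_inv i)}.
  by apply: differentiable_continuous; exact: hu.
have c2 : {for x, continuous (chart i)} by exact: chart_continuous.
have c3 : (u \o chart_inv i) (chart i y) @[y --> x] --> u x.
  have := cvg_comp _ _ c2 c1; rewrite /= chartK//.
apply: cvg_trans c3; apply: near_eq_cvg.
have nx : nbhs x (chart_dom i) by apply: open_nbhs_nbhs; split => //; exact: chart_dom_open.
by apply: filterS nx => y iy /=; rewrite chartK.
Qed.

Lemma chart_image_nbhs (i : chart_index M) W x : chart_dom i x -> open W -> W x ->
  nbhs (chart i x) (chart i @` (chart_dom i `&` W)).
Proof.
move=> ix oW Wx.
have n1 : nbhs (chart i x) (chart i @` chart_dom i).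
  by apply: open_nbhs_nbhs; split; [exact: chart_img_open|exists x].
have ct : {for chart i x, continuous (chart_inv i)}.
  by apply: chart_inv_continuous; exists x.
have n2 : nbhs (chart i x) (chart_inv i @^-1` W).
  by apply: ct; rewrite chartK//; exact: open_nbhs_nbhs.
apply: filterS2 n1 n2 => z [y iy <-] /=; rewrite chartK// => Wy.
by exists y.
Qed.

(** [identity_ball] in the chart i. The neighborhood does not depend on u, so
    that [propagation] applies to conditions on several functions. *)
Lemma local_identity (i : chart_index M) W (x0 : X) :
  open W -> W x0 -> chart_dom i x0 ->
  exists N : set X, [/\ open N, N x0, N `<=` W `&` chart_dom i &
    forall u, holomorphic_fun M (chart_dom i `&` W) u ->
    forall O, open O -> O !=set0 -> O `<=` N -> (forall x, O x -> u x = 0) ->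
    forall x, N x -> u x = 0].
Proof.
move=> oW Wx0 ix0; pose c := chart i x0.
pose D := chart i @` (chart_dom i `&` (chart_dom i `&` W)).
have nD : nbhs c D.
  apply: chart_image_nbhs => //; apply: openI => //; exact: chart_dom_open.
have /nbhs_ballP[e /= e0 he] := nD.
(* the ratio of the two radii in [identity_ball] *)
pose r : K := e / 14%:R.
have r0 : 0 < r by rewrite divr_gt0// ltr0n.
pose N := [set x | [/\ W x, chart_dom i x & `|chart i x - c| < r]].
exists N; split.
- rewrite openE => x [Wx ix xr]; rewrite /interior.
  have n1 : nbhs x W by exact: open_nbhs_nbhs.
  have n2 : nbhs x (chart_dom i) by apply: open_nbhs_nbhs; split => //; exact: chart_dom_open.
  have nb : nbhs (chart i x) [set w | `|w - c| < r].
    apply/nbhs_ballP; exists (r - `|chart i x - c|) => [|w] /=; first by rewrite subr_gt0.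
    rewrite -ball_normE /= distrC => wx.
    rewrite -(subrK (chart i x) w) -addrA; apply: le_lt_trans (ler_normD _ _) _.
    by rewrite -ltrBrDr.
  have n3 : nbhs x (chart i @^-1` [set w | `|w - c| < r]) := chart_continuous ix nb.
  by apply: filterS3 n1 n2 n3 => y Wy iy yr; split.
- by split => //; rewrite subrr normr0.
- by move=> x [].
- move=> u hu O oO [y Oy] ON uO x [Wx ix xr].
  rewrite -(chartK ix).
  have [Wy iy yr] := ON _ Oy.
  apply: (@identity_ball R n (u \o chart_inv i) c r r0 _ (chart i y)) => //.
    move=> w wr; apply: hu; apply: he; rewrite -ball_normE /= distrC.
    by apply: lt_le_trans wr _; rewrite /r -(mulr_natr (e / 14%:R)) divfK// pnatr_eq0.
  have ct : {for chart i y, continuous (chart_inv i)}.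
    by apply: chart_inv_continuous; exists y.
  have n1 : nbhs (chart i y) (chart_inv i @^-1` O).
    by apply: ct; rewrite chartK//; exact: open_nbhs_nbhs.
  by apply: filterS n1 => w Ow /=; exact: uO.
Qed.

(** The interior of S is closed: if y is in its closure, a neighborhood of y as
    in the hypothesis meets it in an open set, from which S spreads to the whole
    neighborhood. *)
Lemma propagation (S : set X) : connected [set: X] ->
  (forall x, exists N, [/\ open N, N x &
     forall O, open O -> O !=set0 -> O `<=` N -> O `<=` S -> N `<=` S]) ->
  forall O, open O -> O !=set0 -> O `<=` S -> forall x, S x.
Proof.
move=> cX loc O oO O0 OS x.
suff e : S^° = setT by apply: interior_subset; rewrite e.
apply: cX.
- case: O0 => y Oy; exists y; rewrite /interior.
  by apply: filterS OS _; exact: open_nbhs_nbhs.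
- by exists S^°; [exact: open_interior|rewrite setTI].
- exists S^°; last by rewrite setTI.
  move=> y cy; have [N [oN Ny hN]] := loc y.
  have nN : nbhs y N by exact: open_nbhs_nbhs.
  have NO : (N `&` S^°) !=set0.
    by have [z [Sz Nz]] := cy _ nN; exists z.
  rewrite /interior; apply: filterS nN.
  apply: hN NO _ _ => //.
  + by apply: openI => //; exact: open_interior.
  + by move=> z [_ /interior_subset].
Qed.

End Manifold.

Section Forms.
Context {R : realType} {n : nat} {X : topologicalType}.
Context (M : complexAtlas R n X) (L : lineBundle M).
Local Notation K := (Cplx R).
Local Notation H0 := (twistedForm L).
Implicit Types (w eta : H0).

Lemma form_coefD w1 w2 i x p :
  form_coef (w1 + w2) i x p = form_coef w1 i x p + form_coef w2 i x p.
Proof. by rewrite /= scale1r. Qed.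

Lemma form_coefZ (c : K) w i x p : form_coef (c *: w) i x p = c *: form_coef w i x p.
Proof. by rewrite /= addr0. Qed.

Lemma form_coef0 i x p : form_coef (0 : H0) i x p = 0.
Proof. by []. Qed.

Lemma form_coef_sum (I : Type) (r : seq I) (c : I -> K) (w : I -> H0) i x p :
  form_coef (\sum_(j <- r) c j *: w j) i x p =
  \sum_(j <- r) c j *: form_coef (w j) i x p.
Proof.
elim: r => [|j r ih]; first by rewrite !big_nil.
by rewrite !big_cons form_coefD form_coefZ ih.
Qed.

Definition vanish_at (eta : H0) (x : X) := forall i p, form_coef eta i x p = 0.

Lemma vanish_atP eta (x : X) i a : chart_dom i x -> triv_dom a x ->
  (forall p, triv a x (form_coef eta i x p) = 0) -> vanish_at eta x.
Proof.
move=> ix ax h j p.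
have inj : injective (triv a x) by apply: bij_inj; exact: triv_bij.
have {}h q : form_coef eta i x q = 0 by apply: inj; rewrite h linear0.
have [jx|njx] := pselect (chart_dom j x); last exact: form_coef_out.
by rewrite (form_coef_change eta p jx ix) big1// => q _; rewrite h scaler0.
Qed.

Lemma form_identity eta (O : set X) : connected [set: X] ->
  open O -> O !=set0 -> (forall x, O x -> vanish_at eta x) -> eta = 0.
Proof.
move=> cX oO O0 hO; apply: twistedForm_eq => i x p; rewrite form_coef0.
suff : forall x, vanish_at eta x by apply.
apply: (@propagation X [set x | vanish_at eta x] cX _ O) => // {i x p}.
move=> x; have [i ix] := chart_cover M x; have [a ax] := triv_cover L x.
have [N [oN Nx NW hN]] := local_identity (triv_dom_open a) ax ix.
exists N; split => // O' oO' O'0 O'N O'S y Ny.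
have [ay iy] := NW _ Ny.
apply: (vanish_atP iy ay) => p.
apply: (hN (fun x => triv a x (form_coef eta i x p)) _ O') => //.
  exact: form_coef_holo.
by move=> z /O'S ->; rewrite linear0.
Qed.

End Forms.

(** * Independence of forms at a point *)

Section OneVariable.
Context (K : fieldType).

Definition poly_of_mpoly1 (P : mpoly 1 K) : {poly K} :=
  \sum_(m <- msupp P) (mcoeff m P) *: 'X^(m ord0).

Lemma poly_of_mpoly1_eval P (c : K) : (poly_of_mpoly1 P).[c] = meval (fun=> c) P.
Proof.
rewrite mevalE /poly_of_mpoly1 horner_sum; apply: eq_bigr => m _.
by rewrite hornerZ hornerXn big_ord1.
Qed.

Lemma poly_of_mpoly1_eq0 P : poly_of_mpoly1 P = 0 -> P = 0.
Proof.
move=> P0; apply/eqP; rewrite -msupp_eq0; apply/eqP.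
case E : (msupp P) => [//|m0 r]; exfalso.
have m0P : m0 \in msupp P by rewrite E mem_head.
have := congr1 (fun q : {poly K} => q`_(m0 ord0)) P0.
rewrite coef0 /poly_of_mpoly1 coef_sum (bigD1_seq m0) //= ?msupp_uniq//.
rewrite coefZ coefXn eqxx mulr1 big1 ?addr0 => [|m mm0].
  by move/eqP; rewrite mcoeff_eq0 m0P.
rewrite coefZ coefXn; case: eqVneq => [e|]; last by rewrite mulr0.
by case/eqP: mm0; apply/mnmP => i; rewrite (ord1 i).
Qed.

End OneVariable.

Section RowFree.
Context {K : fieldType}.

Lemma row_free_ker k m (A : 'M[K]_(k, m)) :
  (forall c : 'rV[K]_k, c *m A = 0 -> c = 0) -> row_free A.
Proof.
move=> h; rewrite -kermx_eq0; apply/eqP/row_matrixP => i.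
rewrite row0; apply: h; apply/sub_kermxP; exact: row_sub.
Qed.

Lemma row_free_minor k m (A : 'M[K]_(k, m)) :
  row_free A <-> exists f : 'I_k -> 'I_m, \det (colsub f A) != 0.
Proof.
split=> [fr|[f df]].
  have rf : row_full A^T by rewrite /row_full mxrank_tr.
  exists (fullrankfun rf); rewrite -det_tr trmx_mxsub.
  by have := fullrowsub_unit rf; rewrite unitmxE unitfE.
apply: row_free_ker => c c0.
have u : colsub f A \in unitmx by rewrite unitmxE unitfE.
have cA : c *m colsub f A = 0 by rewrite mulmx_colsub c0; apply/matrixP => i j; rewrite !mxE.
by rewrite -(mulmxK u c) cA mul0mx.
Qed.

End RowFree.

Section PointwiseIndependence.
Context {R : realType} {n : nat} {X : topologicalType}.
Context (M : complexAtlas R n X) (L : lineBundle M).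
Local Notation K := (Cplx R).
Local Notation H0 := (twistedForm L).
Implicit Types (w eta : H0).

Definition lin_indep k (w : 'I_k -> H0) : Prop :=
  forall c : 'I_k -> K, \sum_j c j *: w j = 0 -> forall j, c j = 0.

Definition indep_at k (w : 'I_k -> H0) (x : X) : Prop :=
  forall c : 'I_k -> K, vanish_at (\sum_j c j *: w j) x -> forall j, c j = 0.

Definition form_mx k (w : 'I_k -> H0) (i : chart_index M) (a : triv_index L) (x : X) :
    'M[K]_(k, n) :=
  \matrix_(j, p) triv a x (form_coef (w j) i x p).

Lemma form_mx_comb k (w : 'I_k -> H0) i a x (c : 'rV[K]_k) p :
  (c *m form_mx w i a x) 0 p = triv a x (form_coef (\sum_j c 0 j *: w j) i x p).
Proof.
rewrite form_coef_sum linear_sum mxE; apply: eq_bigr => j _.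
by rewrite mxE linearZ.
Qed.

Lemma indep_atP k (w : 'I_k -> H0) i a x : chart_dom i x -> triv_dom a x ->
  indep_at w x <-> row_free (form_mx w i a x).
Proof.
move=> ix ax; split=> [h|fr c hc j].
  apply: row_free_ker => c c0; apply/rowP => j; rewrite mxE.
  apply: (h (fun j => c 0 j)); apply: (vanish_atP ix ax) => p.
  by rewrite -form_mx_comb c0 mxE.
have c0 : (\row_j c j) *m form_mx w i a x = 0.
  apply/rowP => p; rewrite form_mx_comb mxE.
  rewrite (_ : \sum_j _ = \sum_j c j *: w j); first by rewrite hc linear0.
  by apply: eq_bigr => l _; rewrite mxE.
have : (\row_j c j) = 0 by apply: (row_free_inj fr); rewrite c0 mul0mx.
by move/rowP/(_ j); rewrite !mxE.
Qed.

Lemma form_mx_holo k (w : 'I_k -> H0) i a j p :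
  holomorphic_fun M (chart_dom i `&` triv_dom a) (fun x => form_mx w i a x j p).
Proof.
rewrite (_ : (fun x => _) = fun x => triv a x (form_coef (w j) i x p)).
  exact: form_coef_holo.
by apply: funext => x; rewrite mxE.
Qed.

Lemma minor_holo k (w : 'I_k -> H0) i a (f : 'I_k -> 'I_n) :
  holomorphic_fun M (chart_dom i `&` triv_dom a)
    (fun x => \det (colsub f (form_mx w i a x))).
Proof.
apply: holo_det => j l.
rewrite (_ : (fun x => _) = fun x => form_mx w i a x j (f l)); first exact: form_mx_holo.
by apply: funext => x; rewrite mxE.
Qed.

Hypothesis cX : connected [set: X].

(** Dependence at a point is the vanishing of all maximal minors of the matrix
    of coefficients, which are holomorphic: the identity theorem applies to each
    of them. *)
Lemma dependent_everywhere k (w : 'I_k -> H0) (O : set X) : open O -> O !=set0 ->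
  (forall x, O x -> ~ indep_at w x) -> forall x, ~ indep_at w x.
Proof.
move=> oO O0 hO.
apply: (@propagation X [set x | ~ indep_at w x] cX _ O) => // x.
have [i ix] := chart_cover M x; have [a ax] := triv_cover L x.
have [N [oN Nx NW hN]] := local_identity (triv_dom_open a) ax ix.
exists N; split => // O' oO' O'0 O'N O'S y Ny.
have [ay iy] := NW _ Ny => /(indep_atP w iy ay)/row_free_minor[f]; apply/negP.
rewrite negbK; apply/eqP.
apply: (hN (fun x => \det (colsub f (form_mx w i a x))) _ O') => //.
  exact: minor_holo.
move=> z O'z; have [az iz] := NW _ (O'N _ O'z).
apply/eqP; apply: contrapT => /negP dz; apply: (O'S z O'z).
by apply/(indep_atP w iz az)/row_free_minor; exists f.
Qed.

(** On U the values of u lie in the finite set of roots of p, and near a point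
    of O and U continuity leaves only one of them. *)
Lemma algebraic_const (u : X -> K) (O U : set X) (p : {poly K}) : p != 0 ->
  open O -> O !=set0 -> (forall x, O x -> {for x, continuous u}) ->
  open U -> dense U -> (forall x, U x -> p.[u x] = 0) ->
  exists O', [/\ open O', O' !=set0, O' `<=` O & exists c, forall x, O' x -> u x = c].
Proof.
move=> p0 oO O0 cu oU dU pu.
have [rs prs] := closed_field_poly_normal p.
have root_mem x : U x -> u x \in rs.
  move=> Ux; have := pu x Ux; rewrite prs => /eqP; rewrite -/(root _ _) rootZ ?lead_coef_eq0//.
  by rewrite root_prod_XsubC.
have [x [Ox Ux]] := dU O O0 oO.
pose V := [set z : K | forall r, r \in rs -> r != u x -> z != r].
have nV : nbhs (u x) V.
  rewrite /V; elim: rs {prs root_mem V} => [|r rs ih];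
    first by apply: filterS filterT => z _ r; rewrite in_nil.
  have [e|ne] := eqVneq r (u x).
    apply: filterS ih => z hz s; rewrite inE => /predU1P[->|srs]; first by rewrite e eqxx.
    exact: hz.
  have nr : nbhs (u x) [set z | z != r] by apply: nbhs_neq; rewrite eq_sym.
  apply: filterS2 ih nr => z hz zr s; rewrite inE => /predU1P[->//|srs].
  exact: hz.
have nx : nbhs x (O `&` U `&` (u @^-1` V)).
  apply: filterI; first by apply: open_nbhs_nbhs; split => //; exact: openI.
  exact: (cu x Ox).
exists ((O `&` U `&` (u @^-1` V))^°); split.
- exact: open_interior.
- by exists x.
- by move=> y /interior_subset[[]].
- exists (u x) => y /interior_subset[[_ Uy] Vy]; apply/eqP; apply: contrapT => /negP ne.
  by have := Vy (u y) (root_mem y Uy) ne; rewrite eqxx.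
Qed.

End PointwiseIndependence.

(** * Generic independence when a(X) = 0 *)

Section CramerCoefficients.
Context {R : realType} {n : nat} {X : topologicalType}.
Context (M : complexAtlas R n X) (L : lineBundle M).
Local Notation K := (Cplx R).
Local Notation H0 := (twistedForm L).
Implicit Types (w eta : H0).
Hypothesis cX : connected [set: X].

Definition generically_indep k (w : 'I_k -> H0) :=
  forall O : set X, open O -> O !=set0 -> exists2 x, O x & indep_at w x.

Definition expansion k (w : 'I_k -> H0) (v : H0) (cf : X -> 'I_k -> K) :=
  forall x, indep_at w x -> vanish_at (v - \sum_j cf x j *: w j) x.

(** Cramer's rule for the coefficient j of v on w, from the components f of the
    forms in a chart and a trivialization: the denominator is the minor of the
    columns f. *)
Definition cramer_numer k (w : 'I_k -> H0) (v : H0) i a (f : 'I_k -> 'I_n) (x : X)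
    (j : 'I_k) : K :=
  ((\row_l triv a x (form_coef v i x (f l))) *m \adj (colsub f (form_mx w i a x))) 0 j.

Lemma cramer_numerE k (w : 'I_k -> H0) v cf i a f x j : expansion w v cf ->
  chart_dom i x -> triv_dom a x -> indep_at w x ->
  cramer_numer w v i a f x j = \det (colsub f (form_mx w i a x)) * cf x j.
Proof.
move=> ex ix ax ind; rewrite /cramer_numer.
have -> : (\row_l triv a x (form_coef v i x (f l))) =
    (\row_l cf x l) *m colsub f (form_mx w i a x).
  apply/rowP => l; rewrite mulmx_colsub [RHS]mxE form_mx_comb mxE.
  have := ex x ind i (f l).
  rewrite (_ : \sum_j0 _ = \sum_j cf x j *: w j); last first.
    by apply: eq_bigr => q _; rewrite mxE.
  rewrite -scaleN1r form_coefD form_coefZ scaleN1r => /eqP.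
  by rewrite subr_eq0 => /eqP ->.
by rewrite -mulmxA mul_mx_adj mul_mx_scalar !mxE.
Qed.

Lemma cramer_numer_holo k (w : 'I_k -> H0) v i a f j :
  holomorphic_fun M (chart_dom i `&` triv_dom a) (fun x => cramer_numer w v i a f x j).
Proof.
rewrite (_ : (fun x => _) = (fun x => \sum_l triv a x (form_coef v i x (f l)) *
   (\adj (colsub f (form_mx w i a x))) l j)).
  apply: holo_big => [|l]; [exact: holoD|apply: holoM]; first exact: form_coef_holo.
  apply: (@holo_adj _ _ _ M _ k (fun x => colsub f (form_mx w i a x))) => p q.
  rewrite (_ : (fun x => _) = fun x => form_mx w i a x p (f q)); first exact: form_mx_holo.
  by apply: funext => x; rewrite mxE.
apply: funext => x; rewrite /cramer_numer mxE; apply: eq_bigr => l _.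
by rewrite mxE.
Qed.

(** The same minor is nonzero on a dense subset of N: were it zero on an open
    subset, it would be zero on N. So it can serve as a denominator in the
    definition of meromorphic functions. *)
Lemma local_minor k (w : 'I_k -> H0) (x0 : X) : generically_indep w ->
  exists (i : chart_index M) (a : triv_index L) (f : 'I_k -> 'I_n) (N : set X),
    [/\ open N, N x0, N `<=` chart_dom i `&` triv_dom a &
     forall O, open O -> O `<=` N -> O !=set0 ->
       exists2 y, O y & \det (colsub f (form_mx w i a y)) != 0].
Proof.
move=> gw; have [i ix] := chart_cover M x0; have [a ax] := triv_cover L x0.
have [N [oN Nx NW hN]] := local_identity (triv_dom_open a) ax ix.
have [y Ny iy] := gw N oN (ex_intro _ x0 Nx).
have [ay cy] := NW _ Ny.
have /(indep_atP w cy ay)/row_free_minor[f df] := iy.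
exists i, a, f, N; split => //; first by move=> z /NW[].
move=> O oO ON O0; apply: contrapT => h.
case/eqP: df; apply: (hN (fun x => \det (colsub f (form_mx w i a x))) _ O) => //.
  exact: minor_holo.
move=> z Oz; apply/eqP; apply: contrapT => /negP dz.
by apply: h; exists z.
Qed.

Lemma minor_indep k (w : 'I_k -> H0) i a f x : chart_dom i x -> triv_dom a x ->
  \det (colsub f (form_mx w i a x)) != 0 -> indep_at w x.
Proof. by move=> ix ax df; apply/(indep_atP w ix ax)/row_free_minor; exists f. Qed.

Lemma expansion_meromorphic k (w : 'I_k -> H0) v cf j : generically_indep w ->
  expansion w v cf -> meromorphic M (fun x => cf x j).
Proof.
move=> gw ex x0; have [i [a [f [N [oN Nx NW hN]]]]] := local_minor x0 gw.
exists N, (fun x => cramer_numer w v i a f x j), (fun x => \det (colsub f (form_mx w i a x))).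
split => //.
- by split; apply: holoS NW _; [exact: cramer_numer_holo|exact: minor_holo].
- move=> y Ny dy; have [iy ay] := NW _ Ny.
  have iw := minor_indep iy ay dy.
  by rewrite (cramer_numerE f j ex iy ay iw) mulrAC divff// mul1r.
Qed.

(** Otherwise u alone would be an algebraically independent family. *)
Lemma meromorphic_algebraic (u : X -> K) : algebraic_dimension M 0 ->
  meromorphic M u -> exists (U : set X) (p : {poly K}),
    [/\ p != 0, open U, dense U & forall x, U x -> p.[u x] = 0].
Proof.
move=> [_ h] mu; apply: contrapT => h2; apply: h.
exists (fun _ => u); split => // P [U [oU dU PU]].
apply: contrapT => P0; apply: h2; exists U, (poly_of_mpoly1 P); split => //.
  by apply/eqP => /poly_of_mpoly1_eq0.
by move=> x Ux; rewrite poly_of_mpoly1_eval PU.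
Qed.

(** The coefficients are continuous where a minor is not 0, and algebraic over
    C; the open set is shrunk once for each of them. *)
Lemma expansion_locally_constant k (w : 'I_k -> H0) v cf :
  algebraic_dimension M 0 -> [set: X] !=set0 -> generically_indep w ->
  expansion w v cf ->
  exists (O : set X) (c : 'I_k -> K), [/\ open O, O !=set0,
    forall x, O x -> indep_at w x & forall x j, O x -> cf x j = c j].
Proof.
move=> aX [x0 _] gw ex; have [i [a [f [N [oN Nx NW hN]]]]] := local_minor x0 gw.
have [x1 Nx1 dx1] := hN N oN (fun _ h => h) (ex_intro _ x0 Nx).
pose h := fun x => \det (colsub f (form_mx w i a x)).
have hh : holomorphic_fun M N h by apply: holoS NW _; exact: minor_holo.
have ch x : N x -> {for x, continuous h} by move=> Nxx; exact: (holo_continuous oN hh Nxx).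
pose O0 := N `&` [set x | h x != 0].
have oO0 : open O0.
  rewrite openE => x [Nxx hx]; rewrite /interior; apply: filterI.
    exact: open_nbhs_nbhs.
  exact: (ch x Nxx _ (nbhs_neq hx)).
have iO0 x : O0 x -> indep_at w x.
  by move=> [Nxx hx]; have [ix ax] := NW _ Nxx; exact: minor_indep hx.
have cO0 j x : O0 x -> {for x, continuous (fun x => cf x j)}.
  move=> O0x; have [Nxx hx] := O0x.
  have hn : holomorphic_fun M N (fun x => cramer_numer w v i a f x j).
    by apply: holoS NW _; exact: cramer_numer_holo.
  have cn := holo_continuous oN hn Nxx.
  have e y : O0 y -> cramer_numer w v i a f y j * (h y)^-1 = cf y j.
    move=> [Ny hy]; have [iy ay] := NW _ Ny.
    by rewrite (cramer_numerE f j ex iy ay (minor_indep iy ay hy)) mulrAC divff// mul1r.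
  have hV : (fun y => (h y)^-1) @ x --> (h x)^-1 by apply: cvgV; [exact: hx|exact: (ch x Nxx)].
  have hc : (fun y => cramer_numer w v i a f y j * (h y)^-1) @ x --> cf x j.
    by rewrite -(e x O0x); exact: (cvgM cn hV).
  apply: cvg_trans hc; apply: near_eq_cvg.
  have nO : nbhs x O0 by exact: open_nbhs_nbhs.
  by apply: filterS nO => y /e.
have main (s : seq 'I_k) : exists O, [/\ open O, O !=set0, O `<=` O0 &
    forall j, j \in s -> exists c, forall x, O x -> cf x j = c].
  elim: s => [|j s [ O [oO On OO0 hO]]]; first by exists O0; split => //; exists x1.
  have [U [p [p0 oU dU pU]]] := meromorphic_algebraic aX (expansion_meromorphic j gw ex).
  have [ O2 [oO2 O2n O2O [c hc]]] := algebraic_const p0 oO On (fun x Ox =>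
    cO0 j x (OO0 _ Ox)) oU dU pU.
  exists O2; split => //; first by move=> x /O2O /OO0.
  move=> l; rewrite inE => /predU1P[->|/hO[d hd]]; first by exists c.
  by exists d => x /O2O /hd.
have [ O [oO On OO0 hO]] := main (enum 'I_k).
have /choice[c hc] : forall j : 'I_k, exists c, forall x, O x -> cf x j = c.
  by move=> j; apply: hO; rewrite mem_enum.
exists O, c; split => //; first by move=> x /OO0 /iO0.
by move=> x j Ox; exact: hc.
Qed.

(** By induction on the number of forms: if w were dependent on an open set, it
    would be so everywhere, the first form would be a generic combination of the
    others with coefficients that are constant on an open set, and this linear
    relation would hold on X. *)
Theorem generic_independence k (w : 'I_k -> H0) :
  algebraic_dimension M 0 -> [set: X] !=set0 -> lin_indep w -> generically_indep w.
Proof.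
move=> aX X0; elim: k w => [|k ih] w lw; first by move=> O _ [x Ox]; exists x => // c _ [].
pose w' (j : 'I_k) := w (lift ord0 j).
have gw' : generically_indep w'.
  apply: ih => c c0 j.
  have := lw (fun l => if unlift ord0 l is Some m then c m else 0) _ (lift ord0 j).
  rewrite liftK; apply; rewrite big_ord_recl unlift_none scale0r add0r.
  by rewrite -[RHS]c0; apply: eq_bigr => l _; rewrite liftK.
move=> O oO O0; apply: contrapT => hO.
have dep x : ~ indep_at w x.
  by apply: (dependent_everywhere cX oO O0) => y Oy iy; apply: hO; exists y.
have /choice[cf hcf] : forall x, exists c : 'I_k -> K, indep_at w' x ->
    vanish_at (w ord0 - \sum_j c j *: w' j) x.
  move=> x; have [iw|] := pselect (indep_at w' x); last by exists (fun=> 0).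
  have /existsNP[c /not_implyP[vc /existsNP[j0 cj0]]] := dep x.
  rewrite big_ord_recl in vc.
  have c0 : c ord0 != 0.
    apply/eqP => c0; rewrite c0 scale0r add0r in vc.
    have := iw _ vc; case: (unliftP ord0 j0) cj0 => [j ->|-> //] cj h.
    by apply: cj; exact: h.
  exists (fun j => - (c ord0)^-1 * c (lift ord0 j)) => _.
  move=> i p; have := vc i p.
  rewrite (_ : w ord0 - _ = (c ord0)^-1 *: (c ord0 *: w ord0 + \sum_(j < k) c (lift ord0 j) *:
    w (lift ord0 j))).
    by rewrite form_coefZ => ->; rewrite scaler0.
  rewrite scalerDr scalerA mulVf// scale1r scaler_sumr -sumrN; congr (_ + _).
  by apply: eq_bigr => j _; rewrite scalerA mulNr scaleNr opprK.
have [ O1 [c [oO1 O1n iO1 hc]]] := expansion_locally_constant aX X0 gw' hcf.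
have : w ord0 - \sum_j c j *: w' j = 0.
  apply: (form_identity cX oO1 O1n) => x Ox.
  have := hcf x (iO1 x Ox); congr vanish_at; congr (_ - _).
  by apply: eq_bigr => j _; rewrite hc.
move=> e; have := lw (fun l => if unlift ord0 l is Some m then - c m else 1) _ ord0.
rewrite unlift_none => h; have /eqP := oner_neq0 K; apply; apply: h.
rewrite big_ord_recl unlift_none scale1r -[RHS]e; congr (_ + _).
by rewrite -sumrN; apply: eq_bigr => j _; rewrite liftK scaleNr.
Qed.

End CramerCoefficients.

(** * Integrability as a system of quadrics *)

Section Wedge.
Context {K : numFieldType}.

(** The coefficients of al /\ D, for a 1-form al and a 2-form given by an
    alternating matrix D. *)
Definition wedge3 n (al : 'rV[K]_n) (D : 'M[K]_n) (p q r : 'I_n) : K :=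
  al 0 p * D q r - al 0 q * D p r + al 0 r * D p q.

Lemma wedge3_pull n m (al : 'rV[K]_n) (D : 'M[K]_n) (G : 'M[K]_(n, m)) :
  (forall p q r, wedge3 al D p q r = 0) ->
  forall p q r, wedge3 (al *m G) (G^T *m D *m G) p q r = 0.
Proof.
move=> h p q r.
have DE u v : (G^T *m D *m G) u v = \sum_a \sum_b G a u * D a b * G b v.
  rewrite mxE exchange_big; apply: eq_bigr => b _; rewrite mxE mulr_suml.
  by apply: eq_bigr => a _; rewrite !mxE.
have alE u : (al *m G) 0 u = \sum_a al 0 a * G a u by rewrite mxE.
rewrite /wedge3 !DE !alE.
transitivity (\sum_a \sum_b \sum_c G a p * G b q * G c r * wedge3 al D a b c); last first.
  by rewrite big1// => a _; rewrite big1// => b _; rewrite big1// => c _; rewrite h mulr0.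
have -> : (\sum_a al 0 a * G a p) * (\sum_a \sum_b G a q * D a b * G b r) =
    \sum_a \sum_b \sum_c G a p * G b q * G c r * (al 0 a * D b c).
  rewrite big_distrl /=; apply: eq_bigr => a _; rewrite big_distrr /=.
  apply: eq_bigr => b _; rewrite big_distrr /=; apply: eq_bigr => c _; ring.
have -> : (\sum_a al 0 a * G a q) * (\sum_a \sum_b G a p * D a b * G b r) =
    \sum_a \sum_b \sum_c G a p * G b q * G c r * (al 0 b * D a c).
  rewrite [RHS]exchange_big /= big_distrl /=; apply: eq_bigr => b _; rewrite big_distrr /=.
  apply: eq_bigr => a _; rewrite big_distrr /=; apply: eq_bigr => c _; ring.
have -> : (\sum_a al 0 a * G a r) * (\sum_a \sum_b G a p * D a b * G b q) =
    \sum_a \sum_b \sum_c G a p * G b q * G c r * (al 0 c * D a b).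
  rewrite big_distrr /=; apply: eq_bigr => a _; rewrite big_distrr /=.
  apply: eq_bigr => b _; rewrite big_distrl /=; apply: eq_bigr => c _; ring.
rewrite -sumrB -big_split /=; apply: eq_bigr => a _.
rewrite -sumrB -big_split /=; apply: eq_bigr => b _.
rewrite -sumrB -big_split /=; apply: eq_bigr => c _.
rewrite /wedge3; ring.
Qed.

(** The coefficient of w_p /\ w_q /\ w_r in w /\ dw, for w = sum_i x_i w_i, when
    dw_i = w_i /\ sum_r e_ir w_r. *)
Definition cyclic_quadric k (e : 'I_k -> 'I_k -> K) (x : 'I_k -> K) (p q r : 'I_k) : K :=
  x p * x q * (e q r - e p r) + x p * x r * (e p q - e r q) +
  x q * x r * (e r p - e q p).

Lemma complete_basis k m (A : 'M[K]_(k, k + m)) : row_free A ->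
  exists N : 'M[K]_(m, k + m), col_mx A N \in unitmx.
Proof.
move=> fr.
have rk : \rank (A^C)%MS = m by rewrite mxrank_compl (eqP fr) addKn.
have [N eN] : exists N : 'M[K]_(m, k + m), (N :=: A^C)%MS.
  by have := eq_row_base (A^C)%MS; move: (row_base _); rewrite rk => N; exists N.
exists N; rewrite -row_full_unit -sub1mx.
apply: submx_trans (_ : (1%:M <= A + A^C)%MS) _.
  by rewrite sub1mx addsmx_compl_full.
rewrite -addsmxE; apply: addsmxS => //; by rewrite eN.
Qed.

(** In a frame that extends al, the condition al_j /\ D_j = 0 leaves only the
    entries of D_j in row and column j. The coefficients of the wedge product of
    a combination are the cyclic quadrics on three of the al_j, the binomials on
    two of them and one other form of the frame, and 0 elsewhere. *)
Lemma wedge_normal_form k n (al : 'I_k -> 'rV[K]_n) (D : 'I_k -> 'M[K]_n) :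
  row_free (\matrix_j al j) -> (forall j, (D j)^T = - D j) ->
  (forall j p q r, wedge3 (al j) (D j) p q r = 0) ->
  exists m (e : 'I_k -> 'I_k -> K) (e' : 'I_k -> 'I_m -> K),
  forall x : 'I_k -> K,
    (forall p q r, wedge3 (\sum_j x j *: al j) (\sum_j x j *: D j) p q r = 0) <->
    (forall p q r, cyclic_quadric e x p q r = 0) /\
    (forall p q s, x p * x q * (e' q s - e' p s) = 0).
Proof.
move=> fr Dt h.
have kn : (k <= n)%N by rewrite -(eqP fr) rank_leq_col.
move: al D fr Dt h; rewrite -(subnKC kn); move: (n - k)%N => m {n kn} al D fr Dt h.
have [N uP] := complete_basis fr.
set P := col_mx _ _ in uP; pose G := invmx P.
have PG : P *m G = 1%:M by rewrite mulmxV.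
have GP : G *m P = 1%:M by rewrite mulVmx.
pose D' j := G^T *m D j *m G.
have alG j : al j *m G = delta_mx 0 (lshift m j).
  have := congr1 (row (lshift m j)) PG.
  by rewrite row_mul /P rowKu rowK row1.
have D't j q r : D' j q r = - D' j r q.
  have : (D' j)^T = - D' j by rewrite /D' !trmx_mul trmxK Dt mulNmx mulmxN mulmxA.
  by move/matrixP/(_ r q); rewrite !mxE.
have D'0 j q : D' j q q = 0.
  by apply/eqP; have /eqP := D't j q q; rewrite -addr_eq0 -mulr2n mulrn_eq0.
pose l (j : 'I_k) : 'I_(k + m) := lshift m j.
have D'E j q r : D' j q r = (q == l j)%:R * D' j (l j) r - (r == l j)%:R * D' j (l j) q.
  have [->|qj] := eqVneq q (l j).
    rewrite mul1r; have [->|rj] := eqVneq r (l j); last by rewrite mul0r subr0.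
    by rewrite mul1r D'0 subr0.
  rewrite mul0r add0r; have [->|rj] := eqVneq r (l j); first by rewrite mul1r D't.
  have := wedge3_pull G (h j) (l j) q r; rewrite -/(D' j) /wedge3 alG !mxE !eqxx.
  by rewrite (negbTE qj) (negbTE rj) /= !mul0r mul1r subr0 addr0 oppr0 => ->.
(* D'_j = al_j /\ sum_r E_jr (r-th form of the frame) *)
pose E (j : 'I_k) r := D' j (l j) r.
exists m, (fun j r => E j (l r)), (fun j s => E j (rshift k s)) => x.
(* X and F extend x and E by 0 to all the indices of the frame. *)
pose X (q : 'I_(k + m)) := if fintype.split q is inl j then x j else 0.
pose F (q r : 'I_(k + m)) := if fintype.split q is inl j then E j r else 0.
have sX : (\sum_j x j *: al j) *m G = \row_q X q.
  apply/rowP => q; rewrite mulmx_suml summxE !mxE /X.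
  under eq_bigr do rewrite -scalemxAl alG !mxE eqxx /=.
  case: splitP => [j qj|s qs].
    have -> : q = l j by apply: val_inj.
    rewrite (bigD1 j) //= big1 ?addr0 => [|i ij]; first by rewrite eqxx mulr1.
    rewrite (_ : (l j == lshift m i) = false) ?mulr0//.
    by apply/negP => /eqP/lshift_inj; apply/eqP; rewrite eq_sym.
  rewrite big1// => i _; rewrite (_ : (q == _) = false) ?mulr0//.
  by apply/eqP => e; have := ltn_ord i; rewrite ltnNge; move/(congr1 val): e;
    rewrite /= qs => <-; rewrite leq_addr.
have sD q r : (G^T *m (\sum_j x j *: D j) *m G) q r = X q * F q r - X r * F r q.
  have half (u v : 'I_(k + m)) : \sum_j x j * ((u == l j)%:R * E j v) = X u * F u v.
    rewrite /X /F; case: splitP => [j uj|s us].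
      have -> : u = l j by apply: val_inj.
      rewrite (bigD1 j) //= big1 ?addr0 => [|i ij]; first by rewrite eqxx mul1r.
      rewrite (_ : (l j == l i) = false) ?mul0r ?mulr0//.
      by apply/negP => /eqP/lshift_inj; apply/eqP; rewrite eq_sym.
    rewrite mul0r big1// => i _; rewrite (_ : (u == _) = false) ?mul0r ?mulr0//.
    by apply/eqP => e; have := ltn_ord i; rewrite ltnNge; move/(congr1 val): e;
      rewrite /= us => <-; rewrite leq_addr.
  rewrite mulmx_sumr mulmx_suml summxE -!half -sumrB; apply: eq_bigr => j _.
  by rewrite -scalemxAr -scalemxAl mxE -/(D' j) D'E mulrBr.
have key p q r : wedge3 (\row_q X q) (G^T *m (\sum_j x j *: D j) *m G) p q r =
    X p * X q * (F q r - F p r) + X p * X r * (F p q - F r q) +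
    X q * X r * (F r p - F q p).
  rewrite /wedge3 !sD !mxE; ring.
have Xl j : X (l j) = x j by rewrite /X /l (unsplitK (inl j)).
have Xr s : X (rshift k s) = 0 by rewrite /X (unsplitK (inr s)).
have Fl j r : F (l j) r = E j r by rewrite /F /l (unsplitK (inl j)).
have step1 : (forall p q r, wedge3 (\sum_j x j *: al j) (\sum_j x j *: D j) p q r = 0) <->
    (forall p q r, wedge3 (\row_q X q) (G^T *m (\sum_j x j *: D j) *m G) p q r = 0).
  split=> hw; first by move=> p q r; rewrite -sX; exact: wedge3_pull.
  move=> p q r; have := wedge3_pull P hw p q r.
  rewrite -sX -mulmxA GP mulmx1 !mulmxA -trmx_mul GP trmx1 mul1mx.
  by rewrite -mulmxA GP mulmx1.
rewrite step1; split=> [hw|[h1 h2] p q r].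
  split=> [p q r|p q s].
    by have := hw (l p) (l q) (l r); rewrite key !Xl !Fl.
  by have := hw (l p) (l q) (rshift k s); rewrite key !Xl Xr !Fl !mulr0 !mul0r !addr0.
rewrite key; case: (split_ordP p) => [p' ->|p' ->]; case: (split_ordP q) => [q' ->|q' ->];
  case: (split_ordP r) => [r' ->|r' ->]; rewrite -?/(l _) ?Xl ?Xr ?Fl ?mulr0 ?mul0r ?mulr0
    ?mul0r ?addr0 ?add0r //.
- exact: h1.
- by have := h2 p' r' q'; rewrite -[in X in X -> _](opprB (E p' _)) mulrN => /eqP;
  rewrite oppr_eq0 => /eqP.
Qed.

End Wedge.

(** * Integrable combinations of forms *)

Section Integrability.
Context {R : realType} {n : nat} {X : topologicalType}.
Context (M : complexAtlas R n X) (L : lineBundle M).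
Local Notation K := (Cplx R).
Local Notation H0 := (twistedForm L).
Implicit Types (w eta : H0).

Definition integrable_at (w : H0) (x : X) := forall i a,
  chart_dom i x -> triv_dom a x ->
  forall p q r, wedge_dform (local_form w i a) p q r (chart i x) = 0.

Lemma integrable_formP w : integrable_form w <-> forall x, integrable_at w x.
Proof.
split=> [h x i a ix ax p q r|h i a z [x [ix ax] <-] p q r]; last exact: h.
by apply: h; exists x.
Qed.

Lemma local_form_diff w i a p z : (chart i @` (chart_dom i `&` triv_dom a)) z ->
  differentiable (local_form w i a p) z.
Proof.
move=> [x [ix ax] <-]; apply: (@form_coef_holo _ _ _ _ _ w i a p i).
by exists x.
Qed.

Definition coef_row w i a z : 'rV[K]_n := \row_p local_form w i a p z.
Definition curl_mx w i a z : 'M[K]_n := \matrix_(p, q) dform (local_form w i a) p q z.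

Lemma wedge_dformE w i a p q r z :
  wedge_dform (local_form w i a) p q r z = wedge3 (coef_row w i a z) (curl_mx w i a z) p q r.
Proof. by rewrite /wedge3 !mxE. Qed.

Lemma coef_row_comb k (w : 'I_k -> H0) (c : 'I_k -> K) i a z :
  coef_row (\sum_j c j *: w j) i a z = \sum_j c j *: coef_row (w j) i a z.
Proof.
apply/rowP => p; rewrite summxE mxE /local_form form_coef_sum linear_sum.
by apply: eq_bigr => j _; rewrite linearZ !mxE.
Qed.

Lemma derive_comb k (f : 'I_k -> 'rV[K]_n -> K) (c : 'I_k -> K) (v z : 'rV[K]_n) :
  (forall j, differentiable (f j) z) ->
  'D_v (fun y => \sum_j c j * f j y) z = \sum_j c j * 'D_v (f j) z.
Proof.
move=> df; have dg j : derivable (c j \*: f j) z v.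
  by apply: derivableZ; exact: diff_derivable.
rewrite (_ : (fun y => _) = \sum_j (c j \*: f j)); last first.
  by apply: funext => y; rewrite fct_sumE.
rewrite derive_sum//; apply: eq_bigr => j _.
by rewrite deriveZ//; exact: diff_derivable.
Qed.

Lemma curl_mx_comb k (w : 'I_k -> H0) (c : 'I_k -> K) i a z :
  (chart i @` (chart_dom i `&` triv_dom a)) z ->
  curl_mx (\sum_j c j *: w j) i a z = \sum_j c j *: curl_mx (w j) i a z.
Proof.
move=> Dz; apply/matrixP => p q; rewrite summxE mxE /dform.
have e r : local_form (\sum_j c j *: w j) i a r =
    fun y => \sum_j c j * local_form (w j) i a r y.
  apply: funext => y; rewrite /local_form form_coef_sum linear_sum.
  by apply: eq_bigr => j _; rewrite linearZ.
rewrite !e !derive_comb; try by move=> j; exact: local_form_diff.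
by rewrite -sumrB; apply: eq_bigr => j _; rewrite !mxE mulrBr.
Qed.

Lemma curl_mx_tr w i a z : (curl_mx w i a z)^T = - curl_mx w i a z.
Proof. by apply/matrixP => p q; rewrite !mxE /dform opprB. Qed.

(** [wedge_normal_form] at x, where [curl_mx] gives the coefficients of d(w_j);
    these are linear in the form because L is trivialized once for all the w_j. *)
Lemma integrable_comb_at k (w : 'I_k -> H0) i a x :
  (forall j, integrable_form (w j)) -> indep_at w x -> chart_dom i x -> triv_dom a x ->
  exists m (e : 'I_k -> 'I_k -> K) (e' : 'I_k -> 'I_m -> K), forall c : 'I_k -> K,
    (forall p q r, wedge_dform (local_form (\sum_j c j *: w j) i a) p q r (chart i x) = 0)
    <-> (forall p q r, cyclic_quadric e c p q r = 0) /\
        (forall p q s, c p * c q * (e' q s - e' p s) = 0).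
Proof.
move=> iw ind ix ax; pose z := chart i x.
have Dz : (chart i @` (chart_dom i `&` triv_dom a)) z by exists x.
have fr : row_free (\matrix_j coef_row (w j) i a z).
  have := (indep_atP w ix ax).1 ind.
  rewrite (_ : form_mx w i a x = \matrix_j coef_row (w j) i a z)//.
  by apply/matrixP => j p; rewrite !mxE /local_form /z chartK.
have iw0 j p q r : wedge3 (coef_row (w j) i a z) (curl_mx (w j) i a z) p q r = 0.
  by rewrite -wedge_dformE; apply: iw.
have [m [e [e' H]]] := wedge_normal_form (al := fun j => coef_row (w j) i a z)
  (D := fun j => curl_mx (w j) i a z) fr (fun j => curl_mx_tr (w j) i a z) iw0.
exists m, e, e' => c; rewrite -H; split=> h p q r.
  by rewrite -coef_row_comb -(curl_mx_comb _ _ Dz) -wedge_dformE.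
by rewrite wedge_dformE coef_row_comb (curl_mx_comb _ _ Dz).
Qed.

(** This is where the continuity of the partial derivatives comes in. *)
Lemma wedge_continuous w i a p q r (x : X) : chart_dom i x -> triv_dom a x ->
  {for x, continuous (fun y => wedge_dform (local_form w i a) p q r (chart i y))}.
Proof.
move=> ix ax; pose z := chart i x.
have nD : nbhs z (chart i @` (chart_dom i `&` triv_dom a)).
  by apply: chart_image_nbhs => //; exact: triv_dom_open.
have dl s : \forall y \near z, differentiable (local_form w i a s) y.
  by apply: filterS nD => y Dy; exact: local_form_diff.
have cl s : local_form w i a s @ z --> local_form w i a s z.
  by apply: differentiable_continuous; exact: nbhs_singleton (dl s).
have cd s t : dform (local_form w i a) s t @ z --> dform (local_form w i a) s t z.
  exact: (cvgB (derive_continuous (v := delta_mx ord0 s) (dl t))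
               (derive_continuous (v := delta_mx ord0 t) (dl s))).
have cz : wedge_dform (local_form w i a) p q r @ z --> wedge_dform (local_form w i a) p q r z.
  exact: (cvgD (cvgB (cvgM (cl p) (cd q r)) (cvgM (cl q) (cd p r))) (cvgM (cl r) (cd p q))).
exact: (cvg_comp _ _ (chart_continuous ix) cz).
Qed.

Lemma integrable_dense w :
  (forall O : set X, open O -> O !=set0 -> exists2 x, O x & integrable_at w x) ->
  integrable_form w.
Proof.
move=> h; apply/integrable_formP => x i a ix ax p q r.
apply: contrapT => /eqP ne.
pose F y := wedge_dform (local_form w i a) p q r (chart i y).
have cF : {for x, continuous F} := @wedge_continuous w i a p q r x ix ax.
have n1 : nbhs x (F @^-1` [set z : K | z != 0]) := cF _ (nbhs_neq ne).
have n2 : nbhs x (chart_dom i `&` triv_dom a).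
  by apply: open_nbhs_nbhs; split => //; apply: openI;
    [exact: chart_dom_open|exact: triv_dom_open].
have n3 := @filterI _ _ (nbhs_filter x) _ _ n1 n2.
have [y Oy ay] := h _ (open_interior _) (ex_intro _ x n3).
have [Fy [iy ty]] := interior_subset Oy.
by move: Fy; rewrite /= /F (ay i a iy ty p q r) eqxx.
Qed.

End Integrability.

(** * Irreducible sets in projective space *)

Section ProjectiveGeometry.
Context {K : numClosedFieldType}.
Local Notation mX i := (mpolyX K (mnm1 i)).

Lemma exists_nonroot (p : {poly K}) : p != 0 -> exists u, p.[u] != 0.
Proof.
move=> p0; apply: contrapT => /forallNP h.
pose rs := [seq (i%:R : K) | i <- iota 0 (size p)].
have : (size rs < size p)%N.
  apply: max_poly_roots => //.
    by apply/allP => u _; apply/eqP; apply: contrapT => /eqP; exact: h.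
  rewrite map_inj_uniq ?iota_uniq// => i j /eqP; rewrite eqr_nat; exact/eqP.
by rewrite size_map size_iota ltnn.
Qed.

Lemma meval_homog m d (P : mpoly m K) (c : K) (v : 'I_m -> K) :
  P \is ishomog1 d mdeg -> meval (fun i => c * v i) P = c ^+ d * meval v P.
Proof.
move=> /dhomogP hP; rewrite !mevalE mulr_sumr; apply: eq_big_seq => mm /hP <-.
rewrite [RHS]mulrCA; congr (_ * _); rewrite [c ^+ _](_ : _ = \prod_i c ^+ mm i);
  last by rewrite prodrXr -mdegE.
rewrite -big_split /=.
by apply: eq_bigr => i _; rewrite exprMn.
Qed.

Lemma homogX m (i : 'I_m) : mX i \is ishomog1 1 mdeg.
Proof. by rewrite dhomogX; apply/eqP; exact: mdeg1. Qed.

Context {V : lmodType K}.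
Implicit Types (v w : V) (Z A B : set (set V)) (f : V -> K).

Lemma line_of_refl v : line_of v v.
Proof. by exists 1 => //; rewrite scale1r. Qed.

Lemma line_ofP v w : v != 0 -> line_of v = line_of w -> exists2 c, c != 0 & w = c *: v.
Proof.
move=> v0 e; have : line_of v w by rewrite e; exact: line_of_refl.
move=> [c _ cw]; exists c => //; apply/eqP => c0.
have : line_of w v by rewrite -e; exact: line_of_refl.
by move=> [d _ dv]; move: v0; rewrite -dv -cw c0 scale0r scaler0 eqxx.
Qed.

Lemma line_ofZ c v : c != 0 -> line_of (c *: v) = line_of v.
Proof.
move=> c0; apply/seteqP; split=> _ [d _ <-].
  by exists (d * c) => //; rewrite scalerA.
by exists (d / c) => //; rewrite scalerA divfK.
Qed.

Lemma proj_space_line v : v != 0 -> proj_space (line_of v).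
Proof. by move=> v0; exists v. Qed.

Lemma proj_space_lineP (l : set V) : proj_space l -> exists2 v, v != 0 & l = line_of v.
Proof. by move=> [v v0 <-]; exists v. Qed.

Lemma hom_poly_funZ d f c v : hom_poly_fun d f -> f (c *: v) = c ^+ d * f v.
Proof.
move=> [m [l [P [hP fE]]]]; rewrite !fE -(meval_homog c _ hP).
by apply: meval_eq => i; rewrite linearZ.
Qed.

Lemma hom_poly_fun_line d f v : hom_poly_fun d f -> f v = 0 ->
  forall u, line_of v u -> f u = 0.
Proof. by move=> hf fv u [c _ <-]; rewrite (hom_poly_funZ _ _ hf) fv mulr0. Qed.

(** V is not assumed to be of finite dimension, so a curve is tested on linear
    forms. *)
Definition poly_curve (c : K -> V) :=
  forall l : {linear V -> K^o}, exists p : {poly K}, forall t, l (c t) = p.[t].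

Lemma hom_poly_curve d f c : hom_poly_fun d f -> poly_curve c ->
  exists p : {poly K}, forall t, f (c t) = p.[t].
Proof.
move=> [m [l [P [hP fE]]]] hc.
have /choice[q hq] : forall i, exists p : {poly K}, forall t, l i (c t) = p.[t].
  by move=> i; exact: hc.
exists (\sum_(mm <- msupp P) mcoeff mm P *: \prod_i q i ^+ mm i) => t.
rewrite fE mevalE horner_sum; apply: eq_bigr => mm _.
rewrite hornerZ horner_prod; congr (_ * _); apply: eq_bigr => i _.
by rewrite horner_exp hq.
Qed.

Lemma not_closed A v : zariski_closed A -> v != 0 -> ~ A (line_of v) ->
  exists d (f : V -> K), [/\ hom_poly_fun d f, f v != 0 &
    forall u, A (line_of u) -> f u = 0].
Proof.
move=> [S [hS ->]] v0 nA.
have : ~ forall f, S f -> forall u, line_of v u -> f u = 0.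
  by move=> h; apply: nA; split => //; exact: proj_space_line.
move=> /existsNP[f /not_implyP[Sf /existsNP[u /not_implyP[vu fu]]]].
have [d hf] := hS f Sf; exists d, f; split => //.
  by apply/eqP => fv; apply: fu; exact: (hom_poly_fun_line hf fv vu).
by move=> w [_ /(_ f Sf w)]; apply; exact: line_of_refl.
Qed.

Lemma closed_hypersurface d f : hom_poly_fun d f ->
  zariski_closed [set l | proj_space l /\ forall v, l v -> f v = 0].
Proof.
move=> hf; exists [set f]; split; first by move=> _ ->; exists d.
apply/seteqP; split=> l [pl hl]; split => //; first by move=> _ ->.
exact: hl.
Qed.

(** If Z were the union of two proper closed subsets, equations of these that
    are not 0 at v and at w would restrict to nonzero polynomials on the curve,
    and a point of the curve in Z avoiding both their zeros would be in neither
    subset. *)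
Lemma irreducible_by_curves Z : Z !=set0 -> Z `<=` proj_space ->
  (forall v w, v != 0 -> w != 0 -> Z (line_of v) -> Z (line_of w) ->
     exists (c : K -> V) (s t a b : K) (q : {poly K}),
      [/\ poly_curve c, c s = a *: v, c t = b *: w, (a != 0) && (b != 0) && (q != 0) &
          forall u, q.[u] != 0 -> c u != 0 /\ Z (line_of (c u))]) ->
  irreducible_set Z.
Proof.
move=> Z0 Zp hZ; split=> // A B cA cB ZAB; apply: contrapT.
move=> /not_orP[/existsNP[l1 /not_implyP[Zl1 nA]] /existsNP[l2 /not_implyP[Zl2 nB]]].
have [v v0 e1] := proj_space_lineP (Zp _ Zl1); subst l1.
have [w w0 e2] := proj_space_lineP (Zp _ Zl2); subst l2.
have [d [f [hf fv fA]]] := not_closed cA v0 nA.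
have [d' [g [hg gw gB]]] := not_closed cB w0 nB.
have [c [s [t [a [b [q [hc cs ct /andP[/andP[a0 b0] q0] hq]]]]]]] := hZ v w v0 w0 Zl1 Zl2.
have [p hp] := hom_poly_curve hf hc; have [p' hp'] := hom_poly_curve hg hc.
have p0 : p != 0.
  apply/eqP => p0; move: (hp s); rewrite p0 horner0 cs (hom_poly_funZ _ _ hf).
  by apply/eqP; rewrite mulf_neq0// expf_neq0.
have p'0 : p' != 0.
  apply/eqP => p'0; move: (hp' t); rewrite p'0 horner0 ct (hom_poly_funZ _ _ hg).
  by apply/eqP; rewrite mulf_neq0// expf_neq0.
have [u] := exists_nonroot (mulf_neq0 (mulf_neq0 p0 p'0) q0).
rewrite !hornerM !mulf_eq0 !negb_or => /andP[/andP[pu p'u] qu].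
have [cu0 Zcu] := hq u qu.
case: (ZAB _ Zcu) => [/fA|/gB] e.
  by move: pu; rewrite -hp e eqxx.
by move: p'u; rewrite -hp' e eqxx.
Qed.

(** Each P defines a closed hypersurface that does not contain Z, and an
    irreducible set is not covered by finitely many of these. The product of the
    P is a homogeneous polynomial function because the linear forms are common
    to all P. *)
Lemma irreducible_generic Z m (l : 'I_m -> {linear V -> K^o}) (s : seq (mpoly m K)) :
  irreducible_set Z -> Z `<=` proj_space ->
  (forall P, P \in s -> exists d, P \is ishomog1 d mdeg) ->
  (forall P, P \in s -> exists v, [/\ v != 0, Z (line_of v) & meval (l^~ v) P != 0]) ->
  exists v, [/\ v != 0, Z (line_of v) & forall P, P \in s -> meval (l^~ v) P != 0].
Proof.
move=> [[l0 Zl0] irr] Zp hs ns.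
suff [_ [v [v0 Zv hv]]] : (exists d, \prod_(P <- s) P \is ishomog1 d mdeg) /\
    exists v, [/\ v != 0, Z (line_of v) & meval (l^~ v) (\prod_(P <- s) P) != 0].
  exists v; split => // P Ps; apply: contra_neq hv => e.
  by rewrite (big_rem P)//= mevalM e mul0r.
elim: s hs ns => [|P s ih] hs ns.
  split; first by exists 0%N; rewrite big_nil; exact: dhomog1.
  have [v v0 e] := proj_space_lineP (Zp _ Zl0); subst l0.
  by exists v; split => //; rewrite big_nil meval1 oner_neq0.
have [] := ih.
- by move=> Q Qs; apply: hs; rewrite inE Qs orbT.
- by move=> Q Qs; apply: ns; rewrite inE Qs orbT.
move=> [d hd] [v [v0 Zv hv]].
have [e he] := hs P (mem_head _ _).
have [w [w0 Zw hw]] := ns P (mem_head _ _).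
split; first by exists (e + d)%N; rewrite big_cons; exact: dhomogM.
apply: contrapT => h.
pose f (u : V) := meval (l^~ u) P; pose g (u : V) := meval (l^~ u) (\prod_(Q <- s) Q).
have hf : hom_poly_fun e f by exists m, l, P.
have hg : hom_poly_fun d g by exists m, l, (\prod_(Q <- s) Q).
have [|hA|hB] := irr _ _ (closed_hypersurface hf) (closed_hypersurface hg).
- move=> l' Zl'; have [u u0 eu] := proj_space_lineP (Zp _ Zl'); subst l'.
  have [fu|fu] := eqVneq (f u) 0.
    left; split; first exact: proj_space_line.
    exact: hom_poly_fun_line hf fu.
  right; split; first exact: proj_space_line.
  apply: (hom_poly_fun_line hg); apply/eqP; apply: contrapT => /negP gu.
  by apply: h; exists u; split => //; rewrite big_cons mevalM mulf_neq0.
- by have [_ /(_ w (line_of_refl w))] := hA _ Zw; apply/eqP.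
- by have [_ /(_ v (line_of_refl v))] := hB _ Zv; apply/eqP.
Qed.

End ProjectiveGeometry.

Section Image.
Context {K : numClosedFieldType} {U V : lmodType K}.
Implicit Type phi : {linear U -> V}.

Lemma line_of_image phi u : phi @` line_of u = line_of (phi u).
Proof.
apply/seteqP; split=> [_ [_ [c _ <-] <-]|_ [c _ <-]].
  by exists c => //; rewrite linearZ.
by exists (c *: u); [exists c|rewrite linearZ].
Qed.

(** Closed sets of V pull back along phi to closed sets of U. *)
Lemma irreducible_image phi (Z : set (set U)) : injective phi ->
  Z `<=` proj_space -> irreducible_set Z -> irreducible_set (proj_image phi Z).
Proof.
move=> inj Zp [[l Zl] irr]; split; first by exists (phi @` l), l.
have pull A : zariski_closed A ->
    exists A' : set (set U), zariski_closed A' /\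
      forall u, u != 0 -> A' (line_of u) <-> A (line_of (phi u)).
  move=> [S [hS ->]].
  exists [set l | proj_space l /\ forall f, (exists2 g, S g & f = g \o phi) ->
    forall v, l v -> f v = 0]; split.
    exists [set f | exists2 g, S g & f = g \o phi]; split => //.
    move=> _ [g /hS[d [m [ll [P [hP gE]]]]] ->]; exists d, m.
    by exists (fun i => ll i \o phi : {linear U -> K^o}), P; split => // v /=; rewrite gE.
  move=> u u0; split=> [[_ h]|[_ h]].
    split; first by apply: proj_space_line; rewrite -(linear0 phi) inj_eq.
    move=> g Sg _ [c _ <-]; rewrite -linearZ.
    by apply: (h (g \o phi)); [exists g|exists c].
  split; first exact: proj_space_line.
  move=> _ [g Sg ->] _ [c _ <-] /=; rewrite linearZ; apply: h => //.
  by exists c.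
move=> A B /pull[A' [cA' hA']] /pull[B' [cB' hB']] h.
case: (irr A' B' cA' cB').
- move=> l' Zl'; have [u u0 e] := proj_space_lineP (Zp _ Zl'); subst l'.
  have /h[] : proj_image phi Z (line_of (phi u)) by exists (line_of u) => //;
    exact: line_of_image.
    by left; apply/hA'.
  by right; apply/hB'.
- move=> ZA; left=> _ [l' Zl' <-]; have [u u0 e] := proj_space_lineP (Zp _ Zl'); subst l'.
  by rewrite line_of_image; apply/hA' => //; exact: ZA.
- move=> ZB; right=> _ [l' Zl' <-]; have [u u0 e] := proj_space_lineP (Zp _ Zl'); subst l'.
  by rewrite line_of_image; apply/hB' => //; exact: ZB.
Qed.

End Image.

(** * The Veronese parametrization of the rational normal curve *)

Section Coordinates.
Context {K : numClosedFieldType} {n : nat}.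
Definition coord_fun (i : 'I_n) (v : 'rV[K]_n) : K^o := v ord0 i.
Lemma coord_fun_linear i : linear (coord_fun i).
Proof. by move=> c u v; rewrite /coord_fun !mxE. Qed.
HB.instance Definition _ i := GRing.isLinear.Build K 'rV[K]_n K^o _ (coord_fun i)
  (coord_fun_linear i).
Definition coordl i : {linear 'rV[K]_n -> K^o} := coord_fun i.

Lemma hom_poly_coord d (P : mpoly n K) : P \is ishomog1 d mdeg ->
  hom_poly_fun d (fun v : 'rV[K]_n => meval (v ord0) P).
Proof. by move=> hP; exists n, coordl, P. Qed.
End Coordinates.

Section StandardCurve.
Context {K : numClosedFieldType} (h : nat).
Local Notation k := h.+1.
Local Notation mX i := (mpolyX K (mnm1 i)).
Implicit Types (u v w : 'rV[K]_k.+1) (s t : K).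

Definition veronese s t : 'rV[K]_k.+1 := \row_j (s ^+ (k - j) * t ^+ j).

Definition rnc : set (set 'rV[K]_k.+1) :=
  [set l | exists s t, (s != 0) || (t != 0) /\ l = line_of (veronese s t)].

(** Indexing by natural numbers lets consecutive coordinates be written without
    casts. *)
Definition entry v (j : nat) : K := v ord0 (inord j).

Lemma entry_veronese s t j : (j <= k)%N -> entry (veronese s t) j = s ^+ (k - j) * t ^+ j.
Proof. by move=> jk; rewrite /entry mxE inordK. Qed.

Lemma entry_eq u v : (forall j, (j <= k)%N -> entry u j = entry v j) -> u = v.
Proof.
move=> e; apply/rowP => j; have := e j; rewrite /entry inord_val; apply.
by rewrite -ltnS.
Qed.

Lemma entryD u v j : entry (u + v) j = entry u j + entry v j. Proof. by rewrite /entry mxE. Qed.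
Lemma entryN u j : entry (- u) j = - entry u j. Proof. by rewrite /entry mxE. Qed.
Lemma entryZ c u j : entry (c *: u) j = c * entry u j. Proof. by rewrite /entry mxE. Qed.
Lemma entry0 j : entry 0 j = 0. Proof. by rewrite /entry mxE. Qed.

Lemma veronese_neq0 s t : (s != 0) || (t != 0) -> veronese s t != 0.
Proof.
case/orP => [s0|t0]; apply/eqP.
  move=> /(congr1 (entry^~ 0%N)); rewrite entry_veronese// entry0 subn0 mulr1.
  by apply/eqP; exact: expf_neq0.
move=> /(congr1 (entry^~ k)); rewrite entry_veronese// entry0 subnn mul1r.
by apply/eqP; exact: expf_neq0.
Qed.

Lemma veronese_scale c s t : veronese (c * s) (c * t) = c ^+ k *: veronese s t.
Proof.
apply: entry_eq => j jk; rewrite entryZ !entry_veronese// !exprMn mulrACA -exprD subnK//.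
Qed.

Lemma rnc_veronese s t : (s != 0) || (t != 0) -> rnc (line_of (veronese s t)).
Proof. by move=> st; exists s, t. Qed.

Lemma rnc_proj : rnc `<=` proj_space.
Proof. by move=> _ [s [t [st ->]]]; apply: proj_space_line; exact: veronese_neq0. Qed.

(** The scalar is absorbed by its k-th root. *)
Lemma rnc_cone v : v != 0 -> rnc (line_of v) ->
  exists s t, (s != 0) || (t != 0) /\ v = veronese s t.
Proof.
move=> v0 [s [t [st e]]]; have [c c0 ->] := line_ofP (veronese_neq0 st) (esym e).
exists ((k.-root c) * s), ((k.-root c) * t); rewrite veronese_scale rootCK//.
by rewrite !mulf_eq0 !negb_or rootC_eq0// c0.
Qed.

Definition minor_eqs v := forall i j, (i < k)%N -> (j < k)%N ->
  entry v i * entry v j.+1 = entry v i.+1 * entry v j.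

Lemma veronese_minors s t : minor_eqs (veronese s t).
Proof.
move=> i j ik jk; have ik' := ltnW ik; have jk' := ltnW jk; rewrite !entry_veronese//.
have -> : (k - i = (k - i.+1).+1)%N by rewrite subnSK.
have -> : (k - j = (k - j.+1).+1)%N by rewrite subnSK.
rewrite !exprS; ring.
Qed.

(** If v_0 is not 0, the equations with i = 0 say that v is a geometric
    progression; if v_0 = 0, they kill all coordinates but the last. *)
Lemma rncP v : v != 0 -> rnc (line_of v) <-> minor_eqs v.
Proof.
move=> v0; split=> [/(rnc_cone v0)[s [t [_ ->]]]|hv]; first exact: veronese_minors.
have [c0|c0] := eqVneq (entry v 0) 0.
  have vj j : (j < k)%N -> entry v j = 0.
    elim: j => // j ih jk; have := hv j j.+1 (ltnW jk) jk.
    by rewrite ih ?(ltnW jk)// mul0r => /esym/eqP; rewrite -expr2 expf_eq0 /= => /eqP.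
  have e : v = entry v k *: veronese 0 1.
    apply: entry_eq => j jk; rewrite entryZ entry_veronese// expr1n mulr1.
    move: jk; rewrite leq_eqVlt => /predU1P[->|jk]; first by rewrite subnn mulr1.
    by rewrite vj// expr0n subn_eq0 leqNgt jk /= mulr0.
  have ck : entry v k != 0 by apply: contra_neq v0 => ck; rewrite e ck scale0r.
  by rewrite e line_ofZ//; apply: rnc_veronese; rewrite oner_neq0 orbT.
have e : v = entry v 0 *: veronese 1 (entry v 1 / entry v 0).
  apply: entry_eq => j jk; rewrite entryZ entry_veronese// expr1n mul1r.
  elim: j jk => [|j ih] jk; first by rewrite mulr1.
  apply: (mulfI c0); rewrite (hv 0%N j)// ih 1?ltnW// exprS; field.
  by rewrite c0.
by rewrite e line_ofZ//; apply: rnc_veronese; rewrite oner_neq0.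
Qed.

Definition minor_poly (i j : 'I_k.+1) (i' j' : 'I_k.+1) : mpoly k.+1 K :=
  mX i * mX j - mX i' * mX j'.

Lemma minor_poly_homog i j i' j' : minor_poly i j i' j' \is ishomog1 2 mdeg.
Proof.
apply: dhomogD; last rewrite dhomogN.
  by apply: (@dhomogM _ _ _ 1 _ 1); exact: homogX.
by apply: (@dhomogM _ _ _ 1 _ 1); exact: homogX.
Qed.

Lemma minor_poly_eval i j i' j' v :
  meval (v ord0) (minor_poly i j i' j') = v ord0 i * v ord0 j - v ord0 i' * v ord0 j'.
Proof. by rewrite /minor_poly mevalB !mevalM !mevalXU. Qed.

Lemma rnc_closed : zariski_closed rnc.
Proof.
exists [set f | exists i j, [/\ (i < k)%N, (j < k)%N &
  f = fun v => meval (v ord0) (minor_poly (inord i) (inord j.+1) (inord i.+1) (inord j))]].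
split.
  by move=> f [i [j [_ _ ->]]]; exists 2%N; apply: hom_poly_coord; exact: minor_poly_homog.
apply/seteqP; split=> [l Dl|l [/proj_space_lineP[v v0 ->] hl]].
  split; first exact: rnc_proj.
  have [s [t [st e]]] := Dl; move=> _ [i [j [ik jk ->]]]; rewrite e => _ [c _ <-].
  have := veronese_minors s t ik jk; rewrite minor_poly_eval !mxE => e'.
  rewrite [X in X - _](_ : _ = c * c * (entry (veronese s t) i * entry (veronese s t) j.+1));
    last by rewrite /entry !mxE; ring.
  rewrite veronese_minors// /entry !mxE; ring.
apply/rncP => // i j ik jk; apply/eqP; rewrite -subr_eq0; apply/eqP.
rewrite -[RHS](hl (fun v => meval (v ord0) (minor_poly (inord i) (inord j.+1) (inord i.+1)
  (inord j))) _ v).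
- by rewrite minor_poly_eval.
- by exists i, j.
- exact: line_of_refl.
Qed.

Lemma veronese_curve (a b c d : K) : poly_curve (fun x => veronese (a + b * x) (c + d * x)).
Proof.
move=> l.
exists (\sum_j (l (delta_mx ord0 j)) *: ((a%:P + b *: 'X) ^+ (k - j) * (c%:P + d *: 'X) ^+ j))
  => x.
rewrite [veronese _ _]row_sum_delta linear_sum horner_sum; apply: eq_bigr => j _.
rewrite linearZ hornerZ /= [LHS]mulrC mxE; congr (_ * _).
by rewrite hornerM !horner_exp !hornerE.
Qed.

Lemma rnc_irreducible : irreducible_set rnc.
Proof.
apply: irreducible_by_curves; [|exact: rnc_proj|].
  by exists (line_of (veronese 1 0)); apply: rnc_veronese; rewrite oner_neq0.
move=> v w v0 w0 /(rnc_cone v0)[s [t [st ->]]] /(rnc_cone w0)[s' [t' [st' ->]]].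
suff [q q0 hq] : exists2 q : {poly K}, q != 0 &
    forall x, q.[x] != 0 -> (s + (s' - s) * x != 0) || (t + (t' - t) * x != 0).
  exists (fun x => veronese (s + (s' - s) * x) (t + (t' - t) * x)), 0, 1, 1, 1, q.
  split.
  - exact: veronese_curve.
  - by rewrite !mulr0 !addr0 scale1r.
  - by rewrite !mulr1 addrC subrK addrC subrK scale1r.
  - by rewrite oner_neq0.
  - by move=> u /hq hu; split; [exact: veronese_neq0|exact: rnc_veronese].
case/orP: st => [s0|t0].
  exists (s%:P + (s' - s) *: 'X); last by move=> x; rewrite !hornerE => ->.
  by apply: contra_neq s0 => /(congr1 (fun p => p.[0])); rewrite !hornerE.
exists (t%:P + (t' - t) *: 'X); last by move=> x; rewrite !hornerE => ->; rewrite orbT.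
by apply: contra_neq t0 => /(congr1 (fun p => p.[0])); rewrite !hornerE.
Qed.

End StandardCurve.

(** * Dimension and rationality of the rational normal curve *)

Section CurveGeometry.
Context {K : numClosedFieldType} (h : nat).
Local Notation k := h.+1.
Local Notation mX i := (mpolyX K (mnm1 i)).
Local Notation veronese := (@veronese K h).
Local Notation rnc := (@rnc K h).
Implicit Types (u v w : 'rV[K]_k.+1) (s t : K).

Lemma veronese_same (a b s t : K) : (a != 0) || (b != 0) -> (s != 0) || (t != 0) ->
  a * t - b * s = 0 -> line_of (veronese s t) = line_of (veronese a b).
Proof.
move=> ab st /eqP; rewrite subr_eq0 => /eqP e.
suff [c c0 [-> ->]] : exists2 c, c != 0 & s = c * a /\ t = c * b.
  by rewrite veronese_scale line_ofZ// expf_neq0.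
have [a0|a0] := eqVneq a 0.
  rewrite a0 eqxx /= in ab; have s0 : s = 0.
    by apply: (mulfI ab); rewrite -e a0 mul0r mulr0.
  rewrite s0 eqxx /= in st.
  by exists (t / b); rewrite ?mulf_neq0 ?invr_eq0// a0 mulr0 divfK.
have et : t = s / a * b by apply: (mulfI a0); rewrite e; field.
exists (s / a); last by split=> //; rewrite divfK.
rewrite mulf_neq0 ?invr_eq0//; apply/eqP => s0; move: st.
by rewrite et s0 !mul0r eqxx.
Qed.

Lemma nonzero_in_affine_chart (f : 'rV[K]_k.+1 -> K) d s t :
  hom_poly_fun d f -> f (veronese s t) != 0 ->
  exists t', f (veronese 1 t') != 0.
Proof.
move=> hf f0.
have [p hp] := hom_poly_curve hf (veronese_curve s 1 t 0).
have p0 : p != 0.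
  by apply: contra_neq f0 => p0; have := hp 0; rewrite p0 horner0 !mulr0 !addr0.
have q0 : (s%:P + 'X : {poly K}) != 0.
  by rewrite -size_poly_eq0 addrC size_XaddC.
have [u] := exists_nonroot (mulf_neq0 p0 q0).
rewrite !hornerE -hp mul0r addr0 mul1r mulf_eq0 negb_or => /andP[fu su].
exists (t / (s + u)); apply: contra_neq fu => e.
have -> : veronese (s + u) t = veronese ((s + u) * 1) ((s + u) * (t / (s + u))).
  by rewrite mulr1 mulrCA divff// mulr1.
by rewrite veronese_scale (hom_poly_funZ _ _ hf) e mulr0.
Qed.

(** An equation of A that is not identically 0 on the curve is a nonzero
    polynomial in the affine coordinate t/s; the pairs are its roots and the
    point at infinity. *)
Lemma closed_proper_finite A : zariski_closed A -> ~ (rnc `<=` A) ->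
  exists rs : seq (K * K), (forall ab, ab \in rs -> (ab.1 != 0) || (ab.2 != 0)) /\
    forall s t, (s != 0) || (t != 0) -> A (line_of (veronese s t)) ->
      exists2 ab, ab \in rs & ab.1 * t - ab.2 * s = 0.
Proof.
move=> cA /existsNP[_ /not_implyP[[s [t [st ->]]] nA]].
have [d [f [hf fv fA]]] := not_closed cA (veronese_neq0 _ st) nA.
have [t' ft'] := nonzero_in_affine_chart hf fv.
have [p hp] := hom_poly_curve hf (veronese_curve 1 0 0 1).
have {}hp x : f (veronese 1 x) = p.[x] by rewrite -hp mul0r addr0 add0r mul1r.
have p0 : p != 0 by apply: contra_neq ft' => p0; rewrite hp p0 horner0.
have [rs prs] := closed_field_poly_normal p.
have hrs x : f (veronese 1 x) = 0 -> x \in rs.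
  rewrite hp prs => /eqP; rewrite -/(root _ _) rootZ ?lead_coef_eq0//.
  by rewrite root_prod_XsubC.
exists ((0, 1) :: [seq (1, r) | r <- rs]); split.
  move=> ab; rewrite inE => /predU1P[->|/mapP[r _ ->]] /=; first by rewrite oner_neq0 orbT.
  by rewrite oner_neq0.
move=> s' t'' st' As; have [s0|s0] := eqVneq s' 0.
  by exists (0, 1); [exact: mem_head|rewrite /= s0 mul0r mulr0 subrr].
exists (1, t'' / s'); last by rewrite /= divfK// mul1r subrr.
rewrite inE; apply/orP; right; apply/mapP; exists (t'' / s') => //.
apply: hrs; apply: fA; rewrite -(veronese_same (s := s') (t := t'')) ?oner_neq0//.
by rewrite divfK// mul1r subrr.
Qed.

(** The hyperplane meeting the curve at the point ab only, with multiplicity k. *)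
Definition osculating (ab : K * K) : mpoly k.+1 K :=
  \sum_(j < k.+1) ((- ab.2) ^+ (k - j) * ab.1 ^+ j *+ 'C(k, j)) *: mX j.

Lemma osculating_homog ab : osculating ab \is ishomog1 1 mdeg.
Proof. by apply: rpred_sum => j _; apply: dhomogZ; exact: homogX. Qed.

Lemma osculating_eval ab s t :
  meval ((veronese s t) ord0) (osculating ab) = (ab.1 * t - ab.2 * s) ^+ k.
Proof.
rewrite [RHS](_ : _ = (- ab.2 * s + ab.1 * t) ^+ k); last by rewrite mulNr addrC.
rewrite exprDn /osculating raddf_sum; apply: eq_bigr => j _; rewrite /=.
rewrite mevalZ mevalXU mxE !exprMn mulrnAl; congr (_ *+ _); ring.
Qed.

(** A is covered by the osculating hyperplanes at finitely many points of the
    curve, hence contained in one of them. *)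
Lemma closed_irreducible_point A : zariski_closed A -> irreducible_set A ->
  A `<=` rnc -> ~ (rnc `<=` A) -> exists l, A = [set l].
Proof.
move=> cA irr AD nA; have [rs [rs0 hrs]] := closed_proper_finite cA nA.
have Ap : A `<=` proj_space by move=> l /AD; exact: rnc_proj.
have [ab abrs hab] : exists2 ab, ab \in rs &
    forall v, v != 0 -> A (line_of v) -> meval (v ord0) (osculating ab) = 0.
  apply: contrapT => hn.
  have [||v [v0 Av hv]] := irreducible_generic (l := coordl) (s := map osculating rs) irr Ap.
  - by move=> P /mapP[ab _ ->]; exists 1%N; exact: osculating_homog.
  - move=> P /mapP[ab abrs ->]; apply: contrapT => hP; apply: hn; exists ab => // v v0 Av.
    by apply/eqP; apply: contrapT => /negP e; apply: hP; exists v.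
  - have [s [t [st e]]] := rnc_cone v0 (AD _ Av); subst v.
    have [ab abrs e] := hrs s t st Av.
    have := hv _ (map_f osculating abrs).
    by rewrite (_ : meval _ _ = meval ((veronese s t) ord0) (osculating ab))// osculating_eval
      e expr0n eqxx.
have hl l : A l -> l = line_of (veronese ab.1 ab.2).
  move=> Al; have [v v0 e] := proj_space_lineP (Ap _ Al); subst l.
  have [s [t [st e]]] := rnc_cone v0 (AD _ Al); subst v.
  apply: veronese_same => //; first exact: rs0.
  by have := hab _ v0 Al; rewrite osculating_eval => /eqP; rewrite expf_eq0 /= => /eqP.
exists (line_of (veronese ab.1 ab.2)); apply/seteqP; split=> [l /hl//|_ ->].
by have [[l Al] _] := irr; rewrite -(hl l Al).
Qed.

Lemma point_closed n (v : 'rV[K]_n) : v != 0 -> zariski_closed [set line_of v].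
Proof.
move=> v0; have [i vi] : exists i, v ord0 i != 0.
  apply: contrapT => /forallNP hv; move/eqP: v0; apply; apply/rowP => j; rewrite mxE.
  by apply/eqP; apply: contrapT => /negP e; exact: (hv j e).
pose P j : mpoly n K := v ord0 i *: mX j - v ord0 j *: mX i.
have hP j : P j \is ishomog1 1 mdeg.
  by apply: dhomogD; rewrite ?dhomogN; apply: dhomogZ; exact: homogX.
have eP j (u : 'rV[K]_n) : meval (u ord0) (P j) = v ord0 i * u ord0 j - v ord0 j * u ord0 i.
  by rewrite /P mevalB !mevalZ !mevalXU.
exists [set f | exists j, f = fun u : 'rV[K]_n => meval (u ord0) (P j)]; split.
  by move=> f [j ->]; exists 1%N; exact: hom_poly_coord.
apply/seteqP; split=> [_ ->|l [/proj_space_lineP[u u0 ->] hu]].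
  split; first exact: proj_space_line.
  by move=> _ [j ->] _ [c _ <-]; rewrite eP !mxE; ring.
have e : u = (u ord0 i / v ord0 i) *: v.
  apply/rowP => j; rewrite mxE; apply: (mulfI vi).
  have := hu (fun u : 'rV[K]_n => meval (u ord0) (P j)) (ex_intro _ j erefl) u (line_of_refl u).
  by rewrite eP => /eqP; rewrite subr_eq0 => /eqP ->; field.
rewrite /= e line_ofZ//; apply: contra_neq u0 => c0; by rewrite e c0 scale0r.
Qed.

Lemma point_irreducible (V : lmodType K) (l : set V) : irreducible_set [set l].
Proof.
split; first by exists l.
by move=> A B _ _ AB; case: (AB l erefl) => ?; [left|right] => _ ->.
Qed.

Lemma rnc_dimension : proj_dimension rnc 1.
Proof.
split; last first.
  move=> [c [hc cs]].
  have [cl1 ir1 s1] := hc 1%N isT; have [cl2 ir2 s2] := hc 2%N isT.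
  have [cl0 ir0 s0] := hc 0%N isT.
  have [c01 nc10] := cs 0%N isT; have [c12 nc21] := cs 1%N isT.
  have [|l e] := closed_irreducible_point cl1 ir1 s1.
    by move=> Dc1; apply: nc21 => x /s2 /Dc1.
  apply: nc10 => x; rewrite e => ->; have [[y y0] _] := ir0.
  by have := c01 _ y0; rewrite e => <-.
have st : ((1 : K) != 0) || ((0 : K) != 0) by rewrite oner_neq0.
exists (fun i => if i is 0%N then [set line_of (veronese 1 0)] else rnc); split.
  case=> [|i] _; split.
  - by apply: point_closed; exact: veronese_neq0.
  - exact: point_irreducible.
  - by move=> _ ->; exact: rnc_veronese.
  - exact: rnc_closed.
  - exact: rnc_irreducible.
  - by [].
case=> // _; split; first by move=> _ ->; exact: rnc_veronese.
have st' : ((0 : K) != 0) || ((1 : K) != 0) by rewrite oner_neq0 orbT.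
move=> /(_ _ (rnc_veronese _ st')) /= e.
have [c c0] := line_ofP (veronese_neq0 _ st') e.
move/(congr1 (fun v : 'rV_k.+1 => entry v 0));
  rewrite entryZ !entry_veronese// subn0 !expr0 expr1n expr0n /= !mulr1 mulr0.
by apply/eqP; exact: oner_neq0.
Qed.

Lemma rnc_nondegenerate : Defs.nondegenerate rnc.
Proof.
move=> a a0 sub; pose p := \poly_(i < k.+1) a ord0 (inord i).
have p0 : p != 0.
  apply: contra_neq a0 => p0; apply/rowP => j; rewrite mxE.
  have := congr1 (fun q : {poly K} => q`_j) p0.
  by rewrite coef0 coef_poly ltn_ord inord_val.
have [u] := exists_nonroot p0; apply/negP; rewrite negbK; apply/eqP.
have st : ((1 : K) != 0) || (u != 0) by rewrite oner_neq0.
have [_ /(_ _ (line_of_refl _)) <-] := sub _ (rnc_veronese _ st).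
rewrite horner_poly; apply: eq_bigr => j _.
by rewrite inord_val mxE expr1n mul1r.
Qed.

Definition P1_param (j : 'I_k.+1) : mpoly 2 K := mX ord0 ^+ (k - j) * mX ord_max ^+ j.
Definition P1_coord (j : 'I_2) : mpoly k.+1 K := mX (inord j).

Lemma eval_param (x : 'rV[K]_2) : eval_map P1_param x = veronese (x ord0 ord0) (x ord0 ord_max).
Proof.
apply/rowP => j; rewrite !mxE /P1_param mevalM; congr (_ * _).
  by rewrite rmorphXn /= mevalXU.
by rewrite rmorphXn /= mevalXU.
Qed.

Lemma row2P (x y : 'rV[K]_2) : x ord0 ord0 = y ord0 ord0 ->
  x ord0 ord_max = y ord0 ord_max -> x = y.
Proof.
move=> e0 e1; apply/rowP => j; case: (unliftP ord_max j) => [i ->|-> //].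
by rewrite (_ : lift _ _ = ord0)//; apply: val_inj; case: i => [[]].
Qed.

Lemma eval_coord s t : eval_map P1_coord (veronese s t) =
  s ^+ h *: (\row_j (if j == ord0 then s else t)).
Proof.
have e (j : 'I_2) : eval_map P1_coord (veronese s t) ord0 j = entry (veronese s t) j.
  by rewrite mxE /P1_coord mevalXU.
apply: row2P; rewrite e !mxE entry_veronese//= ?expr0 ?mulr1 ?expr1 ?subn1 //= ?subn0.
by rewrite exprSr.
Qed.

(** The projection to the first two coordinates inverts the parametrization
    where s is not 0: the composites are multiplications by powers of s. *)
Lemma rnc_birational : rational_variety_P1 rnc.
Proof.
have cX n (i : 'I_n) :
    zariski_closed [set l : set 'rV[K]_n | proj_space l /\
      forall v : 'rV[K]_n, l v -> meval (v ord0) (mX i) = 0].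
  apply: (closed_hypersurface (d := 1)); apply: hom_poly_coord; exact: homogX.
exists 1%N, k, P1_coord, P1_param; split.
- by move=> j; exact: homogX.
- move=> j; have -> : k = (1 * (k - j) + 1 * j)%N.
    by rewrite !mul1n subnK// -ltnS.
  by apply: dhomogM; apply: dhomogMn; exact: homogX.
- exists [set l : set 'rV[K]_k.+1 | proj_space l /\ forall v,
  l v -> meval (v ord0) (mX ord0) = 0].
  split; first exact: cX.
    have st : ((1 : K) != 0) || ((0 : K) != 0) by rewrite oner_neq0.
    move=> /(_ _ (rnc_veronese _ st))[_ /(_ _ (line_of_refl _))].
    by rewrite mevalXU mxE expr1n mulr1; apply/eqP; exact: oner_neq0.
  move=> v v0 Dv nA; have [s [t [st e]]] := rnc_cone v0 Dv; subst v.
  have s0 : s != 0.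
    apply/eqP => s0; apply: nA; split; first exact: proj_space_line.
    by move=> _ [c _ <-]; rewrite mevalXU !mxE s0 subn0 expr0n /= mul0r mulr0.
  have e : eval_map P1_param (eval_map P1_coord (veronese s t)) = (s ^+ h) ^+ k *: veronese s t.
    by rewrite eval_coord eval_param !mxE /= veronese_scale.
  have e0 : eval_map P1_coord (veronese s t) != 0.
    rewrite eval_coord scaler_eq0 negb_or expf_neq0//=.
    by apply: contra_neq s0 => /rowP/(_ ord0); rewrite !mxE.
  split => //; first exact: proj_space_line.
  - by rewrite e scaler_eq0 negb_or v0 !expf_neq0.
  - by rewrite e line_ofZ// !expf_neq0.
- exists [set l : set 'rV[K]_2 | proj_space l /\
      forall v : 'rV[K]_2, l v -> meval (v ord0) (mX ord0) = 0].
  split; first exact: cX.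
    have x0 : (\row_j (if j == ord0 then 1 else 0) : 'rV[K]_2) != 0.
      by apply/eqP => /rowP/(_ ord0); rewrite !mxE /=; apply/eqP; exact: oner_neq0.
    move=> /(_ _ (proj_space_line x0))[_ /(_ _ (line_of_refl _))].
    by rewrite mevalXU mxE /=; apply/eqP; exact: oner_neq0.
  move=> x x0 _ nA.
  have s0 : x ord0 ord0 != 0.
    apply/eqP => s0; apply: nA; split; first exact: proj_space_line.
    by move=> _ [c _ <-]; rewrite mevalXU !mxE s0 mulr0.
  have e : eval_map P1_coord (eval_map P1_param x) = (x ord0 ord0) ^+ h *: x.
    by rewrite eval_param eval_coord; congr (_ *: _); apply: row2P; rewrite mxE.
  split => //.
  + by rewrite eval_param; apply: veronese_neq0; rewrite s0.
  + by rewrite eval_param; apply: rnc_veronese; rewrite s0.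
  + by rewrite e scaler_eq0 negb_or x0 expf_neq0.
  + by rewrite e line_ofZ// expf_neq0.
Qed.

End CurveGeometry.

(** * The chain rule for polynomials *)

Section ChainRule.
Context {K : numClosedFieldType} {m : nat} (p : 'I_m -> {poly K}).
Implicit Type P Q : mpoly m K.

Lemma mmap_horner P t : (mmap polyC p P).[t] = meval (fun i => (p i).[t]) P.
Proof.
rewrite mevalE /mmap horner_sum; apply: eq_bigr => mm _.
rewrite hornerM hornerC /mmap1 horner_prod; congr (_ * _).
by apply: eq_bigr => i _; rewrite horner_exp.
Qed.

Definition chain_rule P :=
  (mmap polyC p P)^`() = \sum_i mmap polyC p (mderiv i P) * (p i)^`().

Lemma chain_ruleD P Q : chain_rule P -> chain_rule Q -> chain_rule (P + Q).
Proof.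
rewrite /chain_rule => hP hQ; rewrite mmapD derivD hP hQ -big_split /=.
by apply: eq_bigr => i _; rewrite mderivD mmapD mulrDl.
Qed.

Lemma chain_ruleM P Q : chain_rule P -> chain_rule Q -> chain_rule (P * Q).
Proof.
rewrite /chain_rule => hP hQ.
have mM A B : mmap polyC p (A * B) = mmap polyC p A * mmap polyC p B by rewrite rmorphM.
rewrite mM derivM hP hQ mulr_suml mulr_sumr -big_split /=.
by apply: eq_bigr => i _; rewrite mderivM mmapD !mM; ring.
Qed.

Lemma chain_ruleC c : chain_rule (mpolyC m c).
Proof.
rewrite /chain_rule mmapC derivC big1// => i _.
by rewrite mderivC mmap0 mul0r.
Qed.

Lemma chain_ruleX i : chain_rule (mpolyX K (mnm1 i)).
Proof.
rewrite /chain_rule mmapX mmap1U (bigD1 i)//= big1 ?addr0 => [|j ji].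
  rewrite mderivX mnm1E eqxx scale1r (_ : mnm_sub _ _ = mnm0).
    by rewrite mpolyX0 rmorph1 mul1r.
  by apply/mnmP => l; rewrite mnmBE mnm0E subnn.
by rewrite mderivX mnm1E eq_sym (negbTE ji) scale0r mmap0 mul0r.
Qed.

Lemma chain_ruleP P : chain_rule P.
Proof.
elim/mpolyind: P => [|c mm P _ _ hP].
  by rewrite -(mpolyC0 m); exact: chain_ruleC.
apply: chain_ruleD => //; rewrite -mul_mpolyC; apply: chain_ruleM; first exact: chain_ruleC.
rewrite mpolyXE_id; apply: big_ind => [||i _].
- by rewrite -(mpolyC1 m); exact: chain_ruleC.
- exact: chain_ruleM.
- elim: (mm i) => [|d ih]; first by rewrite expr0 -(mpolyC1 m); exact: chain_ruleC.
  by rewrite exprS; apply: chain_ruleM => //; exact: chain_ruleX.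
Qed.

End ChainRule.

(** * Smoothness of the rational normal curve *)

Section Smooth.
Context {K : numClosedFieldType} (h : nat).
Local Notation k := h.+1.
Local Notation mX i := (mpolyX K (mnm1 i)).
Local Notation veronese := (@veronese K h).
Local Notation rnc := (@rnc K h).
Implicit Types (u v w : 'rV[K]_k.+1) (s t : K) (P : mpoly k.+1 K).

(** The differential of P at v, in the direction w. *)
Definition grad P v w : K :=
  \sum_(i < k.+1) w ord0 i * meval (v ord0) (mderiv i P).

Lemma grad_lin P v a b w w' : grad P v (a *: w + b *: w') = a * grad P v w + b * grad P v w'.
Proof.
rewrite /grad !mulr_sumr -big_split /=; apply: eq_bigr => i _.
by rewrite !mxE; ring.
Qed.

Lemma meval_mderivX (v : 'rV[K]_k.+1) (i j : 'I_k.+1) :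
  meval (v ord0) (mderiv i (mX j)) = (i == j)%:R.
Proof.
rewrite mderivX mevalZ mnm1E eq_sym; case: eqVneq => [->|_]; last by rewrite mul0r.
by rewrite (_ : mnm_sub _ _ = mnm0) ?mpolyX0 ?meval1 ?mulr1//; apply/mnmP => l;
  rewrite mnmBE mnm0E subnn.
Qed.

Lemma grad_mulX a b v w : grad (mX a * mX b) v w =
  w ord0 a * v ord0 b + v ord0 a * w ord0 b.
Proof.
rewrite /grad; transitivity (\sum_i ((i == a)%:R * (w ord0 i * v ord0 b) +
                                     (i == b)%:R * (w ord0 i * v ord0 a))).
  by apply: eq_bigr => i _; rewrite mderivM mevalD !mevalM !mevalXU !meval_mderivX; ring.
have pick (c : 'I_k.+1) (F : 'I_k.+1 -> K) : \sum_i (i == c)%:R * F i = F c.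
  by rewrite (bigD1 c)//= eqxx mul1r big1 ?addr0// => i /negbTE ->; rewrite mul0r.
rewrite big_split /= !pick; ring.
Qed.

Lemma grad_minor i j i' j' v w : grad (minor_poly i j i' j') v w =
  w ord0 i * v ord0 j + v ord0 i * w ord0 j - (w ord0 i' * v ord0 j' + v ord0 i' * w ord0 j').
Proof.
rewrite -!grad_mulX /grad -sumrB; apply: eq_bigr => l _.
by rewrite /minor_poly mderivB mevalB mulrBr.
Qed.

Definition veronese_ds s t : 'rV[K]_k.+1 :=
  \row_j ((s ^+ (k - j).-1 *+ (k - j)) * t ^+ j).
Definition veronese_dt s t : 'rV[K]_k.+1 :=
  \row_j (s ^+ (k - j) * (t ^+ j.-1 *+ j)).

Lemma entry_ds s t j : (j <= k)%N ->
  entry (veronese_ds s t) j = (s ^+ (k - j).-1 *+ (k - j)) * t ^+ j.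
Proof. by move=> jk; rewrite /entry mxE inordK. Qed.
Lemma entry_dt s t j : (j <= k)%N -> entry (veronese_dt s t) j = s ^+ (k - j) * (t ^+ j.-1 *+ j).
Proof. by move=> jk; rewrite /entry mxE inordK. Qed.

Definition vanishes_on_rnc P :=
  forall u, rnc (line_of u) -> meval (u ord0) P = 0.

(** P vanishes at almost all points of the curve p, hence P o p is the zero
    polynomial, and the derivative of P o p at 0 is given by the chain rule. *)
Lemma grad_along P (p : 'I_k.+1 -> {poly K}) (q : {poly K}) : q != 0 ->
  (forall x, q.[x] != 0 -> rnc (line_of (\row_j (p j).[x]))) ->
  vanishes_on_rnc P -> grad P (\row_j (p j).[0]) (\row_j (p j)^`().[0]) = 0.
Proof.
move=> q0 hq hP.
have P0 : mmap polyC p P = 0.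
  apply/eqP; apply: contrapT => /negP P0.
  have [x] := exists_nonroot (mulf_neq0 P0 q0); rewrite hornerM mulf_eq0 negb_or => /andP[px qx].
  move: px; apply/negP; rewrite negbK mmap_horner; apply/eqP.
  rewrite -[RHS](hP _ (hq x qx)).
  by apply: meval_eq => i; rewrite mxE.
have := chain_ruleP p P; rewrite /chain_rule P0 deriv0 => /(congr1 (fun q : {poly K} => q.[0])).
rewrite horner0 horner_sum /grad => e; rewrite [RHS]e; apply: eq_bigr => i _.
rewrite hornerM mmap_horner mulrC mxE; congr (_ * _).
by apply: meval_eq => j; rewrite mxE.
Qed.

Lemma grad_ds P s t : (s != 0) || (t != 0) -> vanishes_on_rnc P ->
  grad P (veronese s t) (veronese_ds s t) = 0.
Proof.
move=> st hP; pose p (j : 'I_k.+1) : {poly K} := (s%:P + 'X) ^+ (k - j) * (t ^+ j)%:P.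
have pE x : \row_j (p j).[x] = veronese (s + x) t by apply/rowP => j; rewrite !mxE /p !hornerE.
have [q q0 hq] : exists2 q : {poly K}, q != 0 &
    forall x, q.[x] != 0 -> (s + x != 0) || (t != 0).
  exists (s%:P + 'X); first by rewrite -size_poly_eq0 addrC size_XaddC.
  by move=> x; rewrite !hornerE => ->.
rewrite -[RHS](@grad_along P p q q0 _ hP); last by move=> x /hq st'; rewrite pE;
  exact: rnc_veronese.
rewrite pE addr0; congr grad; apply/rowP => j.
rewrite !mxE /p derivM derivC mulr0 addr0 deriv_exp derivD derivC derivX add0r mul1r.
by rewrite !hornerE hornerMn horner_exp !hornerE.
Qed.

Lemma grad_dt P s t : (s != 0) || (t != 0) -> vanishes_on_rnc P ->
  grad P (veronese s t) (veronese_dt s t) = 0.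
Proof.
move=> st hP; pose p (j : 'I_k.+1) : {poly K} := (s ^+ (k - j))%:P * (t%:P + 'X) ^+ j.
have pE x : \row_j (p j).[x] = veronese s (t + x) by apply/rowP => j; rewrite !mxE /p !hornerE.
have [q q0 hq] : exists2 q : {poly K}, q != 0 &
    forall x, q.[x] != 0 -> (s != 0) || (t + x != 0).
  exists (t%:P + 'X); first by rewrite -size_poly_eq0 addrC size_XaddC.
  by move=> x; rewrite !hornerE => ->; rewrite orbT.
rewrite -[RHS](@grad_along P p q q0 _ hP); last by move=> x /hq st'; rewrite pE;
  exact: rnc_veronese.
rewrite pE addr0; congr grad; apply/rowP => j.
rewrite !mxE /p derivM derivC mul0r add0r deriv_exp derivD derivC derivX add0r mul1r.
by rewrite !hornerE hornerMn horner_exp !hornerE.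
Qed.

(** The equations of the tangent space given by the differentials of the minors. *)
Definition killed_by_minors v w := forall i j, (i < k)%N -> (j < k)%N ->
  entry w i * entry v j.+1 + entry v i * entry w j.+1 =
  entry w i.+1 * entry v j + entry v i.+1 * entry w j.

Lemma killed_minors v w :
  (forall e P, P \is ishomog1 e mdeg -> vanishes_on_rnc P -> grad P v w = 0) ->
  killed_by_minors v w.
Proof.
move=> hw i j ik jk.
have := hw 2%N _ (@minor_poly_homog K h (inord i) (inord j.+1) (inord i.+1) (inord j)) _.
rewrite grad_minor => e; apply/eqP; rewrite -subr_eq0; apply/eqP; apply: e => u Du.
have [u0|u0] := eqVneq u 0; first by rewrite minor_poly_eval u0 !mxE !mul0r subrr.
rewrite minor_poly_eval; apply/eqP; rewrite subr_eq0; apply/eqP.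
by have := (rncP u0).1 Du i j ik jk.
Qed.

(** The equations with i = 0 determine the coordinates from the first two, one
    after the other; where t is not 0, those with i = h determine them from the
    last two. *)
Lemma killed_zero_s s t w : s != 0 -> killed_by_minors (veronese s t) w ->
  entry w 0 = 0 -> entry w 1 = 0 -> w = 0.
Proof.
move=> s0 kw w0 w1; apply: entry_eq => j jk; rewrite entry0.
elim: j jk => // j ih jk; have := kw 0%N j (ltn0Sn _) jk.
rewrite w0 w1 ih ?(ltnW jk)// !mul0r mulr0 !add0r => /eqP.
by rewrite mulf_eq0 entry_veronese// subn0 expr0 mulr1 (negbTE (expf_neq0 _ s0)) /= => /eqP.
Qed.

Lemma killed_zero_t s t w : t != 0 -> killed_by_minors (veronese s t) w ->
  entry w k = 0 -> entry w h = 0 -> w = 0.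
Proof.
move=> t0 kw wk wh.
have main i : (i <= h)%N -> entry w (h - i) = 0.
  elim: i => [|i ih] ihh; first by rewrite subn0.
  have := kw (h - i.+1)%N h; rewrite subnSK// => /(_ _ _)/eqP.
  rewrite wk wh (ih (ltnW ihh)) !mulr0 !mul0r !addr0 mulf_eq0 entry_veronese//.
  rewrite subnn expr0 mul1r (negbTE (expf_neq0 _ t0)) orbF => e.
  by apply/eqP/e => //; exact: leq_trans (leq_subr _ _) (leqnSn h).
apply: entry_eq => j; rewrite entry0 leq_eqVlt => /predU1P[-> //|jh].
by rewrite -(subKn (n := h) (m := j))// main// leq_subr.
Qed.

Lemma killed_lin v a b w w' : killed_by_minors v w -> killed_by_minors v w' ->
  killed_by_minors v (a *: w + b *: w').
Proof.
move=> k1 k2 i j ik jk; have e1 := k1 i j ik jk; have e2 := k2 i j ik jk.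
rewrite !entryD !entryZ.
transitivity (a * (entry w i * entry v j.+1 + entry v i * entry w j.+1) +
              b * (entry w' i * entry v j.+1 + entry v i * entry w' j.+1)); first by ring.
by rewrite e1 e2; ring.
Qed.

(** The coefficients are chosen so that the difference of the two sides has two
    coordinates equal to 0. *)
Lemma tangent_coords s t w : (s != 0) || (t != 0) -> killed_by_minors (veronese s t) w ->
  exists a b, w = a *: veronese_ds s t + b *: veronese_dt s t.
Proof.
move=> st kw.
have kd w' : (forall P, vanishes_on_rnc P -> grad P (veronese s t) w' = 0) -> killed_by_minors
  (veronese s t) w'.
  by move=> hw'; apply: killed_minors => e P _; exact: hw'.
have k1 := kd _ (fun P => grad_ds st (P := P)); have k2 := kd _ (fun P => grad_dt st (P := P)).
have kr a b : killed_by_minors (veronese s t) (w - (a *: veronese_ds s t + b *: veronese_dt s t)).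
  have := killed_lin 1 (-1) kw (killed_lin a b k1 k2).
  by rewrite scale1r scaleN1r.
have fin a b : w - (a *: veronese_ds s t + b *: veronese_dt s t) = 0 ->
    exists a b, w = a *: veronese_ds s t + b *: veronese_dt s t.
  by move=> /eqP; rewrite subr_eq0 => /eqP e; exists a, b.
have kn : k%:R != 0 :> K by rewrite pnatr_eq0.
case/orP: st => [s0|t0].
  pose a := entry w 0 / (s ^+ h *+ k).
  pose b := (entry w 1 - a * entry (veronese_ds s t) 1) / s ^+ h.
  have sh : s ^+ h != 0 by exact: expf_neq0.
  apply: (fin a b); apply: (killed_zero_s s0 (kr a b)).
    rewrite entryD entryN entryD !entryZ entry_ds// entry_dt// subn0 mulr0n !mulr0 addr0 expr0
      mulr1 /=.
    by rewrite divfK ?subrr// -mulr_natr mulf_neq0.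
  rewrite entryD entryN entryD !entryZ [entry (veronese_dt s t) 1]entry_dt// subn1 expr0 mulr1n
    mulr1 /=.
  by rewrite /b divfK//; ring.
pose b := entry w k / (t ^+ h *+ k).
pose a := (entry w h - b * entry (veronese_dt s t) h) / t ^+ h.
have th : t ^+ h != 0 by exact: expf_neq0.
apply: (fin a b); apply: (killed_zero_t t0 (kr a b)).
  rewrite entryD entryN entryD !entryZ entry_ds// entry_dt// subnn mulr0n mul0r mulr0 add0r
    expr0 mul1r /=.
  by rewrite divfK ?subrr// -mulr_natr mulf_neq0.
rewrite entryD entryN entryD !entryZ [entry (veronese_ds s t) h]entry_ds// subSnn expr0 mulr1n
  mul1r.
by rewrite /a divfK//; ring.
Qed.

Lemma tangent_free s t a b : (s != 0) || (t != 0) ->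
  a *: veronese_ds s t + b *: veronese_dt s t = 0 -> a = 0 /\ b = 0.
Proof.
have kn : k%:R != 0 :> K by rewrite pnatr_eq0.
case/orP => [s0|t0] e.
  have sh : s ^+ h != 0 by exact: expf_neq0.
  have e0 := congr1 (fun u => entry u 0) e; have e1 := congr1 (fun u => entry u 1) e.
  have a0 : a = 0.
    move: e0; rewrite /= entryD !entryZ entry_ds// entry_dt// entry0 subn0 mulr0n !mulr0 addr0
      expr0 mulr1 /=.
    by move/eqP; rewrite -mulr_natr !mulf_eq0 (negbTE sh) (negbTE kn) !orbF => /eqP.
  split=> //; move: e1; rewrite /= entryD !entryZ a0 mul0r add0r entry_dt// entry0 subn1 expr0
    mulr1n mulr1 /=.
  by move/eqP; rewrite mulf_eq0 (negbTE sh) orbF => /eqP.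
have th : t ^+ h != 0 by exact: expf_neq0.
have e0 := congr1 (fun u => entry u k) e; have e1 := congr1 (fun u => entry u h) e.
have b0 : b = 0.
  move: e0; rewrite /= entryD !entryZ entry_ds// entry_dt// entry0 subnn mulr0n mul0r mulr0
    add0r expr0 mul1r /=.
  by move/eqP; rewrite -mulr_natr !mulf_eq0 (negbTE th) (negbTE kn) !orbF => /eqP.
split=> //; move: e1; rewrite /= entryD !entryZ b0 mul0r addr0 entry_ds// entry0 subSnn expr0
  mulr1n mul1r.
by move/eqP; rewrite mulf_eq0 (negbTE th) orbF => /eqP.
Qed.

(** The tangent space of the cone is spanned by the two partial derivatives of
    the parametrization: all equations of the curve kill them, and the minors
    kill nothing else. *)
Lemma rnc_smooth : smooth_variety rnc.
Proof.
exists 1%N; first exact: rnc_dimension.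
move=> v v0 Dv; have [s [t [st e]]] := rnc_cone v0 Dv; subst v.
have memT w : (w \in <<[:: veronese_ds s t; veronese_dt s t]>>%VS) <->
    exists a b, w = a *: veronese_ds s t + b *: veronese_dt s t.
  rewrite span_cons span_seq1; split=> [/memv_addP[_ /vlineP[a ->] [_ /vlineP[b ->] ->]]|].
    by exists a, b.
  move=> [a [b ->]]; apply: memv_add; exact/memvZ/memv_line.
exists <<[:: veronese_ds s t; veronese_dt s t]>>%VS.
  have /eqP -> // : free [:: veronese_ds s t; veronese_dt s t].
  rewrite free_cons seq1_free span_seq1; apply/andP; split.
    apply/negP => /vlineP[b e].
    have [] := @tangent_free s t 1 (- b) st; last by move/eqP; rewrite oner_eq0.
    by rewrite scale1r scaleNr -e subrr.
  apply/eqP => e; have [] := @tangent_free s t 0 1 st; last by move=> _ /eqP; rewrite oner_eq0.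
  by rewrite e scale0r scaler0 addr0.
move=> w; rewrite memT; split=> [[a [b ->]] e P _ hP|hw].
  have := grad_lin P (veronese s t) a b (veronese_ds s t) (veronese_dt s t).
  by rewrite (grad_ds st hP) (grad_dt st hP) !mulr0 addr0.
by apply: tangent_coords => //; apply: killed_minors => e P; exact: hw.
Qed.

End Smooth.

(** * Degree of the rational normal curve *)

Section Degree.
Context {K : numClosedFieldType} (h : nat).
Local Notation k := h.+1.
Local Notation mX i := (mpolyX K (mnm1 i)).
Local Notation veronese := (@veronese K h).
Local Notation rnc := (@rnc K h).

(** The size of [Sylvester_mx] depends on the degrees of the polynomials; here
    it is a parameter, and the matrix can be formed for generic coefficients and
    then specialized. *)
Definition sylvester (A : comNzRingType) (dq dp : nat) (p q : nat -> A) : 'M[A]_(dq + dp) :=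
  \matrix_(i, j) match fintype.split i with
    | inl i' => if (j < i')%N then 0 else p (j - i')%N
    | inr i' => if (j < i')%N then 0 else q (j - i')%N
    end.

Lemma sylvester_resultant (p q : {poly K}) dq dp :
  dq = (size q).-1 -> dp = (size p).-1 ->
  \det (sylvester dq dp (fun i => p`_i) (fun i => q`_i)) = resultant p q.
Proof.
move=> -> ->; rewrite /resultant; congr (\det _); apply/matrixP => i j.
rewrite /Sylvester_mx; case: (split_ordP i) => i' ->.
  by rewrite col_mxEu !mxE (unsplitK (inl i')) /= rVpoly_delta coefXnM.
by rewrite col_mxEd !mxE (unsplitK (inr i')) /= rVpoly_delta coefXnM.
Qed.

Definition gen_coef (i : nat) : mpoly k.+1 K := if (i <= k)%N then mX (inord i) else 0.
Definition gen_dcoef (i : nat) : mpoly k.+1 K := gen_coef i.+1 *+ i.+1.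
(** The resultant of the generic polynomial of degree k and of its derivative,
    times the leading coefficient. It vanishes on the hyperplanes to be avoided:
    those that are tangent to the curve or pass through its point s = 0. *)
Definition gen_disc : mpoly k.+1 K := mX ord_max * \det (sylvester h k gen_coef gen_dcoef).

Lemma gen_coef_homog i : gen_coef i \is ishomog1 1 mdeg.
Proof. by rewrite /gen_coef; case: ifP => _; [exact: homogX|exact: dhomog0]. Qed.

Lemma homog_det n d (A : 'M[mpoly k.+1 K]_n) : (forall i j, A i j \is ishomog1 d mdeg) ->
  \det A \is ishomog1 (d * n) mdeg.
Proof.
move=> hA; apply: rpred_sum => s _.
have main (r : seq 'I_n) : \prod_(i <- r) A i (s i) \is ishomog1 (d * size r) mdeg.
  elim: r => [|i r ih]; first by rewrite big_nil muln0 dhomog1.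
  by rewrite big_cons mulnS; exact: dhomogM.
have {}main : \prod_i A i (s i) \is ishomog1 (d * n) mdeg.
  by have := main (index_enum 'I_n); rewrite -[index_enum _]enumT size_enum_ord.
by case: (odd_perm s); rewrite ?expr0 ?mul1r// expr1 mulN1r dhomogN.
Qed.

Lemma gen_disc_homog : gen_disc \is ishomog1 (1 + 1 * (h + k)) mdeg.
Proof.
apply: dhomogM; first exact: homogX.
apply: homog_det => i j; rewrite mxE; case: fintype.split => i'; case: ifP => _;
  rewrite ?dhomog0//.
  exact: gen_coef_homog.
by rewrite /gen_dcoef -scaler_nat dhomogZ// gen_coef_homog.
Qed.

Definition row_poly (a : 'rV[K]_k.+1) : {poly K} := \poly_(i < k.+1) entry a i.

Lemma gen_coef_eval (a : 'rV[K]_k.+1) i : meval (a ord0) (gen_coef i) = (row_poly a)`_i.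
Proof.
rewrite /gen_coef /row_poly coef_poly ltnS.
by case: ifP => _; rewrite ?meval0// mevalXU.
Qed.

Lemma gen_disc_eval (a : 'rV[K]_k.+1) : entry a k != 0 ->
  meval (a ord0) gen_disc = entry a k * resultant (row_poly a) (row_poly a)^`().
Proof.
move=> ak; have sp : size (row_poly a) = k.+1 by rewrite size_poly_eq.
rewrite /gen_disc mevalM mevalXU (_ : ord_max = inord k); last first.
  by apply: val_inj; rewrite /= inordK.
congr (_ * _); rewrite -(@sylvester_resultant _ _ h k); last 2 first.
- have sd : (size (row_poly a)^`() <= k)%N.
    by have := @lt_size_deriv _ (row_poly a); rewrite sp; apply; rewrite -size_poly_eq0 sp.
  have : (row_poly a)^`()`_h != 0.
    rewrite coef_deriv coef_poly ltnSn -mulr_natr mulf_neq0// pnatr_eq0.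
  by case: (ltnP h (size (row_poly a)^`())) sd => [h1 h2 _|/(nth_default 0) ->];
    [apply/eqP; rewrite -eqSS prednK ?(leq_ltn_trans _ h1)// eqn_leq h1 h2|rewrite eqxx].
- by rewrite sp.
rewrite -det_map_mx; congr (\det _); apply/matrixP => i j; rewrite !mxE.
case: fintype.split => i'; case: ifP => _; rewrite /= ?meval0//; first exact: gen_coef_eval.
by rewrite coef_deriv /gen_dcoef mevalMn gen_coef_eval.
Qed.

Lemma resultant_separable (p : {poly K}) : p != 0 ->
  (resultant p p^`() != 0) = separable_poly p.
Proof.
move=> p0; rewrite resultant_eq0 -leqNgt separable_poly.unlock /coprimep.
have : size (gcdp p p^`()) != 0 by rewrite size_poly_eq0 gcdp_eq0 negb_and p0.
by case: (size _) => [|[|m]].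
Qed.

Lemma row_poly_eval (a : 'rV[K]_k.+1) x :
  (row_poly a).[x] = \sum_(i < k.+1) a ord0 i * (veronese 1 x) ord0 i.
Proof.
rewrite horner_poly; apply: eq_bigr => i _.
by rewrite /entry inord_val mxE expr1n mul1r.
Qed.

(** A hyperplane a off the zeros of [gen_disc] meets the curve at the points (1
    : x), for the k distinct roots x of [row_poly a]. *)
Lemma rnc_degree : curve_degree rnc k.
Proof.
exists [set l | proj_space l /\ forall a : 'rV[K]_k.+1, l a -> meval (a ord0) gen_disc = 0];
  split.
- apply: closed_hypersurface; apply: hom_poly_coord; exact: gen_disc_homog.
(* not all hyperplanes are excluded: take the one with roots 0, ..., k - 1 *)
- pose rs := [seq (i%:R : K) | i <- iota 0 k].
  have urs : uniq rs.
    by rewrite map_inj_uniq ?iota_uniq// => i j /eqP; rewrite eqr_nat => /eqP.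
  pose p := \prod_(r <- rs) ('X - r%:P).
  have sp : size p = k.+1 by rewrite size_prod_XsubC size_map size_iota.
  have mp : p \is monic by exact: monic_prod_XsubC.
  pose a : 'rV[K]_k.+1 := \row_i p`_i.
  have ap : row_poly a = p.
    apply/polyP => i; rewrite coef_poly /entry mxE; case: ltnP => ik; first by rewrite inordK.
    by rewrite nth_default// sp.
  have ak : entry a k != 0.
    rewrite /entry mxE inordK// (_ : p`_k = lead_coef p); last by rewrite lead_coefE sp.
    by rewrite (monicP mp) oner_neq0.
  have a0 : a != 0 by apply: contra_neq ak => ->; rewrite entry0.
  move=> /(_ _ (proj_space_line a0))[_ /(_ a (line_of_refl a))].
  rewrite gen_disc_eval// ap; apply/eqP; rewrite mulf_neq0//.
  by rewrite resultant_separable ?monic_neq0// separable_prod_XsubC.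
move=> a a0 nB.
have nd : meval (a ord0) gen_disc != 0.
  apply/eqP => e; apply: nB; split; first exact: proj_space_line.
  exact: (hom_poly_fun_line (hom_poly_coord gen_disc_homog)).
have ak : entry a k != 0.
  move: nd; rewrite /gen_disc mevalM mulf_eq0 negb_or mevalXU => /andP[+ _].
  by rewrite (_ : ord_max = inord k)//; apply: val_inj; rewrite /= inordK.
have sp : size (row_poly a) = k.+1 by rewrite size_poly_eq.
have p0 : row_poly a != 0 by rewrite -size_poly_eq0 sp.
have sep : separable_poly (row_poly a).
  rewrite -resultant_separable//; move: nd; rewrite gen_disc_eval// mulf_eq0 negb_or.
  by case/andP.
have [rs prs] := closed_field_poly_normal (row_poly a).
have l0 : lead_coef (row_poly a) != 0 by rewrite lead_coef_eq0.
have urs : uniq rs.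
  move: sep; rewrite prs -separable_prod_XsubC separable_poly.unlock derivZ.
  by rewrite coprimepZl// coprimepZr.
have srs : size rs = k.
  by move: sp; rewrite {1}prs size_scale// size_prod_XsubC => -[].
have mem_rs x : (x \in rs) = ((row_poly a).[x] == 0).
  by rewrite {1}prs -/(root _ _) rootZ// root_prod_XsubC.
pose f (i : nat) : set 'rV[K]_k.+1 := line_of (veronese 1 (rs`_i)).
have st1 (x : K) : ((1 : K) != 0) || (x != 0) by rewrite oner_neq0.
have -> : rnc `&` hyperplane a = f @` `I_k.
  apply/seteqP; split=> [_ [[s [t [st ->]]] [_ hl]]|_ [i ik <-]]; last first.
    split; first exact: (rnc_veronese _ (st1 _)).
    split; first by apply: proj_space_line; exact: (veronese_neq0 _ (st1 _)).
    move=> _ [c _ <-]; under eq_bigr do rewrite mxE mulrCA.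
    rewrite -mulr_sumr -row_poly_eval; have : rs`_i \in rs by apply: mem_nth; rewrite srs.
    by rewrite mem_rs => /eqP ->; rewrite mulr0.
  have e := hl _ (line_of_refl _).
  have s0 : s != 0.
    apply/eqP => s0; move: st; rewrite s0 eqxx /= => t0; move: e.
    rewrite (bigD1 ord_max)//= big1 ?addr0 => [|j jm].
      rewrite mxE subnn expr0 mul1r => /eqP; rewrite mulf_eq0 expf_eq0 (negbTE t0) andbF orbF.
      by move/eqP => e; move/eqP: ak; apply; rewrite -[RHS]e /entry; congr (a _ _);
        apply: val_inj; rewrite /= inordK.
    rewrite mxE s0 expr0n subn_eq0 -ltnS (_ : (k < j.+1)%N = false) ?mul0r ?mulr0//.
    apply/negbTE; rewrite -leqNgt ltn_neqAle -ltnS ltn_ord andbT.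
    by apply: contra_neq jm => jk; apply: val_inj.
  have es : veronese s t = s ^+ k *: veronese 1 (t / s).
    by rewrite -veronese_scale mulr1 mulrCA divff// mulr1.
  have : t / s \in rs.
    rewrite mem_rs row_poly_eval; move: e; rewrite es.
    under eq_bigr do rewrite mxE mulrCA.
    by rewrite -mulr_sumr => /eqP; rewrite mulf_eq0 expf_eq0 (negbTE s0) andbF.
  move=> trs; exists (index (t / s) rs); first by rewrite /= -srs index_mem.
  by rewrite /f nth_index// es line_ofZ// expf_neq0.
apply: inj_card_eq => i j; rewrite !inE /= => ik jk e.
have [c c0] := line_ofP (veronese_neq0 _ (st1 _)) e => ec.
have c1 : c = 1.
  by have := congr1 (fun u => entry u 0) ec; rewrite /= entryZ !entry_veronese// !expr1n expr0
    !mulr1.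
have := congr1 (fun u => entry u 1) ec; rewrite /= c1 scale1r !entry_veronese// !expr1n !expr1
  !mul1r.
by move/eqP; rewrite nth_uniq ?srs// eq_sym => /eqP.
Qed.

Theorem rnc_rational_normal : rational_normal_curve_in rnc.
Proof.
split.
- split; last exact: rnc_dimension.
  by split; [exact: rnc_closed|exact: rnc_irreducible].
- exact: rnc_smooth.
- exact: rnc_nondegenerate.
- exact: rnc_birational.
- exact: rnc_degree.
Qed.

End Degree.

(** * Quadrics and the Cremona transformation *)

Section Reciprocals.
Context {K : numFieldType} {k : nat}.
Implicit Types (x : 'I_k -> K) (e : 'I_k -> 'I_k -> K) (T : set ('I_k -> K)).

Definition in_torus T := forall x, T x -> forall i, x i != 0.
Definition pairwise_independent T := forall i j, i != j ->
  exists x x', [/\ T x, T x' & x i * x' j != x j * x' i].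

(** The image of T by the Cremona transformation lies in a plane, parametrized
    by its coordinates p and q. *)
Definition reciprocal_plane T (p q : 'I_k) (a b : 'I_k -> K) :=
  p != q /\ forall x, T x -> forall m, (x m)^-1 = a m * (x p)^-1 + b m * (x q)^-1.

Lemma cyclic_quadric_degenerate e x p q r : (p == q) || (q == r) || (p == r) ->
  cyclic_quadric e x p q r = 0.
Proof. by rewrite /cyclic_quadric => /orP[/orP[]|] /eqP ->; ring. Qed.

(** Division by x_p x_q x_r. *)
Lemma cyclic_quadric_reciprocal e x p q r : (forall i, x i != 0) ->
  cyclic_quadric e x p q r = 0 ->
  (e q r - e p r) * (x r)^-1 + (e p q - e r q) * (x q)^-1 + (e r p - e q p) * (x p)^-1 = 0.
Proof.
move=> x0 h; have xp := x0 p; have xq := x0 q; have xr := x0 r.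
apply: (mulfI (mulf_neq0 (mulf_neq0 xp xq) xr)); rewrite mulr0 -[RHS]h /cyclic_quadric.
by field; rewrite xp xq xr.
Qed.

Lemma independent_reciprocals T i j c d : in_torus T -> pairwise_independent T -> i != j ->
  (forall x, T x -> c * (x i)^-1 + d * (x j)^-1 = 0) -> c = 0 /\ d = 0.
Proof.
move=> T0 Tp ij h; have [x [x' [Tx Tx' ne]]] := Tp i j ij.
have xi := T0 _ Tx i; have xj := T0 _ Tx j; have xi' := T0 _ Tx' i; have xj' := T0 _ Tx' j.
have e1 : c * x j + d * x i = 0.
  by rewrite -(mulr0 (x i * x j)) -(h x Tx); field; rewrite xi xj.
have e2 : c * x' j + d * x' i = 0.
  by rewrite -(mulr0 (x' i * x' j)) -(h x' Tx'); field; rewrite xi' xj'.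
have nz : x i * x' j - x j * x' i != 0 by rewrite subr_eq0.
split; apply: (mulfI nz); rewrite mulr0.
  by transitivity ((c * x' j + d * x' i) * x i - (c * x j + d * x i) * x' i);
    [ring|rewrite e1 e2; ring].
by transitivity ((c * x j + d * x i) * x' j - (c * x' j + d * x' i) * x j);
  [ring|rewrite e1 e2; ring].
Qed.

Section Structure.
Variables (T : set ('I_k -> K)) (e : 'I_k -> 'I_k -> K).
Hypotheses (T0 : in_torus T) (Tp : pairwise_independent T).
Hypothesis Te : forall x, T x -> forall p q r, cyclic_quadric e x p q r = 0.

(** If the coefficient of 1/x_m in the relation for (p, m, r) were 0, then 1/x_p
    and 1/x_r would be proportional on T. *)
Lemma third_reciprocal p m r : p != r -> e m r != e p r ->
  exists c d, forall x, T x -> (x m)^-1 = c * (x r)^-1 + d * (x p)^-1.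
Proof.
move=> pr ne.
pose al := e m r - e p r; pose be := e p m - e r m; pose ga := e r p - e m p.
have rel x : T x -> al * (x r)^-1 + be * (x m)^-1 + ga * (x p)^-1 = 0.
  by move=> Tx; exact: (cyclic_quadric_reciprocal (T0 Tx) (Te Tx p m r)).
have be0 : be != 0.
  apply/eqP => be0; have [] := @independent_reciprocals T r p al ga T0 Tp _ _.
  - by rewrite eq_sym.
  - by move=> x Tx; rewrite -[RHS](rel x Tx) be0 mul0r addr0.
  by move/eqP; rewrite subr_eq0 (negbTE ne).
exists (- al / be), (- ga / be) => x Tx; apply: (mulfI be0); apply/eqP.
rewrite -subr_eq0 -[X in _ == X](rel x Tx); apply/eqP; field.
by rewrite be0 (T0 Tx p) (T0 Tx r) (T0 Tx m).
Qed.

(** The relation for (p, q, r) gives 1/x_r. For every m, e m r differs from e p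
    r or from e q r, so that one of (p, m, r) and (q, m, r) gives 1/x_m; this is
    where the special form of the coefficients, differences of the e, is used. *)
Lemma plane_of_relation p q r : p != q -> p != r -> q != r -> e q r != e p r ->
  exists a b, reciprocal_plane T p q a b.
Proof.
move=> pq pr qr ne.
have [cr [dr hr]] : exists c d, forall x, T x -> (x r)^-1 = c * (x p)^-1 + d * (x q)^-1.
  have al0 : e q r - e p r != 0 by rewrite subr_eq0.
  exists (- (e r p - e q p) / (e q r - e p r)), (- (e p q - e r q) / (e q r - e p r)) => x Tx.
  have rel := cyclic_quadric_reciprocal (T0 Tx) (Te Tx p q r).
  apply: (mulfI al0); apply/eqP; rewrite -subr_eq0 -[X in _ == X]rel; apply/eqP; field.
  by rewrite al0 (T0 Tx p) (T0 Tx r) (T0 Tx q).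
have main m : exists cd : K * K, forall x, T x -> (x m)^-1 = cd.1 * (x p)^-1 + cd.2 * (x q)^-1.
  have [emp|emp] := eqVneq (e m r) (e p r).
    have [|c [d h]] := @third_reciprocal q m r qr; first by rewrite emp eq_sym.
    by exists (c * cr, c * dr + d) => x Tx; rewrite (h x Tx) (hr x Tx) /=; ring.
  have [c [d h]] := @third_reciprocal p m r pr emp.
  by exists (c * cr + d, c * dr) => x Tx; rewrite (h x Tx) (hr x Tx) /=; ring.
have [f hf] := choice main.
by exists (fun m => (f m).1), (fun m => (f m).2); split => // x Tx m; exact: hf.
Qed.

(** A quadric on T that is not identically 0 has a nonzero coefficient, to which
    [plane_of_relation] applies. *)
Lemma quadrics_vanish : (forall p q a b, ~ reciprocal_plane T p q a b) ->
  forall x p q r, cyclic_quadric e x p q r = 0.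
Proof.
move=> np x p q r.
case: (boolP ((p == q) || (q == r) || (p == r))) => [|]; first exact: cyclic_quadric_degenerate.
rewrite !negb_or => /andP[/andP[pq qr] pr].
have E i j l : i != j -> i != l -> j != l -> e j l = e i l.
  move=> ij il jl; apply/eqP/negPn/negP => ne.
  by have [a [b /np]] := plane_of_relation ij il jl ne.
have e1 : e q r = e p r by exact: E.
have e2 : e p q = e r q by apply: E; rewrite // eq_sym.
have e3 : e r p = e q p by apply: E; rewrite // eq_sym.
by rewrite /cyclic_quadric e1 e2 e3 !subrr !mulr0 !addr0.
Qed.

Variables (p0 q0 : 'I_k) (a b : 'I_k -> K).
Hypothesis plane : reciprocal_plane T p0 q0 a b.

(** Otherwise x_i and x_j would be proportional on T. *)
Lemma plane_slopes i j : i != j -> a i * b j - a j * b i != 0.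
Proof.
move=> ij; have [pq hT] := plane; have [x [x' [Tx Tx' ne]]] := Tp ij.
apply: contra_neq ne => e0.
have xi := T0 Tx i; have xj := T0 Tx j; have xi' := T0 Tx' i; have xj' := T0 Tx' j.
have : (x i)^-1 * (x' j)^-1 - (x j)^-1 * (x' i)^-1 = 0.
  transitivity ((a i * (x p0)^-1 + b i * (x q0)^-1) * (a j * (x' p0)^-1 + b j * (x' q0)^-1) -
     (a j * (x p0)^-1 + b j * (x q0)^-1) * (a i * (x' p0)^-1 + b i * (x' q0)^-1)).
    by congr (_ * _ - _ * _); exact: hT.
  transitivity ((a i * b j - a j * b i) *
    ((x p0)^-1 * (x' q0)^-1 - (x q0)^-1 * (x' p0)^-1)); first by ring.
  by rewrite e0 mul0r.
rewrite -!invfM => /eqP; rewrite subr_eq0 => /eqP/invr_inj ->; ring.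
Qed.

(** The inverse of the point s a + t b of the plane under the Cremona
    transformation, multiplied by the product of its coordinates so as to be
    defined where some of them are 0. *)
Definition cremona (s t : K) (i : 'I_k) : K := \prod_(j | j != i) (s * a j + t * b j).

(** The quadric takes the value G^2 Y_p Y_q Y_r times a linear form in s and t,
    where Y_j = s a_j + t b_j and G is the product of the other Y_j. The linear
    form is 0 because the reciprocals of two coordinates are independent on T. *)
Lemma cremona_quadrics s t p q r : cyclic_quadric e (cremona s t) p q r = 0.
Proof.
case: (boolP ((p == q) || (q == r) || (p == r))) => [|]; first exact: cyclic_quadric_degenerate.
rewrite !negb_or => /andP[/andP[pq qr] pr].
pose Y j := s * a j + t * b j.
pose G := \prod_(j | (j != p) && (j != q) && (j != r)) Y j.
have xp : cremona s t p = Y q * Y r * G.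
  rewrite /cremona (bigD1 q) 1?eq_sym//= (bigD1 r)/= ?mulrA; last first.
    by rewrite eq_sym pr eq_sym qr.
  by congr (_ * _); apply: eq_bigl => j.
have xq : cremona s t q = Y p * Y r * G.
  rewrite /cremona (bigD1 p)//= (bigD1 r)/= ?mulrA; last by rewrite eq_sym qr eq_sym pr.
  by congr (_ * _); apply: eq_bigl => j; rewrite [(j != q) && _]andbC.
have xr : cremona s t r = Y p * Y q * G.
  rewrite /cremona (bigD1 p)//= (bigD1 q)/= ?mulrA; last by rewrite qr eq_sym pq.
  by congr (_ * _); apply: eq_bigl => j; rewrite [in RHS]andbC andbA.
have [pq0 hT] := plane.
pose al := e q r - e p r; pose be := e p q - e r q; pose ga := e r p - e q p.
have [ea eb] : al * a r + be * a q + ga * a p = 0 /\ al * b r + be * b q + ga * b p = 0.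
  apply: (independent_reciprocals T0 Tp pq0) => x Tx.
  have := cyclic_quadric_reciprocal (T0 Tx) (Te Tx p q r); rewrite -/al -/be -/ga.
  move=> <-; transitivity (al * (a r * (x p0)^-1 + b r * (x q0)^-1) +
    be * (a q * (x p0)^-1 + b q * (x q0)^-1) + ga * (a p * (x p0)^-1 + b p * (x q0)^-1)).
    by ring.
  by congr (_ * _ + _ * _ + _ * _); rewrite -hT.
rewrite /cyclic_quadric xp xq xr -/al -/be -/ga.
transitivity (G ^+ 2 * Y p * Y q * Y r * (s * (al * a r + be * a q + ga * a p) +
   t * (al * b r + be * b q + ga * b p))); first by rewrite /Y; ring.
by rewrite ea eb !mulr0 addr0 mulr0.
Qed.

End Structure.

End Reciprocals.

Section BinaryForms.
Context {K : numFieldType}.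

Lemma binary_form (r : seq (K * K)) : exists c : nat -> K, forall s t,
  \prod_(ab <- r) (s * ab.1 + t * ab.2) =
  \sum_(m < (size r).+1) c m * (s ^+ (size r - m) * t ^+ m).
Proof.
elim: r => [|[a b] r [c ih]].
  by exists (fun=> 1) => s t; rewrite big_nil big_ord1 /= !expr0 !mulr1.
exists (fun m => a * (if (m <= size r)%N then c m else 0) +
                 b * (if m is m'.+1 then c m' else 0)) => s t.
rewrite big_cons ih /=; set d := size r.
under [RHS]eq_bigr do rewrite mulrDl.
rewrite [RHS]big_split /= [X in _ = X + _]big_ord_recr /= ltnn mulr0 mul0r addr0.
rewrite [X in _ = _ + X]big_ord_recl /= mulr0 mul0r add0r mulrDl !mulr_sumr.
congr (_ + _); apply: eq_bigr => m _.
  by rewrite -ltnS ltn_ord subSn -1?ltnS// exprS; ring.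
by rewrite /bump /= add1n subSS exprS; ring.
Qed.

End BinaryForms.

(** * Bases of linear spans in H^0 *)

Lemma wedge3Z (K : numFieldType) n (c : K) (al : 'rV[K]_n) (D : 'M[K]_n) p q r :
  wedge3 (c *: al) (c *: D) p q r = c * c * wedge3 al D p q r.
Proof. by rewrite /wedge3 !mxE; ring. Qed.

Section Frame.
Context {R : realType} {n : nat} {X : topologicalType}.
Context (M : complexAtlas R n X) (L : lineBundle M).
Local Notation K := (Cplx R).
Local Notation H0 := (twistedForm L).
Hypotheses (cX : connected [set: X]) (X0 : [set: X] !=set0).
Hypothesis (aX : algebraic_dimension M 0).

(** The forms are independent at some point, where the cotangent space has
    dimension n. In particular H^0 has finite dimension, which bounds the bases
    below. *)
Lemma lin_indep_le k (w : 'I_k -> H0) : lin_indep w -> (k <= n)%N.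
Proof.
move=> lw; have [x _ ix] := generic_independence cX aX X0 lw openT X0.
have [i cx] := chart_cover M x; have [a ax] := triv_cover L x.
by rewrite -(eqP ((indep_atP w cx ax).1 ix)) rank_leq_col.
Qed.

(** Evaluation at a point where the w_j are independent, followed by a right
    inverse of the matrix of their components. *)
Lemma dual_forms k (w : 'I_k -> H0) : lin_indep w ->
  exists xi : 'I_k -> {linear H0 -> K^o}, forall i j, xi i (w j) = (j == i)%:R.
Proof.
move=> lw; have [x _ ix] := generic_independence cX aX X0 lw openT X0.
have [i cx] := chart_cover M x; have [a ax] := triv_cover L x.
have /row_freeP[B AB] := (indep_atP w cx ax).1 ix.
pose f (l : 'I_k) (v : H0) : K^o := \sum_p triv a x (form_coef v i x p) * B p l.
have lf l : linear (f l).
  move=> c u v; rewrite /f scaler_sumr -big_split; apply: eq_bigr => p _.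
  have -> : triv a x (form_coef (c *: u + v) i x p) =
      c * triv a x (form_coef u i x p) + triv a x (form_coef v i x p).
    by rewrite form_coefD form_coefZ linearP.
  by rewrite mulrDl -mulrA.
pose g l : {linear H0 -> K^o} := HB.pack (f l) (GRing.isLinear.Build K H0 K^o _ (f l) (lf l)).
exists g => l j; have := congr1 (fun A : 'M[K]_k => A j l) AB.
by rewrite !mxE => <-; apply: eq_bigr => p _; rewrite mxE.
Qed.

Lemma dual_coord k (w : 'I_k -> H0) (xi : 'I_k -> {linear H0 -> K^o}) (c : 'I_k -> K) i :
  (forall i j, xi i (w j) = (j == i)%:R) -> xi i (\sum_j c j *: w j) = c i.
Proof.
move=> hx; rewrite linear_sum (bigD1 i)//= linearZ hx eqxx big1 ?addr0 => [|j ji].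
  by rewrite [LHS]mulr1.
by rewrite linearZ hx (negbTE ji) [LHS]mulr0.
Qed.

Lemma basis_of_points (Z : set (set H0)) :
  exists k (w : 'I_k -> H0), [/\ lin_indep w, forall i, w i != 0 /\ Z (line_of (w i)) &
    forall v, v != 0 -> Z (line_of v) -> exists c : 'I_k -> K, v = \sum_j c j *: w j].
Proof.
pose P k := `[< exists w : 'I_k -> H0, lin_indep w /\ forall i, w i != 0 /\ Z (line_of (w i)) >].
have P0 : exists k, P k.
  exists 0%N; apply/asboolP; exists (fun _ => 0); split; first by move=> c _ [].
  by case.
have Pn k : P k -> (k <= n)%N by move=> /asboolP[w [lw _]]; exact: lin_indep_le lw.
case: (ex_maxnP P0 Pn) => k /asboolP[w [lw hw]] kmax.
exists k, w; split => // v v0 Zv; apply: contrapT => nv.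
suff /kmax : P k.+1 by rewrite ltnn.
apply/asboolP; exists (fun i => if unlift ord0 i is Some j then w j else v); split; last first.
  by move=> i; case: unliftP => [j _|_]; [exact: hw|].
move=> c; rewrite big_ord_recl unlift_none.
under eq_bigr do rewrite liftK.
move=> e; have c0 : c ord0 = 0.
  apply/eqP/negPn/negP => c0; apply: nv; exists (fun j => - (c ord0)^-1 * c (lift ord0 j)).
  apply: (scalerI c0); rewrite scaler_sumr; apply/eqP; rewrite -subr_eq0 -sumrN -[X in _ == X]e.
  apply/eqP; congr (_ + _); apply: eq_bigr => j _.
  by rewrite scalerA mulrA mulrN divff// mulN1r scaleNr opprK.
rewrite c0 scale0r add0r in e; move=> j; case: (unliftP ord0 j) => [l ->|-> //].
exact: lw e l.
Qed.

Lemma integrableZ (c : K) (w : H0) : integrable_form w -> integrable_form (c *: w).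
Proof.
move=> iw i a z Dz p q r; have := iw i a z Dz p q r.
have e : c *: w = \sum_(j < 1) c *: w by rewrite big_ord1.
rewrite !wedge_dformE e (coef_row_comb (fun=> w) (fun=> c)) (curl_mx_comb (fun=> w) (fun=> c))//.
by rewrite !big_ord1 wedge3Z => ->; rewrite mulr0.
Qed.

Lemma foliation_spaceP (v : H0) : v != 0 -> foliation_space L (line_of v) <-> integrable_form v.
Proof.
move=> v0; split=> [[w [w0 iw] e]|iv]; last by exists v.
by have [c c0 ->] := line_ofP w0 e; exact: integrableZ.
Qed.

Lemma foliation_space_proj : foliation_space L `<=` proj_space.
Proof. by move=> _ [w [w0 _] <-]; exact: proj_space_line. Qed.

End Frame.

Section Spans.
Context {K : numClosedFieldType} {V : lmodType K} {k : nat} (w : 'I_k -> V).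

Definition span_pred : {pred V} := fun v => `[< exists c : 'I_k -> K, v = \sum_j c j *: w j >].

Lemma span_predP v : v \in span_pred <-> exists c : 'I_k -> K, v = \sum_j c j *: w j.
Proof. by split=> [/asboolP|h]; [|apply/asboolP]. Qed.

Lemma span_submod : submod_closed span_pred.
Proof.
split; first by apply/span_predP; exists (fun=> 0); rewrite big1// => j _; rewrite scale0r.
move=> c u v /span_predP[cu ->] /span_predP[cv ->]; apply/span_predP.
exists (fun j => c * cu j + cv j); rewrite scaler_sumr -big_split /=.
by apply: eq_bigr => j _; rewrite scalerDl scalerA.
Qed.

Definition proj_span : set (set V) := [set l | proj_space l /\ forall v, l v -> v \in span_pred].

Lemma proj_spanP v : v != 0 -> proj_span (line_of v) <-> v \in span_pred.
Proof.
move=> v0; split=> [[_ h]|h]; first exact: h (line_of_refl v).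
split; first exact: proj_space_line.
move=> _ [c _ <-]; rewrite -[c *: v]addr0; apply: (span_submod.2) => //.
exact: span_submod.1.
Qed.

Lemma proj_span_linear : linear_subspace proj_span.
Proof. by exists span_pred; split; first exact: span_submod. Qed.

Lemma proj_span_irreducible (i0 : 'I_k) : (forall i, w i != 0) -> irreducible_set proj_span.
Proof.
move=> w0; apply: irreducible_by_curves.
- exists (line_of (w i0)); apply/proj_spanP => //; apply/span_predP.
  exists (fun j => (j == i0)%:R); rewrite (bigD1 i0)//= eqxx scale1r big1 ?addr0// =>
    j /negbTE ->.
  by rewrite scale0r.
- by move=> l [].
move=> v v' v0 v'0 /(proj_spanP v0) sv /(proj_spanP v'0) sv'.
have hs t : v + t *: (v' - v) \in span_pred.
  rewrite addrC; apply: (span_submod.2) => //.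
  by rewrite addrC -scaleN1r; apply: (span_submod.2).
(* q is 0 at the only parameter where the line through v and v' may pass
   through 0. *)
pose q : {poly K} := if v' == v then 1 else if `[< exists t, v + t *: (v' - v) = 0 >]
   then 'X - (xget 0 [set t | v + t *: (v' - v) = 0])%:P else 1.
have q0 : q != 0.
  by rewrite /q; case: ifP => _; [|case: ifP => _]; rewrite ?oner_neq0 ?polyXsubC_eq0.
exists (fun t => v + t *: (v' - v)), 0, 1, 1, 1, q; split.
- move=> l; exists ((l v)%:P + (l (v' - v)) *: 'X) => t.
  by rewrite linearD linearZ !hornerE; congr (_ + _); rewrite mulrC.
- by rewrite scale0r addr0 scale1r.
- by rewrite !scale1r addrC subrK.
- by rewrite oner_neq0.
move=> t; rewrite /q => qt.
have nz : v + t *: (v' - v) != 0.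
  apply/eqP => e; move: qt; case: (eqVneq v' v) => [ev _|nv].
    by move: e; rewrite ev subrr scaler0 addr0; apply/eqP.
  case: asboolP => [_|]; last by case; exists t.
  have : v + xget 0 [set t | v + t *: (v' - v) = 0] *: (v' - v) = 0.
    exact: (@xgetPex _ 0 [set t | v + t *: (v' - v) = 0] (ex_intro _ t e)).
  rewrite -e => /addrI /eqP; rewrite -subr_eq0 -scalerBl scaler_eq0 !subr_eq0 (negbTE nv) orbF.
  by move=> /eqP ->; rewrite !hornerE subrr eqxx.
by split => //; apply/proj_spanP.
Qed.

End Spans.

(** * The irreducible components *)

Section CremonaCurve.
Context {K : numClosedFieldType} {V : lmodType K} (h : nat).
Local Notation k := h.+1.
Local Notation veronese := (@veronese K h).
Variables (w : 'I_k.+1 -> V) (a b : 'I_k.+1 -> K).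
Hypothesis slopes : forall i j, i != j -> a i * b j - a j * b i != 0.

Lemma cremona_coefs : exists C : 'M[K]_k.+1, forall s t i,
  cremona a b s t i = (C *m (veronese s t)^T) i ord0.
Proof.
have /choice[c hc] : forall i : 'I_k.+1, exists c : nat -> K, forall s t,
    cremona a b s t i = \sum_(m < k.+1) c m * (s ^+ (k - m) * t ^+ m).
  move=> i; have [c hc] := binary_form [seq (a j, b j) | j <- enum (predC1 i)].
  exists c => s t; have := hc s t.
  rewrite big_map size_map -cardE cardC1 card_ord /= => <-.
  by rewrite big_enum.
exists (\matrix_(i, m) c i m) => s t i.
by rewrite hc mxE; apply: eq_bigr => m _; rewrite !mxE.
Qed.

(** The binary forms [cremona a b] are linearly independent. *)
Lemma cremona_coefs_unit (C : 'M[K]_k.+1) :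
  (forall s t i, cremona a b s t i = (C *m (veronese s t)^T) i ord0) -> C \in unitmx.
Proof.
move=> hC; rewrite -row_free_unit; apply: row_free_ker => c c0.
apply/rowP => j; rewrite mxE.
(* all the binary forms but the j-th one vanish at (b_j, - a_j) *)
have e : (c *m (C *m (veronese (b j) (- a j))^T)) ord0 ord0 = 0 by rewrite mulmxA c0 mul0mx mxE.
move: e; rewrite mxE (bigD1 j)//= big1 ?addr0 => [|l lj].
  rewrite -hC => /eqP; rewrite mulf_eq0 => /orP[/eqP //|].
  rewrite /cremona prodf_seq_eq0 => /hasP[l _ /andP[lj]].
  by have := slopes lj; rewrite (_ : a l * b j - _ = b j * a l + - a j * b l) => [/negP//|]; ring.
rewrite -hC /cremona (bigD1 j) 1?eq_sym//= (_ : b j * a j + - a j * b j = 0); last by ring.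
by rewrite mul0r mulr0.
Qed.

Definition comb_map (C : 'M[K]_k.+1) (u : 'rV[K]_k.+1) : V :=
  \sum_i (C *m u^T) i ord0 *: w i.

Lemma comb_map_linear C : linear (comb_map C).
Proof.
move=> c u v; rewrite /comb_map scaler_sumr -big_split /=; apply: eq_bigr => i _.
have -> : (C *m (c *: u + v)^T) i ord0 = c * (C *m u^T) i ord0 + (C *m v^T) i ord0.
  by rewrite [(c *: u + v)^T]linearP mulmxDr -scalemxAr !mxE.
by rewrite scalerDl scalerA.
Qed.

End CremonaCurve.

(** In the coordinates given by phi, the curve [cremona] in the span of the w_i
    is the rational normal curve. The linear forms l invert phi on the span, and
    the polynomials x express the coordinates on w through l: they allow
    [irreducible_generic] to combine conditions on both systems of coordinates. *)
Lemma cremona_curve (K : numClosedFieldType) (V : lmodType K) (k : nat)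
    (w : 'I_k -> V) (xi : 'I_k -> {linear V -> K^o}) (a b : 'I_k -> K) :
  (1 < k)%N -> (forall i j, i != j -> a i * b j - a j * b i != 0) ->
  (forall i j, xi i (w j) = (j == i)%:R) ->
  exists h (phi : {linear 'rV[K]_h.+2 -> V}) (l : 'I_h.+2 -> {linear V -> K^o})
    (x : 'I_k -> mpoly h.+2 K),
  [/\ forall u m, l m (phi u) = u ord0 m,
      forall v, phi (\row_m l m v) = \sum_i (xi i v : K) *: w i,
      forall i, x i \is ishomog1 1 mdeg,
      forall i v, meval (l^~ v) (x i) = xi i v &
      forall s t, phi (veronese h s t) = \sum_i cremona a b s t i *: w i].
Proof.
case: k w xi a b => [|[|h]] w xi a b // _ sl xiw.
have [C hC] := cremona_coefs a b; have uC := cremona_coefs_unit sl hC.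
pose phi : {linear 'rV[K]_h.+2 -> V} :=
  HB.pack (comb_map w C) (GRing.isLinear.Build K _ _ _ (comb_map w C) (comb_map_linear w C)).
pose f (m : 'I_h.+2) (v : V) : K^o := \sum_i invmx C m i * xi i v.
have lf m : linear (f m).
  move=> c u v; rewrite /f scaler_sumr -big_split /=; apply: eq_bigr => i _.
  have -> : xi i (c *: u + v) = c * xi i u + xi i v by rewrite linearP.
  by rewrite mulrDr mulrCA.
pose l m : {linear V -> K^o} := HB.pack (f m) (GRing.isLinear.Build K V K^o _ (f m) (lf m)).
have xphi u i : xi i (phi u) = (C *m u^T) i ord0.
  rewrite /= /comb_map linear_sum (bigD1 i)//= linearZ xiw eqxx big1 ?addr0 => [|j ji].
    by rewrite [LHS]mulr1.
  by rewrite linearZ xiw (negbTE ji) [LHS]mulr0.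
have lE v : (\row_m (l m v : K)) = (invmx C *m \col_i (xi i v : K))^T.
  by apply/rowP => m; rewrite !mxE; apply: eq_bigr => i _; rewrite !mxE.
exists h, phi, l, (fun i => \sum_m C i m *: mpolyX K (mnm1 m)); split.
- move=> u m; transitivity ((\row_m (l m (phi u) : K)) ord0 m); first by rewrite mxE.
  rewrite lE (_ : \col_i _ = C *m u^T); first by rewrite mulKmx// trmxK.
  by apply/colP => i; rewrite mxE xphi.
- move=> v; rewrite /= /comb_map; apply: eq_bigr => i _; congr (_ *: _).
  by rewrite lE trmxK mulKVmx// mxE.
- by move=> i; apply: rpred_sum => m _; apply: dhomogZ; exact: homogX.
- move=> i v; rewrite raddf_sum /=.
  transitivity ((C *m (\row_m (l m v : K))^T) i ord0).
    by rewrite mxE; apply: eq_bigr => m _; rewrite mevalZ mevalXU !mxE.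
  by rewrite lE trmxK mulKVmx// mxE.
- by move=> s t; rewrite /= /comb_map; apply: eq_bigr => i _; rewrite hC.
Qed.

Section Components.
Context {R : realType} {n : nat} {X : topologicalType}.
Context (M : complexAtlas R n X) (L : lineBundle M).
Local Notation K := (Cplx R).
Local Notation H0 := (twistedForm L).
Hypotheses (cX : connected [set: X]) (X0 : [set: X] !=set0).
Hypothesis (aX : algebraic_dimension M 0).
Variable Z : set (set H0).
Hypothesis Zcomp : irreducible_component (foliation_space L) Z.

Let ZF : Z `<=` foliation_space L. Proof. by case: Zcomp. Qed.
Let Zirr : irreducible_set Z. Proof. by case: Zcomp. Qed.
Let Zmax Z' : irreducible_set Z' -> Z `<=` Z' -> Z' `<=` foliation_space L -> Z' = Z.
Proof. by case: Zcomp => _ _; exact. Qed.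
Let Zp : Z `<=` proj_space.
Proof. by move=> l /ZF; exact: foliation_space_proj. Qed.

Variables (k : nat) (w : 'I_k -> H0) (xi : 'I_k -> {linear H0 -> K^o}).
Hypotheses (lw : lin_indep w) (wZ : forall i, w i != 0 /\ Z (line_of (w i))).
Hypothesis wspan : forall v, v != 0 -> Z (line_of v) ->
  exists c : 'I_k -> K, v = \sum_j c j *: w j.
Hypothesis xiw : forall i j, xi i (w j) = (j == i)%:R.

Definition comb (c : 'I_k -> K) : H0 := \sum_j c j *: w j.

Lemma xi_comb c i : xi i (comb c) = c i.
Proof. exact: dual_coord. Qed.

Lemma span_coords v : v != 0 -> Z (line_of v) -> v = comb (fun i => xi i v).
Proof.
move=> v0 Zv; have [c ec] := wspan v0 Zv; rewrite {1}ec; apply: eq_bigr => j _.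
by rewrite ec (xi_comb c).
Qed.

(** The points of Z to which the Cremona transformation applies. *)
Definition torus : set ('I_k -> K) :=
  [set c | (forall i, c i != 0) /\ Z (line_of (comb c))].

(** The k coordinates xi, being homogeneous polynomials in the same linear forms
    l as P, are nonzero together with P at some point of the irreducible set Z. *)
Lemma torus_generic (m : nat) (l : 'I_m -> {linear H0 -> K^o}) (x : 'I_k -> mpoly m K)
    (P : mpoly m K) d v :
  (forall i u, meval (l^~ u) (x i) = xi i u) -> (forall i, x i \is ishomog1 1 mdeg) ->
  P \is ishomog1 d mdeg -> v != 0 -> Z (line_of v) -> meval (l^~ v) P != 0 ->
  exists u, [/\ u != 0, Z (line_of u), torus (fun i => xi i u) & meval (l^~ u) P != 0].
Proof.
move=> xE xh hP v0 Zv Pv.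
have [||u [u0 Zu hu]] := irreducible_generic (l := l) (s :=
  P :: [seq x i | i <- enum 'I_k]) Zirr Zp.
- move=> Q; rewrite inE => /predU1P[->|/mapP[i _ ->]]; first by exists d.
  by exists 1%N; exact: xh.
- move=> Q; rewrite inE => /predU1P[->|/mapP[i _ ->]]; first by exists v.
  have [wi0 Zwi] := wZ i; exists (w i); split; [exact: wi0|exact: Zwi|].
  by rewrite xE xiw eqxx oner_neq0.
exists u; split; [exact: u0|exact: Zu| |by apply: hu; exact: mem_head].
split; last by rewrite -(span_coords u0 Zu).
move=> i; rewrite -xE; apply: hu; rewrite inE map_f ?orbT// mem_enum//.
Qed.

Local Notation mX i := (mpolyX K (mnm1 i)).

Lemma mX_xi i u : meval (xi^~ u) (mX i) = xi i u.
Proof. by rewrite mevalXU. Qed.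

Lemma torus_nonempty : exists c, torus c.
Proof.
have [[l Zl] _] := Zirr; have [v v0 e] := proj_space_lineP (Zp Zl); subst l.
have [||u [_ _ Tu _]] := torus_generic (P := 1) (d := 0) mX_xi (fun i => homogX i) _ v0 Zl.
- exact: dhomog1.
- by rewrite meval1 oner_neq0.
by exists (fun i => xi i u).
Qed.

Lemma torus_in_torus : in_torus torus.
Proof. by move=> c []. Qed.

(** With x in the torus, the equation x_i xi_j = x_j xi_i fails at w_j, hence at
    some point of the torus. *)
Lemma torus_independent : pairwise_independent torus.
Proof.
move=> i j ij; have [x Tx] := torus_nonempty; have [x0 _] := Tx.
pose P : mpoly k K := x i *: mX j - x j *: mX i.
have hP : P \is ishomog1 1 mdeg.
  by apply: dhomogD; rewrite ?dhomogN; apply: dhomogZ; exact: homogX.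
have PE u : meval (xi^~ u) P = x i * xi j u - x j * xi i u.
  by rewrite /P mevalB !mevalZ !mevalXU.
have [wj0 Zwj] := wZ j.
have Pw : meval (xi^~ (w j)) P != 0.
  rewrite PE !xiw eqxx [j == i]eq_sym (negbTE ij) mulr1 mulr0 subr0; exact: x0.
have [u [_ _ Tu]] := torus_generic mX_xi (fun i => homogX i) hP wj0 Zwj Pw.
by rewrite PE subr_eq0 => ne; exists x, (fun i => xi i u); split.
Qed.

Lemma Z_integrable v : v != 0 -> Z (line_of v) -> integrable_form v.
Proof. by move=> v0 /ZF /(foliation_spaceP v0). Qed.

Lemma torus_integrable c : torus c -> integrable_form (comb c).
Proof.
move=> [c0 Zc]; have [z|nz] := eqVneq (comb c) 0; last exact: Z_integrable.
have [v v0 e] := proj_space_lineP (Zp Zc); rewrite e in Zc.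
by rewrite z -(scale0r v); apply: integrableZ; exact: Z_integrable.
Qed.

(** Integrability may be tested at the generic points, where it amounts to
    quadrics that hold on the torus; among these the binomials have coefficient
    0, since the torus has a point. *)
Lemma integrable_by_quadrics c :
  (forall e, (forall x, torus x -> forall p q r, cyclic_quadric e x p q r = 0) ->
     forall p q r, cyclic_quadric e c p q r = 0) ->
  integrable_form (comb c).
Proof.
move=> hc; apply: integrable_dense => O oO O0.
have [x Ox ix] := generic_independence cX aX X0 lw oO O0.
exists x => // i a cx ax.
have iw j : integrable_form (w j) by have [w0 Zw] := wZ j; exact: Z_integrable.
have [m [e [e' H]]] := integrable_comb_at iw ix cx ax.
have Tq y : torus y -> (forall p q r, cyclic_quadric e y p q r = 0) /\
    (forall p q s, y p * y q * (e' q s - e' p s) = 0).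
  by move=> Ty; apply/H => p q r; apply: torus_integrable => //; exists x.
apply/H; split; first by apply: hc => y /Tq[].
have [y Ty] := torus_nonempty; have [_ h] := Tq y Ty; move=> p q s.
have := h p q s => /eqP; rewrite !mulf_eq0 !(negbTE (torus_in_torus Ty _)) /=.
by move=> /eqP ->; rewrite mulr0.
Qed.

(** The quadrics vanish identically, so that the span, which is irreducible,
    consists of foliations. *)
Lemma linear_case : (forall p q a b, ~ reciprocal_plane torus p q a b) ->
  linear_subspace Z.
Proof.
move=> np; suff <- : proj_span w = Z by exact: proj_span_linear.
have sub : Z `<=` proj_span w.
  move=> l Zl; have [v v0 e] := proj_space_lineP (Zp Zl); subst l.
  by apply/proj_spanP => //; apply/span_predP; exact: wspan.
apply: Zmax => //.
- have [[l Zl] _] := Zirr; have [v v0 e] := proj_space_lineP (Zp Zl); subst l.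
  have [c ec] := wspan v0 Zl.
  have [i0 _|none] := pickP (predT : pred 'I_k).
    by apply: (proj_span_irreducible i0) => i; have [] := wZ i.
  by move: v0; rewrite ec big1 ?eqxx// => i _; have := none i.
- move=> l Wl; have [v v0 e] := proj_space_lineP Wl.1; subst l.
  apply/foliation_spaceP => //; have /proj_spanP-/(_ v0)/span_predP[c ->] := Wl.
  apply: integrable_by_quadrics => e he p q r.
  exact: (quadrics_vanish torus_in_torus torus_independent he np).
Qed.

(** The points of the curve are integrable because they satisfy the quadrics.
    Conversely the generic points of Z are on the curve, by definition of the
    plane; since the curve is closed, a minor that is nonzero somewhere on Z
    would be nonzero at one of these generic points. Maximality gives the
    equality. *)
Lemma curve_case p q a b : reciprocal_plane torus p q a b -> rational_normal_curve Z.
Proof.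
move=> pl; have [pq hT] := pl.
have k1 : (1 < k)%N.
  rewrite ltnNge; apply/negP => k1; move/eqP: pq; apply; apply: val_inj => /=.
  have := leq_trans (ltn_ord p) k1; have := leq_trans (ltn_ord q) k1.
  by rewrite !ltnS !leqn0 => /eqP -> /eqP ->.
have sl := plane_slopes torus_in_torus torus_independent pl.
have [h [phi [l [x [lphi phil xh xE phiE]]]]] := cremona_curve k1 sl xiw.
have inj : injective phi.
  by move=> u v e; apply/rowP => m; rewrite -!lphi e.
have phi0 u : u != 0 -> phi u != 0 by move=> u0; rewrite -(linear0 phi) inj_eq.
have eZ : proj_image phi (@rnc K h) = Z.
  apply: Zmax.
  - by apply: irreducible_image => //; [exact: rnc_proj|exact: rnc_irreducible].
  - move=> L' ZL'; have [v v0 e] := proj_space_lineP (Zp ZL'); subst L'.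
    pose u : 'rV[K]_h.+2 := \row_m l m v.
    have phiu : phi u = v by rewrite phil [RHS](span_coords v0 ZL').
    have u0 : u != 0 by apply: contra_neq v0 => u0; rewrite -phiu u0 linear0.
    exists (line_of u); last by rewrite line_of_image phiu.
    apply/(rncP u0) => i j ik jk; apply/eqP; rewrite -subr_eq0; apply/negPn/negP => ne.
    pose P := minor_poly (K := K) (inord i) (inord j.+1) (inord i.+1 : 'I_h.+2) (inord j).
    have PE v' : meval (l^~ v') P = l (inord i) v' * l (inord j.+1) v' - l (inord i.+1) v' * l
      (inord j) v'.
      by rewrite /P /minor_poly mevalB !mevalM !mevalXU.
    have Pv : meval (l^~ v) P != 0 by move: ne; rewrite PE /entry !mxE.
    have [v' [v'0 Zv' Tv']] := torus_generic xE xh (minor_poly_homog _ _ _ _) v0 ZL' Pv.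
    apply/negP; rewrite negbK PE.
    (* v' is the point of the curve with these parameters, up to the factor
       prod_j Y_j. *)
    pose s := (xi p v')^-1; pose t := (xi q v')^-1.
    pose Y i := s * a i + t * b i.
    have xY i' : xi i' v' = (\prod_j Y j)^-1 * cremona a b s t i'.
      have := hT _ Tv' i'; rewrite mulrC [b _ * _]mulrC -/s -/t -/(Y i') => eY.
      have Y0 j' : Y j' != 0.
        have := hT _ Tv' j'; rewrite mulrC [b _ * _]mulrC -/s -/t -/(Y j') => <-.
        by rewrite invr_eq0; case: Tv'.
      rewrite (bigD1 i')//= -/(cremona a b s t i') invfM -eY invrK mulfVK//.
      by apply/prodf_neq0 => j' _; exact: Y0.
    have ev : v' = phi ((\prod_j Y j)^-1 *: veronese h s t).
      rewrite linearZ phiE [RHS]scaler_sumr {1}(span_coords v'0 Zv'); apply: eq_bigr => i' _.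
      by rewrite scalerA -xY.
    rewrite ev !lphi; have := veronese_minors s t ik jk; rewrite /entry => em.
    rewrite ![(_ *: veronese h s t) _ _]mxE; apply/eqP.
    move: em; set A := veronese _ _ _ _ _; set B := veronese _ _ _ _ _;
      set D := veronese _ _ _ _ _; set E := veronese _ _ _ _ _.
    by move=> em; transitivity ((\prod_j Y j)^-1 ^+ 2 * (A * B - D * E));
      [ring|rewrite em subrr mulr0].
  - move=> _ [_ [s [t [st ->]]] <-]; rewrite line_of_image.
    apply/foliation_spaceP; first exact/phi0/veronese_neq0.
    rewrite phiE; apply: integrable_by_quadrics => e he p' q' r'.
    exact: (cremona_quadrics torus_in_torus torus_independent he pl).
exists h.+1, phi, (@rnc K h); split => //; last exact: rnc_rational_normal.
apply/seteqP; split.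
  apply: smallest_sub; last first.
    rewrite -eZ => _ [l' Dl' <-]; exists l' => //; exact: rnc_proj.
  exists (fun v => `[< exists u, v = phi u >]); split.
    split; first by apply/asboolP; exists 0; rewrite linear0.
    move=> c u v /asboolP[u' ->] /asboolP[v' ->]; apply/asboolP; exists (c *: u' + v').
    by rewrite linearP.
  apply/seteqP; split=> [_ [l' /proj_space_lineP[u u0 ->] <-]|l' [/proj_space_lineP[v v0 ->] hv]].
    rewrite line_of_image; split; first exact/proj_space_line/phi0.
    move=> _ [c _ <-]; apply/asboolP; exists (c *: u); by rewrite linearZ.
  have /asboolP[u eu] := hv v (line_of_refl v).
  exists (line_of u); last by rewrite line_of_image -eu.
  by apply: proj_space_line; apply: contra_neq v0 => u0; rewrite eu u0 linear0.
move=> _ [l' /proj_space_lineP[u u0 ->] <-]; rewrite line_of_image => A [[W [Wm ->]] ZW].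
split; first exact/proj_space_line/phi0.
have Ww i : w i \in W.
  by have [wi0 Zwi] := wZ i; have [_] := ZW _ Zwi; apply; exact: line_of_refl.
have WD v v' : v \in W -> v' \in W -> v + v' \in W.
  by move=> vW v'W; rewrite -[v]scale1r; apply: Wm.2.
have WZ c v : v \in W -> c *: v \in W.
  by move=> vW; rewrite -[c *: v]addr0; apply: Wm.2 => //; exact: Wm.1.
move=> _ [c _ <-]; apply: (WZ c).
have eu : u = \row_m l m (phi u) by apply/rowP => m; rewrite mxE lphi.
rewrite eu phil; apply: (big_ind (fun v => v \in W)); [exact: Wm.1|exact: WD|].
by move=> i _; exact: WZ.
Qed.

End Components.

Theorem corollary3 (R : realType) (n : nat) (X : topologicalType)
  (M : complexAtlas R n X) (L : lineBundle M)
  (X_nonempty : [set: X] !=set0) (X_hausdorff : hausdorff_space X)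
  (X_connected : connected [set: X]) (X_compact : compact [set: X])
  (aX0 : algebraic_dimension M 0)
  (Z : set (set (twistedForm L))) :
  irreducible_component (foliation_space L) Z ->
  linear_subspace Z \/ rational_normal_curve Z.
Proof.
move=> Zcomp.
have [k [w [lw wZ wspan]]] := basis_of_points X_connected X_nonempty aX0 Z.
have [xi xiw] := dual_forms X_connected X_nonempty aX0 lw.
have [[p [q [a [b pl]]]]|np] := pselect (exists p q a b, reciprocal_plane (torus Z w) p q a b).
  by right; apply: (curve_case X_connected X_nonempty aX0 Zcomp lw wZ wspan xiw pl).
left; apply: (linear_case X_connected X_nonempty aX0 Zcomp lw wZ wspan xiw).
by move=> p q a b pl; apply: np; exists p, q, a, b.
Qed.
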